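(* Let $1\le m<n$, $c_m=\frac{n-m}{m}$, $0<\alpha<c_m$ and $\gamma>\alpha/n$. On a sufficiently small ball centered at the origin of $\mathbb C^n$, define $$\varphi_{\alpha,\gamma}(z)=-|z|^{-2\alpha}\bigl(-\log|z|^2\bigr)^{-\gamma},\qquad z\ne0,$$ and set $\varphi_{\alpha,\gamma}(0)=-\infty$. Then $\varphi_{\alpha,\gamma}$ is $m$-subharmonic (on such a ball) and satisfies $$\{p>0:|\varphi_{\alpha,\gamma}|^p\text{ is integrable in a neighborhood of }0\}=\left(0,\frac n\alpha\right].$$
   Context: Let $\beta=dd^c|z|^2$ on $\mathbb C^n$. A real constant-coefficient $(1,1)$-form $\alpha$ is $m$-positive if $\alpha^k\wedge\beta^{n-k}\ge0$ for $1\le k\le m$. For an open set $\Omega\subset\mathbb C^n$, a locally integrable, upper semicontinuous function $u:\Omega\to[-\infty,\infty)$ is $m$-subharmonic, written $u\in \mathrm{SH}_m(\Omega)$, if it is subharmonic and $dd^c u\wedge\alpha_1\wedge\cdots\wedge\alpha_{m-1}\wedge\beta^{n-m}\ge0$ (as a current) for all constant-coefficient $m$-positive $(1,1)$-forms $\alpha_j$. For $u\in C^2$ this is equivalent to nonnegativity of the first $m$ elementary symmetric functions of the eigenvalues of the complex Hessian. *)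

(* Defs.v *)
From HB Require Import structures.
From mathcomp Require Import all_boot all_order all_algebra all_fingroup.
From mathcomp Require Import complex.
From mathcomp Require Import all_classical all_reals all_analysis.

Set Implicit Arguments.
Unset Strict Implicit.
Unset Printing Implicit Defensive.

Import Order.TTheory GRing.Theory Num.Theory.
Import numFieldNormedType.Exports.

Local Open Scope classical_set_scope.
Local Open Scope complex_scope.
Local Open Scope ring_scope.

(* Lebesgue measure on R^d is built on [d.-tuple R], which carries the product Borel
    sigma-algebra, as the iterated product of the one-dimensional Lebesgue
    measure. *)

Section lebesgue_cons.
Context {R : realType} (d : nat).
Variable mu : {sigma_finite_measure set (d.-tuple (measurableTypeR R)) -> \bar R}.

Definition tcons (p : measurableTypeR R * d.-tuple (measurableTypeR R)) :
  d.+1.-tuple (measurableTypeR R) := [the d.+1.-tuple _ of p.1 :: p.2].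

Lemma measurable_tcons : measurable_fun [set: _] tcons.
Proof. exact: measurable_cons. Qed.

Definition lebesgue_cons : set (d.+1.-tuple (measurableTypeR R)) -> \bar R :=
  pushforward (@lebesgue_measure R \x mu)%E tcons.

Let lebesgue_cons0 : lebesgue_cons set0 = 0%E.
Proof. by rewrite /lebesgue_cons /pushforward preimage_set0 measure0. Qed.

Let lebesgue_cons_ge0 A : (0 <= lebesgue_cons A)%E.
Proof. exact: (measure_ge0 (@lebesgue_measure R \x mu)%E). Qed.

Let lebesgue_cons_sigma_additive : semi_sigma_additive lebesgue_cons.
Proof.
move=> F mF tF mUF; rewrite /lebesgue_cons /pushforward preimage_bigcup.
have mF' k : measurable (tcons @^-1` F k).
  by rewrite -[X in measurable X]setTI; exact: measurable_tcons.
apply: (@measure_semi_sigma_additive _ _ _ (@lebesgue_measure R \x mu)%E) => //.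
  apply/trivIsetP => i j _ _ ij; rewrite -preimage_setI.
  by move/trivIsetP : tF => -> //; rewrite preimage_set0.
exact: bigcup_measurable.
Qed.

HB.instance Definition _ := isMeasure.Build _ _ _ lebesgue_cons
  lebesgue_cons0 lebesgue_cons_ge0 lebesgue_cons_sigma_additive.

Let lebesgue_cons_sigma_finite : sigma_finite setT lebesgue_cons.
Proof.
have /sigma_finiteP[F [TF ndF Foo]] := sigma_finiteT (@lebesgue_measure R).
have /sigma_finiteP[G [TG ndG Goo]] := sigma_finiteT mu.
pose tail (t : d.+1.-tuple (measurableTypeR R)) : d.-tuple (measurableTypeR R) :=
  [tuple of behead t].
pose head (t : d.+1.-tuple (measurableTypeR R)) := tnth t ord0.
have headK x : head (tcons x) = x.1 by [].
have tailK x : tail (tcons x) = x.2 by exact: val_inj.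
exists (fun k => head @^-1` F k `&` tail @^-1` G k).
  apply/esym; rewrite -subTset => t _.
  have [i _ Fi] : (\bigcup_i F i) (head t) by rewrite -TF.
  have [j _ Gj] : (\bigcup_i G i) (tail t) by rewrite -TG.
  exists (maxn i j) => //; split.
    by apply: (subsetPset _ _ (ndF _ _ (leq_maxl i j))).
  by apply: (subsetPset _ _ (ndG _ _ (leq_maxr i j))).
move=> k; have [mFk Fkoo] := Foo k; have [mGk Gkoo] := Goo k; split.
  apply: measurableI; rewrite -[X in measurable X]setTI.
    exact: (measurable_tnth ord0).
  exact: measurable_behead.
rewrite /lebesgue_cons /pushforward.
rewrite (_ : _ @^-1` _ = F k `*` G k); last first.
  by apply/seteqP; split => x /=; rewrite headK tailK.
by rewrite product_measure1E// lte_mul_pinfty// ge0_fin_numE.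
Qed.

HB.instance Definition _ := Measure_isSigmaFinite.Build _ _ _ lebesgue_cons
  lebesgue_cons_sigma_finite.

End lebesgue_cons.

Fixpoint lebesgue {R : realType} (d : nat) :
    {sigma_finite_measure set (d.-tuple (measurableTypeR R)) -> \bar R} :=
  match d with
  | 0 => \d_([tuple] : 0.-tuple (measurableTypeR R))
  | d'.+1 => lebesgue_cons (lebesgue d')
  end.

(* C^n is identified with R^(2n), represented by ['rV[R]_(n + n)]: the first
    [n] entries are x_1, ..., x_n and the last [n] entries y_1, ..., y_n, where
    z_j = x_j + i y_j. *)

Section complex_space.
Context {R : realType} {n : nat}.
Local Notation Cn := ('rV[R]_(n + n)).

Definition zcoord (z : Cn) (j : 'I_n) : R[i] :=
  z ord0 (lshift n j) +i* z ord0 (rshift n j).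

(* The Euclidean norm |z|; the library norm on row vectors is the sup norm,
   which induces the same topology. *)
Definition cnorm (z : Cn) : R :=
  Num.sqrt (\sum_(j < n) (complex.Re (zcoord z j) ^+ 2 + complex.Im (zcoord z j) ^+ 2)).

Definition cball (a : Cn) (r : R) : set Cn := [set z | cnorm (z - a) < r].
Definition cclosed_ball (a : Cn) (r : R) : set Cn := [set z | cnorm (z - a) <= r].

Definition of_tuple (t : (n + n).-tuple (measurableTypeR R)) : Cn :=
  \row_j (tnth t j : R).

Definition cvolume (A : set Cn) : \bar R := lebesgue (n + n) (of_tuple @^-1` A).

Definition cintegral (A : set Cn) (f : Cn -> \bar R) : \bar R :=
  (\int[lebesgue (n + n)]_(t in of_tuple @^-1` A) f (of_tuple t))%E.

Definition cintegrable (A : set Cn) (f : Cn -> \bar R) : Prop :=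
  (lebesgue (n + n)).-integrable (of_tuple @^-1` A) (f \o of_tuple).

Definition clocally_integrable (Omega : set Cn) (f : Cn -> \bar R) : Prop :=
  forall K, compact K -> K `<=` Omega -> cintegrable K f.

Definition integrable_near (Omega : set Cn) (a : Cn) (f : Cn -> \bar R) : Prop :=
  exists U, [/\ open U, U a, U `<=` Omega & cintegrable U f].

Definition partial (k : 'I_(n + n)) (f : Cn -> R) : Cn -> R :=
  fun z => 'D_(delta_mx ord0 k) f z.

Definition smooth (f : Cn -> R) : Prop :=
  forall (s : seq 'I_(n + n)) (z : Cn), differentiable (foldr partial f s) z.

Definition test_function (Omega : set Cn) (chi : Cn -> R) : Prop :=
  smooth chi /\
  exists K, [/\ compact K, K `<=` Omega & forall z, ~ K z -> chi z = 0].

(* The matrix [A] stands for the (1,1)-form i sum_(j,k) A_jk dz_j /\ dzbar_k at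
    a point; the form is real iff [A] is Hermitian. *)

Definition real_form (A : 'M[R[i]]_n) : Prop :=
  forall j k, A k j = (A j k)^*.

(* dd^c is normalised as i d dbar, i.e. d^c = (i/2)(dbar - d). In real
   coordinates, 4 d^2/(dz_j dzbar_k) is
   (d/dx_j - i d/dy_j) (d/dx_k + i d/dy_k). *)
Definition ddc (f : Cn -> R) (z : Cn) : 'M[R[i]]_n :=
  \matrix_(j, k)
    let x := @lshift n n in let y := @rshift n n in
    ((partial (x j) (partial (x k) f) z + partial (y j) (partial (y k) f) z) / 4) +i*
    ((partial (x j) (partial (y k) f) z - partial (y j) (partial (x k) f) z) / 4).

(* beta = dd^c |z|^2 = i sum_j dz_j /\ dzbar_j *)
Definition beta : 'M[R[i]]_n := 1%:M.

(* The coefficient of A_1 /\ ... /\ A_n (for a list of n forms) with respect to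
   the positive volume form (i dz_1 /\ dzbar_1) /\ ... /\ (i dz_n /\ dzbar_n)
   = 2^n dx_1 /\ dy_1 /\ ... /\ dx_n /\ dy_n. In the multilinear expansion only
   the terms in which the dz's and the dzbar's occur along permutations sigma,
   tau survive; (1,1)-forms commute, so reordering the dz's and dzbar's in such a
   term costs the sign of sigma times the sign of tau. *)
Definition wedge (s : seq 'M[R[i]]_n) : R[i] :=
  \sum_(sigma : 'S_n) \sum_(tau : 'S_n)
    (-1) ^+ sigma * (-1) ^+ tau * \prod_(l < n) (nth 0 s l) (sigma l) (tau l).

(* [0 <= w] in R[i] means that w is real and nonnegative. *)
Definition m_positive (m : nat) (A : 'M[R[i]]_n) : Prop :=
  real_form A /\
  forall k, (1 <= k <= m)%N -> 0 <= wedge (nseq k A ++ nseq (n - k) beta).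

Definition usc_on (Omega : set Cn) (u : Cn -> \bar R) : Prop :=
  forall z, Omega z -> forall a : R, (u z < a%:E)%E -> \forall w \near z, (u w < a%:E)%E.

(* Subharmonicity on Omega, a subset of R^(2n), by the mean value inequality over
   closed balls, written without dividing by the volume of the ball. *)
Definition subharmonic (Omega : set Cn) (u : Cn -> \bar R) : Prop :=
  usc_on Omega u /\
  forall (a : Cn) (r : R), 0 < r -> cclosed_ball a r `<=` Omega ->
    (u a * cvolume (cclosed_ball a r) <= cintegral (cclosed_ball a r) u)%E.

(* dd^c u /\ al_1 /\ ... /\ al_(m-1) /\ beta^(n-m) >= 0 on Omega in the sense of
   currents: as the al_j and beta are closed, the pairing with a test function
   chi is the integral of u dd^c chi /\ al_1 /\ ... /\ beta^(n-m), here up to the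
   factor 2^n relating the volume form of [wedge] to Lebesgue measure. *)
Definition positive_current (Omega : set Cn) (u : Cn -> \bar R)
    (al : seq 'M[R[i]]_n) (k : nat) : Prop :=
  forall chi, test_function Omega chi -> (forall z, 0 <= chi z) ->
    (0 <= cintegral Omega (fun z =>
       u z * (complex.Re (wedge (ddc chi z :: al ++ nseq k beta)))%:E))%E.

Definition m_subharmonic (m : nat) (Omega : set Cn) (u : Cn -> \bar R) : Prop :=
  [/\ open Omega,
      forall z, Omega z -> (u z < +oo)%E,
      clocally_integrable Omega u,
      subharmonic Omega u &
      forall al : (m.-1).-tuple 'M[R[i]]_n,
        (forall j, m_positive m (tnth al j)) ->
        positive_current Omega u al (n - m)].

Definition phi (alpha gamma : R) (z : Cn) : \bar R :=
  if z == 0 then -oo%E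
  else (- (cnorm z `^ (- (2 * alpha)) * (- ln (cnorm z ^+ 2)) `^ (- gamma)))%:E.

End complex_space.

(* Main.v *)
(* Put L = - log |z|^2 and h(s) = - s^(-alpha) L^(-gamma) with s = |z|^2. For
   small s one has h' >= 0 >= h'' and n h' + m s h'' >= 0, the last because
   alpha < (n - m)/m, so dd^c h(|z|^2 + e) = h' beta + h'' (rank one form) is
   m-positive near 0 for all small e > 0. Garding's inequality then makes its
   product with m-positive forms and powers of beta nonnegative. It is proved by
   hyperbolicity: the mixed forms, as polynomials in a real direction, have no
   roots in a half-plane, a property preserved by differentiation (Gauss-Lucas).
   Letting e tend to 0, with |h(|z|^2 + e)| <= |h(|z|^2)| integrable, transfers
   the integrated positivity and the mean value inequality to phi.
   For the exponents, the shells exp(-(k + 1)) < |z|^2 <= exp(-k) contribute a term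
   of order k^(-p gamma) to the integral of |phi|^p at the critical p = n/alpha,
   where p gamma > 1; for p > n/alpha the value of |phi|^p on the boundary of a
   small cube times the volume of the cube is already unbounded. *)
Require Import Defs.
From HB Require Import structures.
From mathcomp Require Import all_boot all_order all_algebra all_fingroup.
From mathcomp Require Import complex.
From mathcomp Require Import all_classical all_reals all_analysis.
From mathcomp Require Import measurable_realfun ring lra zify.

Import Order.TTheory GRing.Theory Num.Theory.
Import numFieldNormedType.Exports.
Import ComplexField.Normc.

Local Open Scope classical_set_scope.
Local Open Scope ring_scope.

(** * Garding's inequality for m-positive forms *)

Section wedge_algebra.
Context {R : realType} {n : nat}.
Local Notation K := (complex R).
Local Notation M := 'M[K]_n.
Implicit Types (s : seq M) (A B X Y Z : M).

(** Gauss-Lucas needs a convex cone of directions [Y] for which the form does not vanish at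
    [X + iY], [X] Hermitian. For multiples of the identity this is the reality of Hermitian spectra.
    Any other direction of the Garding cone is reached by a homotopy of polynomials along which no
    root crosses the real axis. As m-positivity is a closed condition, matrices are first pushed
    into the open cone by a multiple of the identity. On the analytic side everything rests on
    translation invariance: the integral of [F(x + te)] does not depend on [t], so derivatives of
    compactly supported functions integrate to 0. This asks for functions that are C^2 on the whole
    space, hence the continuation of the profile beyond the ball, and for a mean value inequality
    without sphere integrals: the weights are the functions [(c - |x-a|^2)_+], whose difference
    quotients in [c] tend to the indicator of a ball. The bound alpha < (n-m)/m has a second use: it
    gives alpha <= n, so that the exponent 1 is at most n/alpha and phi itself is integrable. *)

Lemma wedge_perm s1 s2 : size s1 = n -> perm_eq s1 s2 -> wedge s1 = wedge s2.
Proof.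
move=> sz1 p12; have sz2 : size s2 = n by rewrite -(perm_size p12).
have /tuple_permP [p Ep] : perm_eq s1 (Tuple (introT eqP sz2)) by [].
have nthE (l : 'I_n) : nth 0 s1 l = nth 0 s2 (p l).
  by rewrite Ep (nth_map l) ?size_enum_ord// (tnth_nth 0) nth_ord_enum.
(* Both permutations are composed with [p], so its sign enters squared. *)
rewrite /wedge [LHS](reindex_inj (mulgI p)) /=; apply: eq_bigr => sigma _.
rewrite [LHS](reindex_inj (mulgI p)) /=; apply: eq_bigr => tau _.
rewrite !odd_permM !(signr_addb _ (odd_perm p)) mulrACA -expr2 sqrr_sign mul1r.
congr (_ * _).
rewrite [RHS](reindex_inj (@perm_inj _ p)) /=; apply: eq_bigr => l _.
by rewrite !permM nthE.
Qed.

Lemma wedge_linear (a : K) A B s : (0 < n)%N ->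
  wedge (a *: A + B :: s) = a * wedge (A :: s) + wedge (B :: s).
Proof.
move=> n0; rewrite /wedge mulr_sumr -big_split /=; apply: eq_bigr => sigma _.
rewrite mulr_sumr -big_split /=; apply: eq_bigr => tau _.
rewrite mulrCA -mulrDr; congr (_ * _).
pose i0 := Ordinal n0.
have E C : \prod_(l < n) nth 0 (C :: s) l (sigma l) (tau l) =
    C (sigma i0) (tau i0) * \prod_(l < n | l != i0) nth 0 s l.-1 (sigma l) (tau l).
  rewrite (bigD1 i0)//=; congr (_ * _); by apply: eq_bigr => -[[|l] ll]//=.
by rewrite !E !mxE mulrDl mulrA.
Qed.

Lemma wedgeD A B s : (0 < n)%N -> wedge (A + B :: s) = wedge (A :: s) + wedge (B :: s).
Proof. by move=> n0; rewrite -{1}[A]scale1r wedge_linear// mul1r. Qed.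

Lemma wedge0 s : (0 < n)%N -> wedge (0 :: s) = 0.
Proof.
move=> n0; have := wedgeD 0 0 s n0; rewrite addr0 => /esym/eqP.
by rewrite -subr_eq0 addrK => /eqP.
Qed.

Lemma wedgeZ (a : K) A s : (0 < n)%N -> wedge (a *: A :: s) = a * wedge (A :: s).
Proof. by move=> n0; rewrite -[a *: A]addr0 wedge_linear// wedge0// addr0. Qed.

(** Brings any slot to the front, where [wedge_linear] applies. *)
Lemma wedge_cat_cons A s1 s2 : (size s1 + size s2).+1 = n ->
  wedge (s1 ++ A :: s2) = wedge (A :: s1 ++ s2).
Proof.
move=> sz; apply: wedge_perm; first by rewrite size_cat /= addnS.
by rewrite -cat1s perm_catCA.
Qed.

Lemma wedge_nseqZ k (a : K) A s : (k + size s)%N = n ->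
  wedge (nseq k (a *: A) ++ s) = a ^+ k * wedge (nseq k A ++ s).
Proof.
elim: k s => [|k IH] s sz /=; first by rewrite expr0 mul1r.
have n0 : (0 < n)%N by rewrite -sz.
rewrite wedgeZ// -wedge_cat_cons ?size_nseq//.
rewrite IH /= ?addnS//.
by rewrite wedge_cat_cons ?size_nseq// exprS mulrA.
Qed.

(** For each fixed [sigma] the inner sum is the Leibniz expansion of [\det A] with relabelled rows;
    the outer sum repeats it [n!] times. *)
Lemma wedge_nseq_det A : wedge (nseq n A) = n`!%:R * \det A.
Proof.
rewrite /wedge.
have E (sigma : 'S_n) : \sum_(tau : 'S_n) (-1) ^+ sigma * (-1) ^+ tau *
   \prod_(l < n) nth 0 (nseq n A) l (sigma l) (tau l) = \det A.
  rewrite (reindex_inj (mulgI sigma)) /= /determinant; apply: eq_bigr => tau _.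
  rewrite odd_permM (signr_addb _ (odd_perm sigma)) mulrA -expr2 sqrr_sign mul1r; congr (_ * _).
  rewrite [RHS](reindex_inj (@perm_inj _ sigma)) /=; apply: eq_bigr => l _.
  by rewrite nth_nseq ltn_ord permM.
rewrite (eq_bigr (fun=> \det A)); last by move=> sigma _; exact: E.
by rewrite sumr_const mulr_natl card_Sn.
Qed.

Lemma wedge_nseq1 : wedge (nseq n (1%:M : M)) = n`!%:R.
Proof. by rewrite wedge_nseq_det det1 mulr1. Qed.

(** Conjugation transposes each Hermitian factor and so exchanges the roles of [sigma] and [tau].
    The default entry 0 of [nth] is Hermitian too. *)
Lemma wedge_conj s : (forall A, A \in s -> real_form A) -> complex.Im (wedge s) = 0.
Proof.
move=> rs; suff: conjc (wedge s) = wedge s.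
  by case: (wedge s) => a b [H] /=; lra.
have nthT (l : nat) (i j : 'I_n) : conjc (nth 0 s l i j) = nth 0 s l j i.
  have [ls|ls] := ltnP l (size s); first by rewrite (rs _ (mem_nth 0 ls) i j).
  by rewrite nth_default// !mxE conjc0.
rewrite /wedge rmorph_sum /= exchange_big /=; apply: eq_bigr => sigma _.
rewrite rmorph_sum; apply: eq_bigr => tau _.
rewrite /= !rmorphM/= !rmorph_prod/=.
rewrite !rmorphXn !rmorphN1 [X in X * _ = _]mulrC; congr (_ * _).
exact: eq_bigr.
Qed.

End wedge_algebra.

(** * Stable mixed forms and their derivatives *)

Section stability.
Context {R : realType}.
Local Notation K := (complex R).
Local Notation ImC := (@complex.Im R).
Local Notation ReC := (@complex.Re R).
Local Notation ofR := (real_complex R).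

Lemma ImCD (x y : K) : ImC (x + y) = ImC x + ImC y.
Proof. by case: x; case: y. Qed.

Lemma ImC_invN (r : K) : ImC r < 0 -> ImC (- r^-1) < 0.
Proof.
case: r => a b /= b0; have n2 : 0 < a ^+ 2 + b ^+ 2 by nra.
by rewrite opprK pmulr_llt0 ?invr_gt0.
Qed.

Lemma poly_ImC_roots (p : {poly K}) : p != 0 ->
  (forall t, 0 <= ImC t -> p.[t] != 0) ->
  exists2 rs : seq K, p = lead_coef p *: \prod_(z <- rs) ('X - z%:P) &
    forall z, z \in rs -> ImC z < 0.
Proof.
move=> p0 pn; have [rs prs] := closed_field_poly_normal p; exists rs => // z zrs.
rewrite ltNge; apply/negP => /pn; rewrite -rootE prs rootZ ?lead_coef_eq0//.
by rewrite root_prod_XsubC zrs.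
Qed.

(* Gauss-Lucas at [0]: the logarithmic derivative [sum_r 1 / (0 - r)] has
   negative imaginary part. *)
Lemma gauss_lucas_halfplane (p : {poly K}) : (1 < size p)%N ->
  (forall t, 0 <= ImC t -> p.[t] != 0) -> p^`().[0] != 0.
Proof.
move=> sp pn.
have p0 : p != 0 by rewrite -size_poly_gt0 (ltn_trans _ sp).
have [rs prs rsI] := poly_ImC_roots p p0 pn.
have p00 : p.[0] != 0 by apply: pn.
suff [d [dE dI]] : exists d, p^`().[0] = d * p.[0] /\ ImC d < 0.
  rewrite dE mulf_neq0//; apply/eqP => d0; by rewrite d0 ltxx in dI.
have rs0 : rs != [::].
  apply/eqP => rs0; move: sp; rewrite prs rs0 big_nil.
  by rewrite size_scale ?lead_coef_eq0// size_poly1.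
rewrite prs derivZ !hornerZ.
suff [d [-> dI]] : exists d,
    (\prod_(z <- rs) ('X - z%:P))^`().[0] = d * (\prod_(z <- rs) ('X - z%:P)).[0]
    /\ (if rs is [::] then d = 0 else ImC d < 0).
  exists d; split; last by case: (rs) rs0 dI.
  by rewrite mulrCA.
elim: rs rsI {prs rs0} => [|r rs IH] rsI.
  by exists 0; rewrite big_nil derivC horner0 mul0r.
have [|d [dE dI]] := IH; first by move=> z zrs; apply: rsI; rewrite inE zrs orbT.
have rI : ImC r < 0 by apply: rsI; rewrite inE eqxx.
have r0 : r != 0 by apply/eqP => r0; rewrite r0 ltxx in rI.
exists (- r^-1 + d); split; last first.
  rewrite ImCD; have := ImC_invN r rI.
  by case: (rs) dI => [->|? ? ?]; rewrite /= ?addr0//; lra.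
rewrite big_cons derivM derivXsubC mul1r.
move: dE; set P := \prod_(z <- rs) _ => dE.
rewrite hornerD !hornerM dE hornerXsubC sub0r.
by field.
Qed.

Context {n : nat}.
Local Notation M := 'M[K]_n.
Implicit Types (s : seq M) (A B X Y Z : M).

(* The polynomial t |-> wedge (nseq k (Z + t A) ++ s). *)
Fixpoint pencil k Z A s : {poly K} :=
  if k is k'.+1 then pencil k' Z A (Z :: s) + 'X * pencil k' Z A (A :: s)
  else (wedge s)%:P.

Lemma horner_pencil k Z A s t : (k + size s)%N = n ->
  (pencil k Z A s).[t] = wedge (nseq k (Z + t *: A) ++ s).
Proof.
elim: k s => [|k IH] s sz /=; first by rewrite hornerC.
have n0 : (0 < n)%N by rewrite -sz.
rewrite !hornerE !IH /= ?addnS// !wedge_cat_cons ?size_nseq//.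
by rewrite wedgeD// wedgeZ.
Qed.

Lemma pencil_perm k Z A s1 s2 : (k + size s1)%N = n -> perm_eq s1 s2 ->
  pencil k Z A s1 = pencil k Z A s2.
Proof.
elim: k s1 s2 => [|k IH] s1 s2 sz p12 /=; first by rewrite (wedge_perm s1 s2).
by rewrite (IH (Z :: s1) (Z :: s2)) ?(IH (A :: s1) (A :: s2)) ?perm_cons//= addnS.
Qed.

(** The moving slots contribute equally by symmetry, each turning into a fixed [A]: differentiation
    along [A] is how a further form enters the product. *)
Lemma deriv_pencil k Z A s : (k.+1 + size s)%N = n ->
  (pencil k.+1 Z A s)^`() = k.+1%:R *: pencil k Z A (A :: s).
Proof.
elim: k s => [|k IH] s sz.
  by rewrite /= derivD derivM derivX !derivC mul1r mulr0 addr0 add0r scale1r.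
have -> : pencil k.+2 Z A s =
  pencil k.+1 Z A (Z :: s) + 'X * pencil k.+1 Z A (A :: s) by [].
rewrite derivD derivM derivX mul1r !IH/= ?addnS//.
rewrite (pencil_perm k Z A (A :: Z :: s) (Z :: A :: s)); last 2 first.
- by rewrite /= !addnS.
- by rewrite -![_ :: _ :: s]/([:: _] ++ [:: _] ++ s) perm_catCA.
rewrite -[k.+2]addn1 natrD scalerDl scale1r -!mul_polyC/=.
by ring.
Qed.

Lemma size_pencil k Z A s : (size (pencil k Z A s) <= k.+1)%N.
Proof.
elim: k s => [|k IH] s /=; first exact: size_polyC_leq1.
apply: leq_trans (size_polyD _ _) _; rewrite geq_max.
rewrite (leq_trans (IH _))//= mulrC.
have [->|p0] := eqVneq (pencil k Z A (A :: s)) 0; first by rewrite mul0r size_poly0.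
by rewrite size_mulX// ltnS.
Qed.

Lemma coef_pencil k Z A s : (k + size s)%N = n ->
  (pencil k Z A s)`_k = wedge (nseq k A ++ s).
Proof.
elim: k s => [|k IH] s sz /=; first by rewrite coefC.
rewrite coefD nth_default ?size_pencil// add0r coefXM/= IH/= ?addnS//.
by rewrite wedge_cat_cons ?size_nseq.
Qed.

Definition i_add X Y : M := X + (Complex 0 1 : K) *: Y.

(** Nonvanishing on the tube over [C]: the form, as a polynomial in its repeated slot, is hyperbolic
    in the directions of [C]. *)
Definition stable_on (C : M -> Prop) k s :=
  forall X Y, real_form X -> C Y -> wedge (nseq k (i_add X Y) ++ s) != 0.

Lemma real_formE A : real_form A -> forall j k, A k j = conjc (A j k).
Proof. by []. Qed.

Lemma real_form0 : real_form (0 : M).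
Proof. by move=> i j; rewrite !mxE rmorph0. Qed.

Lemma real_form1 : real_form (1%:M : M).
Proof. by move=> i j; rewrite !mxE eq_sym rmorph_nat. Qed.

Lemma real_formD X Y : real_form X -> real_form Y -> real_form (X + Y).
Proof. by move=> hX hY i j; rewrite !mxE hX hY rmorphD. Qed.

Lemma real_formZ (a : R) X : real_form X -> real_form (ofR a *: X).
Proof. move=> hX i j; change ((ofR a *: X) j i = conjc ((ofR a *: X) i j)).
by rewrite !mxE (real_formE _ hX i j) rmorphM/= oppr0. Qed.

Lemma complexDi (t : K) : t = ofR (ReC t) + (Complex 0 1 : K) * ofR (ImC t).
Proof. by case: t => a b; apply/eqP; rewrite eq_complex /=; apply/andP; split; apply/eqP; ring. Qed.

(** For [Im t >= 0] the point [X + iY + tA] stays in the tube, its imaginary part being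
    [Y + (Im t) A]. Hence the pencil has no root in the closed upper half-plane, and by Gauss-Lucas
    its derivative at 0 does not vanish. *)
Lemma stable_on_derive (C : M -> Prop) k s A : (k.+1 + size s)%N = n ->
  (forall Y (t : R), C Y -> 0 <= t -> C (Y + ofR t *: A)) ->
  real_form A -> C A -> stable_on C k.+1 s -> stable_on C k (A :: s).
Proof.
move=> sz CD hA CA st X Y hX CY.
set Z := i_add X Y.
have szA : (k + size (A :: s))%N = n by rewrite /= addnS.
have := @gauss_lucas_halfplane (pencil k.+1 Z A s).
rewrite deriv_pencil// hornerZ horner_pencil// scale0r addr0 mulf_eq0 negb_or.
move=> H; suff /andP[] : (k.+1%:R != 0 :> K) && (wedge (nseq k Z ++ A :: s) != 0) by [].
apply: H => [|t t0].
  (* The pencil is not constant: its top coefficient is the form at [A], which up to a power of [i]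
     is its value at the tube point [0 + iA]. *)
  rewrite ltnNge; apply/negP => sp.
  have : (pencil k.+1 Z A s)`_k.+1 = 0 by rewrite nth_default// (leq_trans sp).
  rewrite coef_pencil// => w0.
  have := st 0 A real_form0 CA.
  by rewrite /i_add add0r wedge_nseqZ// w0 mulr0 eqxx.
rewrite horner_pencil//.
have -> : Z + t *: A = i_add (X + ofR (ReC t) *: A) (Y + ofR (ImC t) *: A).
  rewrite /Z /i_add {1}(complexDi t) scalerDl scalerDr scalerA !addrA.
  by rewrite -!addrA; congr (_ + _); rewrite addrCA.
by apply: st; [apply: real_formD => //; exact: real_formZ|exact: CD].
Qed.

Definition posI Y := exists2 y : R, 0 < y & Y = ofR y *: 1%:M.

(** A null row vector [v] of [X + iyI] would give [v X v* = -iy |v|^2], but the left side is real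
    for Hermitian [X]. *)
Lemma det_stable : stable_on posI n [::].
Proof.
move=> X _ hX [y y0 ->]; rewrite cats0 wedge_nseq_det mulf_neq0//.
apply/negP => /det0P[v v0 vZ].
have Xv : v *m X = - (Complex 0 1 * ofR y) *: v.
  apply/eqP; rewrite scaleNr -addr_eq0 -vZ /i_add mulmxDr; apply/eqP.
  by congr (_ + _); rewrite -!scalemxAr mulmx1 scalerA.
pose w : 'cV[K]_n := \col_j conjc (v ord0 j).
pose q : K := (v *m X *m w) ord0 ord0.
have qE : q = - (Complex 0 1 * ofR y) * (v *m w) ord0 ord0.
  by rewrite /q Xv -scalemxAl mxE.
have nE : (v *m w) ord0 ord0 = ofR (\sum_j (ReC (v ord0 j) ^+ 2 + ImC (v ord0 j) ^+ 2)).
  rewrite mxE rmorph_sum; apply: eq_bigr => j _; rewrite mxE.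
  by case: (v ord0 j) => a b; apply/eqP; rewrite eq_complex/=; apply/andP; split;
    apply/eqP; ring.
have qc : conjc q = q.
  rewrite /q !mxE rmorph_sum /=.
  under eq_bigr do rewrite mxE rmorphM/= rmorph_sum mulr_suml.
  rewrite exchange_big /=; apply: eq_bigr => i _.
  rewrite mxE mulr_suml; apply: eq_bigr => j _.
  rewrite !mxE rmorphM/= conjcK (real_formE _ hX i j).
  by case: (X _ _) => ? ?; case: (v _ _) => ? ?; case: (v _ _) => ? ?;
   apply/eqP; rewrite eq_complex/=; apply/andP; split; apply/eqP; ring.
have : 0 < \sum_j (ReC (v ord0 j) ^+ 2 + ImC (v ord0 j) ^+ 2).
  have [j vj] : exists j, v ord0 j != 0.
    apply/existsP; rewrite -negb_forall; apply: contra v0 => /forallP vj.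
    by apply/eqP/rowP => j; rewrite mxE; apply/eqP.
  rewrite (bigD1 j)//= ltr_pwDl//.
    move: vj; case: (v _ _) => a b; rewrite eq_complex/= negb_and.
    by move=> /orP[]/eqP/eqP h; nra.
  by apply: sumr_ge0 => i _; rewrite addr_ge0// sqr_ge0.
set N := \sum_j _ in nE *; move=> N0.
have qI : q = Complex 0 (- (y * N)).
  by rewrite qE nE; apply/eqP; rewrite eq_complex/=; apply/andP; split; apply/eqP; ring.
have := mulr_gt0 y0 N0; move: qc; rewrite qI => -[]; lra.
Qed.

End stability.

(** * Roots in a half-plane along a homotopy *)

Section root_homotopy.
Context {R : realType}.
Local Notation K := (complex R).
Local Notation ImC := (@complex.Im R).
Local Notation ReC := (@complex.Re R).
Local Notation ofR := (real_complex R).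
Local Notation N := (@normc R).

(** Take the supremum of the [t] such that [U] fails on [[0, t]]; the local equivalence keeps [U]
    false there and slightly beyond. *)
Lemma unit_interval_clopen (U : R -> Prop) :
  (forall s, 0 <= s <= 1 -> exists2 d : R, 0 < d &
     forall t, 0 <= t <= 1 -> `|s - t| < d -> (U s <-> U t)) ->
  ~ U 0 -> ~ U 1.
Proof.
move=> loc U0.
pose G := [set t : R | 0 <= t <= 1 /\ forall s, 0 <= s <= t -> ~ U s].
have G0 : G 0.
  split; first by rewrite lexx ler01.
  by move=> s /andP[s0 s1]; have -> : s = 0 by apply/eqP; rewrite eq_le s0 s1.
have G1 : ubound G 1 by move=> t [/andP[]].
have hsG : has_sup G by split; [exists 0|exists 1].
set t := sup G.
have t0 : 0 <= t by apply: sup_upper_bound.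
have t1 : t <= 1 by apply: ge_sup => //; exists 0.
have [d d0 dU] := loc t (introT andP (conj t0 t1)).
have [g [/andP[g0 g1] gU] tg] := sup_adherent d0 hsG.
have gt : g <= t by apply: sup_upper_bound => //; split=> //; apply/andP.
have Ut : ~ U t.
  move=> /(dU g); rewrite g0 g1 => /(_ isT) H; apply: (gU g); first by rewrite g0 lexx.
  by apply: H; rewrite ger0_norm ?subr_ge0// ltrBlDr -ltrBlDl.
have nU s : 0 <= s <= 1 -> s < t + d -> ~ U s.
  move=> /andP[s0 s1] std; have [sg|gs] := leP s g; first by apply: gU; rewrite s0.
  move=> Us; apply: Ut; apply/(dU s) => //; first by rewrite s0.
  by rewrite ltr_norml; apply/andP; split; move: tg; rewrite -/t; lra.
have [td|td] := leP (t + d / 2) 1; last by apply: nU; rewrite ?ler01 ?lexx//; lra.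
have : t + d / 2 <= t.
  apply: sup_upper_bound => //; split; first by apply/andP; split; lra.
  by move=> s /andP[s0 s1]; apply: nU; [apply/andP; split|]; lra.
lra.
Qed.

Lemma normc_ge0 (z : K) : 0 <= N z.
Proof. by case: z => a b; exact: sqrtr_ge0. Qed.

Lemma normc_gt0 (z : K) : z != 0 -> 0 < N z.
Proof.
by move=> z0; rewrite lt_neqAle normc_ge0 andbT eq_sym; apply: contra z0 => /eqP/eq0_normc->.
Qed.

Lemma normc_ofR (a : R) : N (ofR a) = `|a|.
Proof. by rewrite /= expr0n addr0 sqrtr_sqr. Qed.

Lemma ImC_le_normc (z : K) : `|ImC z| <= N z.
Proof.
case: z => a b /=; rewrite -sqrtr_sqr ler_wsqrtr//.
by rewrite lerDr sqr_ge0.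
Qed.

Lemma ImCN (z : K) : ImC (- z) = - ImC z.
Proof. by case: z. Qed.

Lemma normc_horner_ge (c : K) rs w (k : R) : 0 <= k ->
  (forall z, z \in rs -> k <= N (w - z)) ->
  N c * k ^+ size rs <= N (c *: \prod_(z <- rs) ('X - z%:P)).[w].
Proof.
move=> k0 krs; rewrite hornerZ normcM ler_wpM2l ?normc_ge0//.
elim: rs krs => [|r rs IH] krs; first by rewrite big_nil hornerC normc1.
rewrite big_cons hornerM normcM exprS hornerXsubC.
apply: ler_pM => //; first exact: exprn_ge0.
  by apply: krs; rewrite inE eqxx.
by apply: IH => z zrs; apply: krs; rewrite inE zrs orbT.
Qed.

Variables (P : R -> {poly K}) (d : nat) (c : K) (M : R).
Hypothesis c0 : c != 0.
Hypothesis sizeP : forall s, size (P s) = d.+1.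
Hypothesis leadP : forall s, lead_coef (P s) = c.
Hypothesis M0 : 0 <= M.
Hypothesis lipP : forall s t, 0 <= s <= 1 -> 0 <= t <= 1 -> forall w,
  N ((P s).[w] - (P t).[w]) <= M * `|s - t| * (1 + N w) ^+ d.
Hypothesis realP : forall s, 0 <= s <= 1 -> forall w, ImC w = 0 -> (P s).[w] != 0.
Hypothesis P0 : forall w, 0 <= ImC w -> (P 0).[w] != 0.

Let roots s : exists2 rs, P s = c *: \prod_(z <- rs) ('X - z%:P) & size rs = d.
Proof.
have [rs E] := closed_field_poly_normal (P s); exists rs; first by rewrite {1}E leadP.
have := sizeP s; rewrite E leadP size_scale// size_prod_XsubC => -[]//.
Qed.

Let root_mem s rs : P s = c *: \prod_(z <- rs) ('X - z%:P) ->
  forall z, z \in rs -> (P s).[z] = 0.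
Proof.
by move=> -> z zrs; apply/eqP; rewrite -rootE rootZ// root_prod_XsubC.
Qed.

(** A bound that grows linearly in [w] is required: the half-plane is unbounded, and the
    perturbation in [lipP] grows like [(1 + |w|)^d]. *)
Lemma root_dist_bound (rs : seq K) : (forall z, z \in rs -> ImC z < 0) ->
  exists2 k : R, 0 < k & forall w, 0 <= ImC w ->
    forall z, z \in rs -> k * (1 + N w) <= N (w - z).
Proof.
elim: rs => [|r rs IH] rsI; first by exists 1.
have [|k k0 kP] := IH; first by move=> z zrs; apply: rsI; rewrite inE zrs orbT.
have rI : ImC r < 0 by apply: rsI; rewrite inE eqxx.
pose e := - ImC r.
have e0 : 0 < e by rewrite oppr_gt0.
have nr := normc_ge0 r.
(* With [D = |w - r| >= e] and [|w| <= D + |r|] one gets [e (1 + |w|) <= D (e + 1 + |r|)]. *)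
pose k' := e / (e + 1 + N r).
have D0 : 0 < e + 1 + N r by lra.
have k'0 : 0 < k' by rewrite divr_gt0.
exists (Num.min k k'); first by rewrite lt_min k0.
move=> w wI z; rewrite inE => /orP[/eqP->|zrs]; last first.
  apply: le_trans (kP w wI z zrs); rewrite ler_wpM2r//.
    by rewrite addr_ge0// normc_ge0.
  by rewrite ge_min lexx.
have nwr : e <= N (w - r).
  apply: le_trans (ImC_le_normc _); rewrite ImCD.
  by rewrite ImCN -/e ger0_norm; lra.
have nw : N w <= N (w - r) + N r by rewrite -{1}(subrK r w); exact: le_normcD.
apply: (@le_trans _ _ (k' * (1 + N w))).
  by rewrite ler_wpM2r ?ge_min ?lexx ?orbT// addr_ge0// normc_ge0.
rewrite /k' mulrAC ler_pdivrMr//.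
nra.
Qed.

Let U s := exists2 w, 0 <= ImC w & (P s).[w] = 0.

Let roots_nU s rs : P s = c *: \prod_(z <- rs) ('X - z%:P) -> ~ U s ->
  forall z, z \in rs -> ImC z < 0.
Proof.
move=> E nU z zrs; rewrite ltNge; apply/negP => zI; apply: nU.
by exists z => //; exact: (root_mem s rs).
Qed.

Let pow_cvg (a b : R) : 0 < a -> 0 <= b -> exists2 e : R, 0 < e & forall x, 0 <= x -> x < e -> b * x < a.
Proof.
move=> a0 b0; exists (a / (b + 1)); first by rewrite divr_gt0//; lra.
move=> x x0; rewrite ltr_pdivlMr; last lra.
nra.
Qed.

(** Having a root in the closed upper half-plane is locally constant in [s]. A root [w] of [P s] has
    [Im w > 0]; if all roots of [P t] lay below the axis, then [|P t (w)| >= |c| (Im w)^d], too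
    large for [t] near [s]. Conversely, if all roots of [P s] lie below, [root_dist_bound] gives
    [|P s (w)| >= |c| k^d (1 + |w|)^d] on the whole half-plane, and the perturbation is smaller than
    this, uniformly in [w]. *)
Let locU s : 0 <= s <= 1 -> exists2 d : R, 0 < d &
     forall t, 0 <= t <= 1 -> `|s - t| < d -> (U s <-> U t).
Proof.
move=> s01; have c_gt0 := normc_gt0 c c0.
have [[w wI Pw]|nU] := pselect (U s).
  have wI' : 0 < ImC w.
    rewrite lt_neqAle wI andbT eq_sym; apply/negP => /eqP/(realP s s01).
    by rewrite Pw eqxx.
  have [e e0 eP] := pow_cvg (N c * ImC w ^+ d) (M * (1 + N w) ^+ d)
    (mulr_gt0 c_gt0 (exprn_gt0 d wI'))
    (mulr_ge0 M0 (exprn_ge0 d (addr_ge0 ler01 (normc_ge0 w)))).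
  exists e => // t t01 st; split; last by exists w.
  move=> _; apply: contrapT => nUt.
  have [rs E szrs] := roots t.
  have rsI := roots_nU t rs E nUt.
  have := normc_horner_ge c rs w (ImC w) wI.
  rewrite -E szrs => H; have {H} : N c * ImC w ^+ d <= N (P t).[w].
    apply: H => z zrs; apply: le_trans (ImC_le_normc _); rewrite ImCD.
    by have := rsI z zrs => zI; rewrite ImCN ger0_norm; lra.
  have := lipP s t s01 t01 w; rewrite Pw sub0r normcN => H1 H2.
  have := eP `|s - t| (normr_ge0 _) st.
  by move=> H3; have := le_lt_trans (le_trans H2 H1); rewrite mulrAC => /(_ _ H3); rewrite ltxx.
have [rs E szrs] := roots s.
have [k k0 kP] := root_dist_bound rs (roots_nU s rs E nU).
have [e e0 eP] := pow_cvg (N c * k ^+ d) M (mulr_gt0 c_gt0 (exprn_gt0 d k0)) M0.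
exists e => // t t01 st; split => // -[w wI Pw]; exfalso.
have nw1 : 0 < (1 + N w) ^+ d by rewrite exprn_gt0// ltr_pwDl// normc_ge0.
have := normc_horner_ge c rs w (k * (1 + N w)).
rewrite -E szrs exprMn => /(_ (mulr_ge0 (ltW k0) (addr_ge0 ler01 (normc_ge0 w)))).
move=> /(_ (kP w wI)) H1.
have := lipP s t s01 t01 w; rewrite Pw subr0 => H2.
have := le_trans H1 H2; rewrite mulrA ler_pM2r//.
by rewrite leNgt eP.
Qed.

Lemma root_homotopy w : 0 <= ImC w -> (P 1).[w] != 0.
Proof.
move=> wI; apply/eqP => Pw.
have U0 : ~ U 0 by move=> [z zI /eqP]; apply/negP; exact: P0.
by apply: (unit_interval_clopen U locU U0); exists w.
Qed.

End root_homotopy.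

(** * The Garding cone and Garding's inequality *)

Lemma pencil_regroup (F : comPzRingType) (V : lmodType F) (i c b e : F) (X Y B J : V) :
  X + i *: (c *: (Y + b *: B) + e *: J) =
  X + i *: (c *: Y) + (i * e) *: J + (i * (c * b)) *: B.
Proof. by rewrite !scalerDr !scalerA mulrA -!addrA; congr (_ + (_ + _)); rewrite addrC. Qed.

Lemma pencil_scale (F : comPzRingType) (V : lmodType F) (i a c e v : F) (X Y B J : V) :
  a *: (X + i *: (c *: Y)) + (i * e) *: J + v *: B =
  a *: X + v *: B + i *: ((a * c) *: Y + e *: J).
Proof.
rewrite !scalerDr !scalerA (mulrCA i) mulrA -!addrA; congr (_ + _).
by rewrite [RHS]addrC -!addrA.
Qed.

Section garding.
Context {R : realType} {n : nat}.
Local Notation K := (complex R).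
Local Notation ImC := (@complex.Im R).
Local Notation ReC := (@complex.Re R).
Local Notation ofR := (real_complex R).
Local Notation N := (@normc R).
Local Notation M := 'M[K]_n.
Local Notation I := (1%:M : M).
Local Notation iC := (Complex 0 1 : K).
Implicit Types (s : seq M) (A B X Y Z : M).

(** Each differentiation of the determinant along the identity replaces one slot by the identity and
    preserves stability. *)
Lemma posI_stable k : (k <= n)%N -> stable_on posI (n - k) (nseq k I).
Proof.
elim: k => [|k IH] kn; first by rewrite subn0; exact: det_stable.
apply: (@stable_on_derive _ _ posI) => //=.
- by rewrite size_nseq; lia.
- move=> _ t [y y0 ->] t0; exists (y + t); first by lra.
  by rewrite rmorphD scalerDl.
- exact: real_form1.
- by exists 1 => //; rewrite scale1r.
- have -> : (n - k.+1).+1 = (n - k)%N by lia.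
  by apply: IH; lia.
Qed.

Variable m : nat.
Hypotheses (m0 : (0 < m)%N) (mn : (m <= n)%N).

Let n0 : (0 < n)%N. Proof. exact: leq_trans m0 mn. Qed.

Local Notation tl := (nseq (n - m) I).
Local Notation f Z := (wedge (nseq m Z ++ tl)).

Let szf (Z : M) : (m + size tl)%N = n. Proof. by rewrite size_nseq; lia. Qed.

(** Multiplying out leaves products of copies of [A] and [I], nonnegative by m-positivity, and the
    term with no [A], which is [b^k n!] and makes the sum strictly positive. The induction carries
    [j] further copies of [A] along. *)
Lemma m_positive_shift A (a b : R) : m_positive m A -> 0 <= a -> 0 < b ->
  forall k, (k <= m)%N ->
  0 < wedge (nseq k (ofR a *: A + ofR b *: I) ++ nseq (n - k) I).
Proof.
move=> [hA mA] a0 b0 k km.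
set B := _ + _.
suff : forall j, (k + j <= m)%N ->
  0 <= wedge (nseq k B ++ nseq j A ++ nseq (n - k - j) I) /\
  (j = 0%N -> 0 < wedge (nseq k B ++ nseq j A ++ nseq (n - k - j) I)).
  by move=> /(_ 0%N); rewrite addn0 => /(_ km)[_ /(_ erefl)]; rewrite subn0.
elim: k km => [_ j jm|k IH km j kj].
  split; last by move=> ->; rewrite /= !subn0 wedge_nseq1 ltr0n fact_gt0.
  case: j jm => [_|j jm]; first by rewrite /= !subn0 wedge_nseq1 ler0n.
  by rewrite subn0; apply: mA; lia.
have szj : (size (nseq k B) + size (nseq j A ++ nseq (n - k.+1 - j) I)).+1 = n.
  by rewrite size_cat !size_nseq; lia.
have E : wedge (nseq k.+1 B ++ nseq j A ++ nseq (n - k.+1 - j) I) =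
    ofR a * wedge (nseq k B ++ nseq j.+1 A ++ nseq (n - k - j.+1) I) +
    ofR b * wedge (nseq k B ++ nseq j A ++ nseq (n - k - j) I).
  have -> : (n - k - j.+1 = n - k.+1 - j)%N by lia.
  have -> : (n - k - j = (n - k.+1 - j).+1)%N by lia.
  rewrite /= {1}/B wedgeD// !wedgeZ// -!wedge_cat_cons//.
  congr (_ + _ * _); apply: wedge_perm; first by rewrite size_cat/= addnS.
  by rewrite perm_cat2l -cat1s perm_catCA perm_cat2l.
have [|w1 _] := IH (ltnW km) j.+1; first by rewrite addnS -addSn.
have [|w2 w3] := IH (ltnW km) j; first by lia.
have a0' : 0 <= ofR a by rewrite ler0c.
have b0' : 0 < ofR b by rewrite ltcR.
rewrite E; split; first by rewrite addr_ge0// mulr_ge0// ltW.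
by move=> /w3 w4; rewrite ltr_wpDl ?mulr_ge0// mulr_gt0.
Qed.

(** The open Garding cone: the wedge product here is [k! (n-k)!] times the k-th elementary symmetric
    function of the eigenvalues of [Y]. *)
Definition garding_cone Y := real_form Y /\
  forall k, (k <= m)%N -> 0 < wedge (nseq k Y ++ nseq (n - k) I).

Lemma garding_cone_shift A (a b : R) : m_positive m A -> 0 <= a -> 0 < b ->
  garding_cone (ofR a *: A + ofR b *: I).
Proof.
move=> mA a0 b0; split; last by move=> k km; exact: m_positive_shift.
by apply: real_formD; apply: real_formZ; [case: mA|exact: real_form1].
Qed.

Lemma garding_cone_m_positive Y : garding_cone Y -> m_positive m Y.
Proof. by move=> [hY pY]; split => // k /andP[_ km]; rewrite ltW// pY. Qed.

Lemma f_posI X (e : R) : real_form X -> 0 < e -> f (i_add X (ofR e *: I)) != 0.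
Proof.
move=> hX e0; have := @posI_stable (n - m) (leq_subr _ _) X (ofR e *: I) hX.
by rewrite subKn//; apply; exists e.
Qed.

(** The roots of [t |-> f(Y + tI)] are real, since [f] is stable in the direction [I] and
    homogeneous (which gives the lower half-plane), and negative, since for real [t >= 0] the value
    is positive. *)
Lemma real_rooted Y (t : K) : garding_cone Y ->
  (0 <= ReC t \/ ImC t != 0) -> f (Y + t *: I) != 0.
Proof.
move=> gY; have [hY pY] := gY; have hI := real_formZ (ReC t) I real_form1.
have E : Y + t *: I = i_add (Y + ofR (ReC t) *: I) (ofR (ImC t) *: I).
  by rewrite {1}(complexDi t) /i_add scalerDl scalerA addrA.
have [tI|tI|tI] := ltrgtP (ImC t) 0.
- move=> _; rewrite E.
  have -> : i_add (Y + ofR (ReC t) *: I) (ofR (ImC t) *: I) =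
    (-1) *: i_add (ofR (-1) *: (Y + ofR (ReC t) *: I)) (ofR (- ImC t) *: I).
    rewrite /i_add scalerDr !scalerA !rmorphN rmorph1 mulrNN mul1r scale1r.
    by congr (_ + _ *: _); rewrite mulN1r mulrN opprK.
  rewrite wedge_nseqZ ?szf// mulf_neq0// ?expf_neq0// ?oppr_eq0 ?oner_eq0//.
  by apply: f_posI; [apply: real_formZ; exact: real_formD|rewrite oppr_gt0].
- by move=> _; rewrite E; apply: f_posI => //; exact: real_formD.
- move=> [t0|//].
  have tE : t = ofR (ReC t) by rewrite {1}(complexDi t) tI mulr0 addr0.
  rewrite tE; move: t0; rewrite le_eqVlt => /predU1P[<-|t0].
    by rewrite scale0r addr0; apply: lt0r_neq0; exact: pY.
  apply: lt0r_neq0; have := @m_positive_shift Y 1 (ReC t)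
    (garding_cone_m_positive _ gY) ler01 t0 m (leqnn m).
  by rewrite scale1r.
Qed.

(** Only the expansion of one slot into three terms matters, so the estimate is made for any family
    obeying that recursion. It supplies the Lipschitz hypothesis of the root homotopy. *)
Lemma affine_recursion_bound (G : nat -> R -> K -> seq M -> K) (G0 : seq M -> K) Z B E :
  (forall a w s, G 0%N a w s = G0 s) ->
  (forall k a w s, (k.+1 + size s)%N = n -> G k.+1 a w s =
     ofR a * G k a w (Z :: s) + G k a w (E :: s) + w * G k a w (B :: s)) ->
  forall k s, (k + size s)%N = n ->
  exists2 C : R, 0 <= C & forall (a b : R) w, 0 <= a <= 1 -> 0 <= b <= 1 ->
   N (G k a w s) <= C * (1 + N w) ^+ k /\
   N (G k a w s - G k b w s) <= C * `|a - b| * (1 + N w) ^+ k.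
Proof.
move=> GE0 GES; elim=> [|k IH] s sz.
  exists (N (G0 s)); first exact: normc_ge0.
  move=> a b w _ _; rewrite !GE0 expr0 !mulr1 subrr; split => //.
  by rewrite normc0 mulr_ge0// normc_ge0.
have szk X : (k + size (X :: s))%N = n by rewrite /= addnS.
have [C1 C10 H1] := IH _ (szk Z); have [C2 C20 H2] := IH _ (szk E).
have [C3 C30 H3] := IH _ (szk B).
have tri (x y z : K) : N (x + y + z) <= N x + N y + N z.
  by apply: le_trans (le_normcD _ _) _; rewrite lerD2r; exact: le_normcD.
(* The factor 2 comes from [a x - b y = (a - b) x + b (x - y)]. *)
exists (2 * C1 + C2 + C3); first by lra.
move=> a b w a01 b01.
have := H1 a b w a01 b01; have := H2 a b w a01 b01; have := H3 a b w a01 b01.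
rewrite !GES// {H1 H2 H3}.
move: (G k a w (Z :: s)) (G k a w (E :: s)) (G k a w (B :: s)).
move: (G k b w (Z :: s)) (G k b w (E :: s)) (G k b w (B :: s)) => y1 y2 y3.
move=> x1 x2 x3 [p3 q3] [p2 q2] [p1 q1].
have nw := normc_ge0 w; set W := (1 + N w) ^+ k in p1 p2 p3 q1 q2 q3 *.
have W0 : 0 <= W by rewrite exprn_ge0// addr_ge0.
have eW : (1 + N w) ^+ k.+1 = W + N w * W by rewrite exprS mulrDl mul1r.
have /andP[a0 a1] := a01; have /andP[b0 b1] := b01.
have nwW : 0 <= N w * W by rewrite mulr_ge0.
rewrite eW; split.
  apply: le_trans (tri _ _ _) _; rewrite !normcM normc_ofR ger0_norm//.
  have h1 : a * N x1 <= C1 * W by apply: le_trans p1; rewrite ler_piMl// normc_ge0.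
  have h3 : N w * N x3 <= N w * (C3 * W) by rewrite ler_wpM2l.
  have : 0 <= C1 * W /\ 0 <= C1 * (N w * W) /\ 0 <= C2 * (N w * W) /\ 0 <= C3 * W.
    by rewrite !mulr_ge0.
  by lra.
have -> : ofR a * x1 + x2 + w * x3 - (ofR b * y1 + y2 + w * y3) =
  (ofR (a - b) * x1 + ofR b * (x1 - y1)) + (x2 - y2) + w * (x3 - y3).
  by rewrite rmorphB; ring.
apply: le_trans (tri _ _ _) _; rewrite normcM.
have h1 : N (ofR (a - b) * x1 + ofR b * (x1 - y1)) <= 2 * (C1 * `|a - b| * W).
  apply: le_trans (le_normcD _ _) _; rewrite !normcM !normc_ofR (ger0_norm b0).
  have : `|a - b| * N x1 <= `|a - b| * (C1 * W) by rewrite ler_wpM2l.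
  have : b * N (x1 - y1) <= C1 * `|a - b| * W.
    by apply: le_trans q1; rewrite ler_piMl// normc_ge0.
  by lra.
have h3 : N w * N (x3 - y3) <= N w * (C3 * `|a - b| * W) by rewrite ler_wpM2l.
have d0 := normr_ge0 (a - b); set D := `|a - b| in q1 q2 q3 h1 h3 d0 *.
have : 0 <= C1 * D * (N w * W) /\ 0 <= C2 * D * (N w * W) /\ 0 <= C3 * D * W.
  by rewrite !mulr_ge0.
by lra.
Qed.

Lemma wedge_affine_bound k s (Z B E : M) : (k + size s)%N = n ->
  exists2 C : R, 0 <= C & forall (a b : R) w, 0 <= a <= 1 -> 0 <= b <= 1 ->
   N (wedge (nseq k (ofR a *: Z + E + w *: B) ++ s)) <= C * (1 + N w) ^+ k /\
   N (wedge (nseq k (ofR a *: Z + E + w *: B) ++ s) -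
      wedge (nseq k (ofR b *: Z + E + w *: B) ++ s)) <= C * `|a - b| * (1 + N w) ^+ k.
Proof.
pose G k a w s := wedge (nseq k (ofR a *: Z + E + w *: B) ++ s).
apply: (@affine_recursion_bound G wedge Z B E) => // {}k a w {}s sz.
by rewrite /G !wedge_cat_cons ?size_nseq// -?addnS// /= !wedgeD// !wedgeZ.
Qed.

(** Polynomials in [w], deformed by scaling [Z] with [a] from 0 to 1. The leading coefficient [f B]
    is fixed and nonzero, the hypothesis excludes real roots, and at [a = 0] only [I] and [B]
    remain, where [real_rooted] decides. *)
Lemma stable_homotopy Z B : garding_cone B ->
  (forall (a v e : R), 0 <= a <= 1 -> 0 < e ->
     f (ofR a *: Z + (iC * ofR e) *: I + ofR v *: B) != 0) ->
  forall e : R, 0 < e -> forall w, 0 <= ImC w ->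
     f (Z + (iC * ofR e) *: I + w *: B) != 0.
Proof.
move=> gB H e e0 w wI; have [hB pB] := gB.
have [C C0 HC] := wedge_affine_bound m tl Z B ((iC * ofR e) *: I) (szf 0).
pose P (a : R) := pencil m (ofR a *: Z + (iC * ofR e) *: I) B tl.
have PE a z : (P a).[z] = f (ofR a *: Z + (iC * ofR e) *: I + z *: B).
  by rewrite /P horner_pencil ?szf.
have cP a : (P a)`_m = f B by rewrite /P coef_pencil ?szf.
have fB : f B != 0 by apply: lt0r_neq0; exact: pB.
have sP a : size (P a) = m.+1.
  apply/eqP; rewrite eqn_leq size_pencil ltnNge; apply/negP => sz.
  by move: fB; rewrite -(cP a) nth_default// eqxx.
have := @root_homotopy R P m (f B) C fB sP _ C0.
have -> : Z = ofR 1 *: Z by rewrite rmorph1 scale1r.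
rewrite -PE; apply => //.
- by move=> a; rewrite lead_coefE sP.
- by move=> a b a01 b01 z; rewrite !PE; have [] := HC a b z a01 b01.
- move=> a a01 z zI; rewrite PE.
  have zE : z = ofR (ReC z) by rewrite {1}(complexDi z) zI mulr0 addr0.
  by rewrite zE; exact: H.
move=> z zI; rewrite PE scale0r add0r.
have [->|z0] := eqVneq z 0.
  have := H 0 0 e; rewrite lexx ler01 scale0r add0r rmorph0; exact.
(* By homogeneity it suffices that [t = ie/z] is not a negative real, which follows from
   [Im z >= 0]. *)
have -> : (iC * ofR e) *: I + z *: B = z *: (B + (iC * ofR e / z) *: I).
  by rewrite scalerDr scalerA addrC; congr (_ + _ *: _); field.
rewrite wedge_nseqZ ?szf// mulf_neq0// ?expf_neq0//.
apply: real_rooted => //.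
set t := _ / z.
have [tI|tI] := eqVneq (ImC t) 0; [left|by right].
have : t * z = iC * ofR e by rewrite /t divfK.
have tE : t = ofR (ReC t) by rewrite {1}(complexDi t) tI mulr0 addr0.
rewrite tE leNgt; case: (z) zI => x y /= y0 []; rewrite !mul0r !mul1r => _ h.
apply/negP => t0; nra.
Qed.

(** The strictly positive multiple of [I] allows [Y] on the boundary of the cone, in particular
    [Y = 0]. *)
Definition stab Y := forall X (c e : R), real_form X -> 0 <= c -> 0 < e ->
  f (i_add X (ofR c *: Y + ofR e *: I)) != 0.

Lemma stab0 : stab 0.
Proof. by move=> X c e hX c0 e0; rewrite scaler0 add0r; exact: f_posI. Qed.

(** The new direction is the pencil in [B] at [w = i c b], where [Im w >= 0]. At real [w] the term
    [wB] is absorbed into the Hermitian part [X], so [stab Y] excludes real roots during the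
    homotopy. *)
Lemma stabD Y B (b : R) : stab Y -> garding_cone B -> 0 <= b -> stab (Y + ofR b *: B).
Proof.
move=> sY gB b0 X c e hX c0 e0.
have -> : i_add X (ofR c *: (Y + ofR b *: B) + ofR e *: I) =
   i_add X (ofR c *: Y) + (iC * ofR e) *: I + (iC * ofR (c * b)) *: B.
  by rewrite (rmorphM ofR c b); exact: pencil_regroup.
apply: stable_homotopy => //=; last by rewrite !mul0r mul1r add0r mulr_ge0.
move=> a v {}e /andP[a0 a1] {}e0.
have -> : ofR a *: i_add X (ofR c *: Y) + (iC * ofR e) *: I + ofR v *: B =
  i_add (ofR a *: X + ofR v *: B) (ofR (a * c) *: Y + ofR e *: I).
  by rewrite (rmorphM ofR a c); exact: pencil_scale.
apply: sY => //; last exact: mulr_ge0.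
by apply: real_formD; apply: real_formZ => //; case: gB.
Qed.

(** The convex cone generated by the Garding cone, built one summand at a time to match [stabD]. *)
Inductive cone0 : M -> Prop :=
| cone0_0 : cone0 0
| cone0_D Y B (b : R) : cone0 Y -> garding_cone B -> 0 <= b -> cone0 (Y + ofR b *: B).

Lemma cone0_add Y Y' : cone0 Y -> cone0 Y' -> cone0 (Y + Y').
Proof.
move=> cY; elim=> [|Z B b cZ IH gB b0]; first by rewrite addr0.
by rewrite addrA; apply: cone0_D.
Qed.

Lemma cone0_scale Y (a : R) : 0 <= a -> cone0 Y -> cone0 (ofR a *: Y).
Proof.
move=> a0; elim=> [|Z B b cZ IH gB b0]; first by rewrite scaler0; exact: cone0_0.
by rewrite scalerDr scalerA -rmorphM; apply: cone0_D => //; exact: mulr_ge0.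
Qed.

Lemma cone0_stab Y : cone0 Y -> stab Y.
Proof. by elim=> [|Z B b cZ IH gB b0]; [exact: stab0|exact: stabD]. Qed.

Lemma cone0_real Y : cone0 Y -> real_form Y.
Proof.
elim=> [|Z B b cZ IH [hB _] b0]; first exact: real_form0.
by apply: real_formD => //; exact: real_formZ.
Qed.

Definition cone Y := exists Y0 (e : R), [/\ cone0 Y0, 0 < e & Y = Y0 + ofR e *: I].

Lemma cone_real Y : cone Y -> real_form Y.
Proof.
move=> [Y0 [e [cY _ ->]]]; apply: real_formD; first exact: cone0_real.
exact: real_formZ real_form1.
Qed.

Lemma coneD Y A (t : R) : cone A -> cone Y -> 0 <= t -> cone (Y + ofR t *: A).
Proof.
move=> [A0 [a [cA a0 ->]]] [Y0 [y [cY y0 ->]]] t0.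
exists (Y0 + ofR t *: A0), (y + t * a); split.
- by apply: cone0_add => //; exact: cone0_scale.
- by rewrite ltr_pwDl// mulr_ge0// ltW.
- by rewrite scalerDr scalerA rmorphD rmorphM scalerDl addrACA.
Qed.

Lemma cone_stable : stable_on cone m tl.
Proof.
move=> X _ hX [Y [e [cY e0 ->]]].
by have := cone0_stab Y cY X 1 e hX ler01 e0; rewrite scale1r.
Qed.

(** Polarisation: differentiating along each [A] in turn replaces the repeated slots by the given
    forms. *)
Lemma cone_list_stable k (As : seq M) : (k + size As)%N = m ->
  (forall A, A \in As -> cone A) -> stable_on cone k (As ++ tl).
Proof.
elim: As k => [|A As IH] k sz cAs.
  by move: sz; rewrite addn0 => ->; exact: cone_stable.
have cA : cone A by apply: cAs; rewrite inE eqxx.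
apply: (@stable_on_derive _ _ cone) => //.
- by rewrite size_cat size_nseq; move: sz => /=; lia.
- by move=> Y t cY t0; exact: coneD.
- exact: cone_real.
- apply: IH; first by rewrite -sz addnS.
  by move=> B BAs; apply: cAs; rewrite inE BAs orbT.
Qed.

Lemma cone_wedge_neq0 (As : seq M) : size As = m ->
  (forall A, A \in As -> cone A) -> wedge (As ++ tl) != 0.
Proof.
move=> sz cAs; have := cone_list_stable 0 As sz cAs; apply; first exact: real_form0.
by exists 0, 1; split => //; exact: cone0_0.
Qed.

Definition path_to_I (t : R) A := ofR (1 - t) *: A + ofR t *: I.

(** Makes the intermediate value theorem for polynomials applicable along the segment to the
    identity. *)
Lemma path_poly (As : seq M) s : (size As + size s)%N = n ->
  exists p : {poly R}, forall t, ReC (wedge (map (path_to_I t) As ++ s)) = p.[t].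
Proof.
elim: As s => [|A As IH] s sz.
  by exists (ReC (wedge s))%:P => t; rewrite hornerC.
have [|p pE] := IH (A :: s); first by rewrite /= addnS.
have [|q qE] := IH (I :: s); first by rewrite /= addnS.
exists ((1 - 'X) * p + 'X * q) => t.
rewrite hornerD !hornerM hornerD hornerN hornerX hornerC -pE -qE.
have szm : (size (map (path_to_I t) As) + size s).+1 = n by rewrite size_map.
rewrite /= !wedge_cat_cons// {1}/path_to_I wedgeD// !wedgeZ//.
case: (wedge _) => a b; case: (wedge _) => c d /=; ring.
Qed.

(* Along the segment from the [A_i] to the identity the mixed form does not
   vanish, except possibly at the starting point, and it is positive at the end. *)
Lemma garding_positivity (As : seq M) : size As = m ->
  (forall A, A \in As -> m_positive m A) -> 0 <= wedge (As ++ tl).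
Proof.
move=> sz pAs; have szn : (size As + size tl)%N = n by rewrite size_nseq sz; lia.
have [p pE] := path_poly As tl szn.
have Im0 (t : R) : ImC (wedge (map (path_to_I t) As ++ tl)) = 0.
  apply: wedge_conj => B; rewrite mem_cat => /orP[/mapP[A /pAs [hA _] ->]|].
    by apply: real_formD; apply: real_formZ => //; exact: real_form1.
  by rewrite mem_nseq => /andP[_ /eqP->]; exact: real_form1.
have E0 : map (path_to_I 0) As = As.
  rewrite -[RHS]map_id; apply: eq_map => A.
  by rewrite /path_to_I subr0 rmorph1 rmorph0 scale1r scale0r addr0.
have E1 : map (path_to_I 1) As = nseq m I.
  rewrite -sz; elim: (As) => //= A s ->; congr (_ :: _).
  by rewrite /path_to_I subrr rmorph1 rmorph0 scale1r scale0r add0r.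
have p1 : 0 < p.[1].
  rewrite -pE E1 -nseqD subnKC// wedge_nseq1.
  by rewrite -(rmorph_nat ofR)/= ltr0n fact_gt0.
suff p0 : 0 <= p.[0].
  have := Im0 0; have := pE 0; rewrite E0; case: (wedge _) => a b /= -> ->.
  by rewrite lecE/= eqxx.
rewrite leNgt; apply/negP => p0.
have [t /andP[t0 t1] /rootP rt] := @poly_ivt _ p _ _ ler01 (introT andP (conj (ltW p0) (ltW p1))).
have {}t0 : 0 < t.
  rewrite lt_neqAle t0 andbT; apply/eqP => t0'; move: p0.
  by rewrite -[X in p.[X]]t0' in rt; rewrite rt ltxx.
have := cone_wedge_neq0 (map (path_to_I t) As); rewrite size_map => /(_ sz) H.
have /H/eqP[] : forall A, A \in map (path_to_I t) As -> cone A.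
  move=> _ /mapP[A /pAs mA ->].
  (* Half of [tI] moves [A] into the open Garding cone; the other half is the multiple of [I]
     required by [cone]. *)
  exists (ofR (1 - t) *: A + ofR (t / 2) *: I), (t / 2); split.
  - rewrite -[X in cone0 X]add0r -[X in cone0 (_ + X)]scale1r -(rmorph1 ofR).
    apply: cone0_D => //; first exact: cone0_0.
    by apply: garding_cone_shift => //; lra.
  - by lra.
  - by rewrite /path_to_I -addrA -scalerDl -rmorphD/= -splitr.
have := Im0 t; have := pE t; rewrite rt.
by case: (wedge _) => a b /= -> ->.
Qed.

End garding.

(** * Forms of rank one *)

Section rank_one.
Context {R : realType} {n : nat}.
Local Notation K := (complex R).
Local Notation ImC := (@complex.Im R).
Local Notation ReC := (@complex.Re R).
Local Notation ofR := (real_complex R).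
Local Notation M := 'M[K]_n.
Local Notation I := (1%:M : M).
Implicit Types (s : seq M) (A B E : M).

(** Composing [sigma] with the transposition of the first two slots keeps the product [x y x y] and
    changes the sign. *)
Lemma wedge_rank1_sqr (x y : 'I_n -> K) s : (size s).+2 = n ->
  let E := \matrix_(i, j) (x i * y j) in wedge (E :: E :: s) = 0.
Proof.
move=> sz E; have l0 : (0 < n)%N by lia.
have l1 : (1 < n)%N by lia.
pose i0 := Ordinal l0; pose i1 := Ordinal l1; pose p := tperm i0 i1.
have i10 : i1 != i0 by [].
suff W : wedge (E :: E :: s) = - wedge (E :: E :: s).
  have /eqP : 2%:R * wedge (E :: E :: s) = 0 by rewrite mulr_natl mulr2n {1}W addNr.
  by rewrite mulf_eq0 pnatr_eq0 => /eqP.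
rewrite {1}/wedge (reindex_inj (mulgI p)) /= -sumrN; apply: eq_bigr => sigma _.
rewrite -sumrN; apply: eq_bigr => tau _.
rewrite odd_permM odd_tperm eq_sym i10 signrN !mulNr; congr (- (_ * _)).
rewrite [LHS](bigD1 i0)//= [in LHS](bigD1 i1)//=.
rewrite [RHS](bigD1 i0)//= [in RHS](bigD1 i1)//= !mxE !permM tpermL tpermR !mulrA.
congr (_ * _); first by ring.
apply: eq_bigr => l /andP[l0' l1']; rewrite permM tpermD// eq_sym//.
Qed.

(** Only [tau = sigma] survives, as two permutations that agree off one point are equal. The factor
    [n] permits averaging over the slot of [E], after which every [sigma] contributes the trace. *)
Lemma wedge_trace E : (0 < n)%N ->
  n%:R * wedge (E :: nseq n.-1 I) = n`!%:R * \sum_j E j j.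
Proof.
move=> n0; pose i0 := Ordinal n0.
have E1 (sigma tau : 'S_n) : (-1) ^+ sigma * (-1) ^+ tau *
    \prod_(l < n) nth 0 (E :: nseq n.-1 I) l (sigma l) (tau l) =
    if tau == sigma then E (sigma i0) (sigma i0) else 0 :> K.
  rewrite (bigD1 i0)//=.
  have F (l : 'I_n) : l != i0 ->
      nth 0 (E :: nseq n.-1 I) l (sigma l) (tau l) = (sigma l == tau l)%:R :> K.
    case: l => -[|l] ll; first by move=> /eqP[]; exact: val_inj.
    by move=> _; rewrite /= nth_nseq ifT ?mxE//; lia.
  case: eqP => [ts|ts].
    rewrite ts in F *; rewrite -expr2 sqrr_sign mul1r big1 ?mulr1// => l ll.
    by rewrite F// eqxx.
  have [l /andP[ll sl]] : exists l, (l != i0) && (sigma l != tau l).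
    apply: contrapT => H; apply: ts.
    have H' l : l != i0 -> sigma l = tau l.
      by move=> ll; apply: contrapT => /eqP sl; apply: H; exists l; rewrite ll.
    apply/permP => l; have [->{l}|/H'//] := eqVneq l i0.
    have [//|ne] := eqVneq (tau i0) (sigma i0).
    have : (tau^-1)%g (sigma i0) != i0.
      by apply: contra ne => /eqP hh; rewrite -{1}hh permKV.
    move=> h; have := H' _ h; rewrite permKV => /perm_inj h'.
    by rewrite h' eqxx in h.
  by rewrite (bigD1 l)//= F// (negbTE sl) mul0r !mulr0.
have -> : wedge (E :: nseq n.-1 I) = \sum_(sigma : 'S_n) E (sigma i0) (sigma i0).
  rewrite /wedge; apply: eq_bigr => sigma _.
  by rewrite (eq_bigr _ (fun tau _ => E1 sigma tau)) -big_mkcond big_pred1_eq.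
have S (i : 'I_n) : \sum_(sigma : 'S_n) E (sigma i0) (sigma i0) =
    \sum_(sigma : 'S_n) E (sigma i) (sigma i).
  rewrite (reindex_inj (mulgI (tperm i0 i))) /=; apply: eq_bigr => sigma _.
  by rewrite !permM tpermL.
transitivity (\sum_(i < n) \sum_(sigma : 'S_n) E (sigma i) (sigma i)).
  under [RHS]eq_bigr do rewrite -S.
  by rewrite sumr_const card_ord mulr_natl.
rewrite exchange_big /= (eq_bigr (fun=> \sum_j E j j)).
  by rewrite sumr_const card_Sn mulr_natl.
by move=> sigma _; rewrite [RHS](reindex_inj (@perm_inj _ sigma)).
Qed.

(** The binomial expansion stops after the linear term because [E /\ E = 0]. *)
Lemma wedge_rank1_pencil (a b : K) (x y : 'I_n -> K) k : (0 < n)%N -> (k <= n)%N ->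
  let E := \matrix_(i, j) (x i * y j) in
  wedge (nseq k (a *: I + b *: E) ++ nseq (n - k) I) =
  a ^+ k * n`!%:R + k%:R * a ^+ k.-1 * b * wedge (E :: nseq n.-1 I).
Proof.
move=> n0 kn E; set B := _ + _.
have V j : (j < n)%N ->
    wedge (nseq j B ++ E :: nseq (n - j).-1 I) = a ^+ j * wedge (E :: nseq n.-1 I).
  elim: j => [|j IH] jn; first by rewrite subn0 mul1r.
  rewrite /= {1}/B wedgeD// !wedgeZ//.
  have -> : wedge (E :: nseq j B ++ E :: nseq (n - j.+1).-1 I) = 0.
    rewrite -(wedge_rank1_sqr x y (nseq j B ++ nseq (n - j.+1).-1 I)); last first.
      by rewrite size_cat !size_nseq; lia.
    apply: wedge_perm; first by rewrite /= size_cat/= !size_nseq; lia.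
    by rewrite perm_cons -cat1s perm_catCA.
  rewrite mulr0 addr0 exprS -mulrA -IH; last by lia.
  congr (_ * _); apply: wedge_perm; first by rewrite /= size_cat/= !size_nseq; lia.
  rewrite (_ : (n - j).-1 = (n - j.+1).-1.+1)//; last by lia.
  by apply/seq.permP => P; rewrite /= !count_cat /=; lia.
elim: k kn => [|k IH] kn; first by rewrite subn0 /= wedge_nseq1 !mul0r addr0 mul1r.
have -> : wedge (nseq k.+1 B ++ nseq (n - k.+1) I) =
    a * wedge (nseq k B ++ nseq (n - k) I) + b * wedge (nseq k B ++ E :: nseq (n - k).-1 I).
  rewrite (_ : (n - k)%N = (n - k.+1).+1); last by lia.
  have sz : (size (nseq k B) + size (nseq (n - k.+1) I)).+1 = n by rewrite !size_nseq; lia.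
  by rewrite /= !wedge_cat_cons// {1}/B wedgeD// !wedgeZ.
rewrite IH ?V//; last by lia.
case: k {IH} kn => [|k] kn; first by rewrite /= mul0r !mul0r addr0 !expr0 expr1 !mul1r.
by move: (n`!%:R) (wedge _) => N w; rewrite /= -[k.+2%:R]natr1 !exprS; ring.
Qed.

(** Up to positive factors the k-th product is [a^(k-1) (n a + k b |z|^2)]; as [b <= 0], the
    condition for [k = m] is the strongest. *)
Lemma m_positive_rank1 (m : nat) (a b : R) (z : 'I_n -> K) : (0 < n)%N -> (m <= n)%N ->
  0 <= a -> b <= 0 ->
  0 <= n%:R * a + m%:R * b * \sum_j (ReC (z j) ^+ 2 + ImC (z j) ^+ 2) ->
  m_positive m (ofR a *: I + ofR b *: \matrix_(i, j) (conjc (z i) * z j)).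
Proof.
move=> n0 mn a0 b0 ab; split.
  apply: real_formD; apply: real_formZ; first exact: real_form1.
  move=> i j; rewrite !mxE; case: (z i) => u v; case: (z j) => u' v'.
  by apply/eqP; rewrite eq_complex/=; apply/andP; split; apply/eqP; ring.
move=> k /andP[k1 km]; have kn : (k <= n)%N by apply: leq_trans mn.
rewrite wedge_rank1_pencil//.
set w := wedge _; set S := \sum_j _ in ab.
have wE : n%:R * w = ofR (n`!%:R * S).
  rewrite /w wedge_trace// rmorphM rmorph_nat; congr (_ * _).
  rewrite rmorph_sum; apply: eq_bigr => j _; rewrite mxE; case: (z j) => u v.
  by apply/eqP; rewrite eq_complex/=; apply/andP; split; apply/eqP; ring.
have S0 : 0 <= S by apply: sumr_ge0 => j _; rewrite addr_ge0// sqr_ge0.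
have nK : 0 < n%:R :> K by rewrite ltr0n.
rewrite -(pmulr_rge0 _ nK).
have -> : n%:R * (ofR a ^+ k * n`!%:R + k%:R * ofR a ^+ k.-1 * ofR b * w) =
   ofR (n`!%:R * a ^+ k.-1 * (n%:R * a + k%:R * b * S)).
  have -> : n%:R * (ofR a ^+ k * n`!%:R + k%:R * ofR a ^+ k.-1 * ofR b * w) =
   n%:R * ofR a ^+ k * n`!%:R + k%:R * ofR a ^+ k.-1 * ofR b * (n%:R * w) by ring.
  rewrite wE -{1}(prednK k1) exprS.
  rewrite !(rmorphM ofR, rmorphD ofR, rmorph_nat ofR, rmorphXn ofR); ring.
rewrite ler0c mulr_ge0//; first by rewrite mulr_ge0// ?ler0n// exprn_ge0.
apply: le_trans ab _; rewrite lerD2l -!mulrA ler_wnM2r//; last by rewrite ler_nat.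
by rewrite mulr_le0_ge0.
Qed.

End rank_one.

(** * Lebesgue measure on tuples *)

Section lebesgue_tuple.
Context {R : realType}.
Local Notation RM := (measurableTypeR R).
Local Notation mu d := (@lebesgue R d).
Local Notation leb := (@lebesgue_measure R).

Definition rv_of {d} (t : d.-tuple RM) : 'rV[R]_d := \row_j (tnth t j : R).

Lemma measurable_translate (a : R) : measurable_fun [set: RM] (fun x : RM => (x + a : RM)).
Proof. exact: measurable_funD. Qed.

Section translate1.
Variable a : R.
Definition translate (x : RM) : RM := x + a.
HB.instance Definition _ := isMeasurableFun.Build _ _ _ _ translate (measurable_translate a).

Lemma lebesgue_measure_translate (A : set RM) : measurable A ->
  leb (translate @^-1` A) = leb A.
Proof.
move=> mA; apply/esym.
have := @lebesgue_measure_unique R (pushforward leb translate : {measure set _ -> \bar R}).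
move=> -> // X [[x y] _ <-] /=.
have -> : pushforward leb translate `]x, y]%classic = leb `]x - a, y - a]%classic.
  congr (leb _); apply/seteqP; split => z /=; rewrite /translate !in_itv/=.
    by rewrite ltrBlDr lerBrDr.
  by rewrite ltrBlDr lerBrDr.
rewrite !lebesgue_measure_itv/= !lte_fin.
have -> : (x - a < y - a) = (x < y) by rewrite ltrD2r.
by case: ifP => // _; congr (_%:E); ring.
Qed.
End translate1.

Definition shift_tuple {d} (v : 'rV[R]_d) (t : d.-tuple RM) : d.-tuple RM :=
  [tuple (tnth t i + v ord0 i : RM) | i < d].

Lemma measurable_shift {d} (v : 'rV[R]_d) : measurable_fun [set: d.-tuple RM] (shift_tuple v).
Proof.
apply/measurable_fun_tnthP => i.
have -> : @tnth d RM ^~ i \o shift_tuple v = translate (v ord0 i) \o (@tnth d RM ^~ i).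
  by apply/funext => t; rewrite /= tnth_mktuple.
by apply: measurableT_comp; [exact: measurable_translate|exact: measurable_tnth].
Qed.

Section shift_inst.
Context {d : nat} (v : 'rV[R]_d).
HB.instance Definition _ := isMeasurableFun.Build _ _ _ _ (shift_tuple v) (measurable_shift v).
End shift_inst.

Section shift_prod.
Context {d : nat} (a : R) (v : 'rV[R]_d).
Definition shift_prod (p : RM * d.-tuple RM) : RM * d.-tuple RM :=
  (translate a p.1, shift_tuple v p.2).
Lemma measurable_shift_prod : measurable_fun setT shift_prod.
Proof.
apply/measurable_fun_pairP; split => /=.
  by apply: (measurableT_comp (measurable_translate a)); exact: measurable_fst.
by apply: (measurableT_comp (measurable_shift v)); exact: measurable_snd.
Qed.
HB.instance Definition _ := isMeasurableFun.Build _ _ _ _ shift_prod measurable_shift_prod.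
End shift_prod.

(** Through [tcons] a shift is a product of shifts, so uniqueness of the product measure reduces the
    claim to rectangles and to the lower dimension. *)
Lemma lebesgue_shift {d} (v : 'rV[R]_d) (A : set (d.-tuple RM)) : measurable A ->
  mu d (shift_tuple v @^-1` A) = mu d A.
Proof.
elim: d v A => [|d IH] v A mA.
  congr (_ _); apply/seteqP; split => t /=; rewrite (tuple0 t) (tuple0 (shift_tuple _ _))//.
pose v' : 'rV[R]_d := \row_i v ord0 (lift ord0 i).
have mtA : measurable (@tcons R d @^-1` A).
  by rewrite -[X in measurable X]setTI; exact: measurable_tcons.
have E : shift_tuple v \o @tcons R d = @tcons R d \o shift_prod (v ord0 ord0) v'.
  apply/funext => -[x t]; apply: eq_from_tnth => i; rewrite tnth_mktuple.
  case: (unliftP ord0 i) => [j|] ->; last by rewrite /tcons /= !tnth0.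
  by rewrite /tcons/= !tnthS tnth_mktuple mxE.
rewrite /= /lebesgue_cons /pushforward -comp_preimage E comp_preimage.
apply/esym; apply: (@product_measure_unique _ _ _ _ _ leb (mu d)
  (pushforward (leb \x mu d)%E (shift_prod (v ord0 ord0) v') : {measure set _ -> \bar R})) => //.
move=> B C mB mC; rewrite /pushforward.
change ((leb \x mu d)%E ((translate (v ord0 ord0) @^-1` B) `*` (shift_tuple v' @^-1` C)) =
  (leb B * mu d C)%E).
have mB' : measurable (translate (v ord0 ord0) @^-1` B).
  by rewrite -[X in measurable X]setTI; exact: measurable_translate.
have mC' : measurable (shift_tuple v' @^-1` C).
  by rewrite -[X in measurable X]setTI; exact: measurable_shift.
rewrite product_measure1E//.
by congr (_ * _)%E; [exact: lebesgue_measure_translate|exact: IH].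
Qed.

Lemma measurable_box d (q : 'rV[R]_d) (r : R) :
  measurable [set t : d.-tuple RM | forall i, `|tnth t i - q ord0 i| < r].
Proof.
have -> : [set t : d.-tuple RM | forall i, `|tnth t i - q ord0 i| < r] =
  \bigcap_(i in [set: 'I_d]) ((@tnth d RM ^~ i) @^-1` `]q ord0 i - r, q ord0 i + r[%classic).
  apply/seteqP; split => t /= H i => [_|]; last move: (H i Logic.I); rewrite /= in_itv/= -?ltr_distl//.
apply: fin_bigcap_measurable => // i _; rewrite -[X in measurable X]setTI.
exact: measurable_tnth.
Qed.

Definition cbox d (b : R) : set (d.-tuple RM) := [set t | forall i, `|tnth t i : R| <= b].

Lemma measurable_cbox d (b : R) : measurable (cbox d b).
Proof.
have -> : cbox d b = \bigcap_(i in [set: 'I_d]) ((@tnth d RM ^~ i) @^-1` `[- b, b]%classic).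
  by apply/seteqP; split => t /= H i => [_|]; last move: (H i Logic.I);
    rewrite /= in_itv/= -?ler_norml//.
apply: fin_bigcap_measurable => // i _; rewrite -[X in measurable X]setTI.
exact: measurable_tnth.
Qed.

Lemma lebesgue_cbox d (b : R) : 0 <= b -> mu d (cbox d b) = ((2 * b) ^+ d)%:E.
Proof.
move=> b0; elim: d => [|d IH].
  rewrite expr0 /= diracE mem_set// => i; by case: i.
rewrite /= /lebesgue_cons /pushforward.
rewrite [X in (_ \x _)%E X](_ : _ = `[- b, b]%classic `*` cbox d b).
  rewrite product_measure1E//; last exact: measurable_cbox.
  transitivity ((2 * b)%:E * ((2 * b) ^+ d)%:E)%E; last by rewrite -EFinM exprS.
  congr (_ * _)%E; last exact: IH.
  have := @lebesgue_measure_itv R `[- b, b]; rewrite /= lte_fin => ->.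
  by case: ifPn => h; [rewrite -EFinB|]; congr (_%:E); lra.
apply/seteqP; split => -[x t] /=.
  move=> H; split; last by move=> i; have := H (lift ord0 i); rewrite /tcons/= tnthS.
  by have := H ord0; rewrite /tcons/= tnth0 in_itv/= ler_norml.
move=> [xb tb] i; rewrite /tcons/=.
case: (unliftP ord0 i) => [j|] ->; first by rewrite tnthS.
by rewrite tnth0 ler_norml; move: xb; rewrite in_itv/=.
Qed.

(** The sigma-algebra on tuples is the product one, so an open set has to be exhibited as a
    countable union of boxes with rational centres. *)
Lemma open_measurable_rv d (U : set 'rV[R]_d) : open U -> measurable (@rv_of d @^-1` U).
Proof.
move=> oU.
pose box (q : d.-tuple rat) (k : nat) :=
  [set t : d.-tuple RM | forall i, `|tnth t i - (\row_i (ratr (tnth q i) : R)) ord0 i| < k.+1%:R^-1].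
pose D := [set p : d.-tuple rat * nat | box p.1 p.2 `<=` @rv_of d @^-1` U].
have -> : @rv_of d @^-1` U = \bigcup_(p in D) box p.1 p.2; last first.
  rewrite bigcup_mkcond; apply: countable_bigcupT_measurable; first exact: countableP.
  by move=> p; case: ifP => // _; exact: measurable_box.
apply/seteqP; split; last by move=> t [p Dp tp]; exact: Dp.
move=> t Ut.
have /nbhs_ballP [e /= e0 eU] : nbhs (rv_of t) U by rewrite openE in oU; exact: oU.
(* With this radius, a box that contains [t] stays within distance [e] of it. *)
have [k ke] : exists k : nat, k.+1%:R^-1 < e / 2.
  have e2 : 0 < e / 2 by lra.
  by have [k _ /(_ k (leqnn _))] := near_infty_natSinv_lt (PosNum e2); exists k.
have k2e : k.+1%:R^-1 + k.+1%:R^-1 < e :> R by move: ke; set h := k.+1%:R^-1; lra.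
have k0 : 0 < k.+1%:R^-1 :> R by rewrite invr_gt0.
have H (i : 'I_d) : exists q : rat, `|(tnth t i : R) - ratr q| < k.+1%:R^-1.
  have lt : (tnth t i : R) - k.+1%:R^-1 < (tnth t i : R) + k.+1%:R^-1.
    by rewrite ltrD2l gtrN.
  have [q] := rat_in_itvoo lt.
  by rewrite in_itv/= -ltr_distl distrC; exists q.
have [q Hq] := choice H.
exists ([tuple q i | i < d], k).
  move=> s /= sb; apply: eU; split => // i j.
  rewrite (ord1 i) !mxE /ball/=.
  have := sb j; rewrite mxE tnth_mktuple => h1; have := Hq j => h2.
  have -> : tnth t j - tnth s j = (tnth t j - ratr (q j)) - (tnth s j - ratr (q j)) :> R by ring.
  by apply: le_lt_trans (ler_normB _ _) _; exact: lt_trans (ltrD h2 h1) k2e.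
by move=> i /=; rewrite mxE tnth_mktuple; exact: Hq.
Qed.

Lemma closed_measurable_rv d (F : set 'rV[R]_d) : closed F -> measurable (@rv_of d @^-1` F).
Proof.
by move=> /closed_openC/open_measurable_rv/measurableC; rewrite preimage_setC setCK.
Qed.

Lemma continuous_measurable_rv d (f : 'rV[R]_d -> R) : continuous f ->
  measurable_fun setT (f \o @rv_of d : _ -> RM).
Proof.
move=> cf _; apply: (measurability _ (RGenOpens.measurableE R)) => //.
move=> _ [_ [a [b ->] <-]]; rewrite setTI comp_preimage; apply: open_measurable_rv.
apply: open_comp; first by move=> x _; exact: cf.
by apply: interval_open.
Qed.

Lemma rv_of_shift d (v : 'rV[R]_d) t : rv_of (shift_tuple v t) = rv_of t + v.
Proof. by apply/rowP => i; rewrite !mxE tnth_mktuple. Qed.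

End lebesgue_tuple.

(** * Integration by parts *)

Section compactly_supported_integral.
Context {R : realType} {d : nat}.
Local Notation RM := (measurableTypeR R).
Local Notation mu := (@lebesgue R d).
Local Notation V := 'rV[R]_d.
Implicit Types (f g : V -> R).

Definition supp_in (b : R) f := forall x, f x != 0 -> forall i, `|x ord0 i| <= b.

Definition cont_supp f := continuous f /\ exists b, supp_in b f.

Definition Int f : R := (\int[mu]_t (f (rv_of t)))%R.

Lemma compact_box (b : R) : compact [set x : V | forall i, `|x ord0 i| <= b].
Proof.
have -> : [set x : V | forall i, `|x ord0 i| <= b] =
  [set x : V | forall i, `[(-b), b]%classic (x ord0 i)].
  by apply/seteqP; split => x /= H i; have := H i; rewrite /= in_itv/= ler_norml.
by apply: (@rV_compact R d (fun=> `[(-b), b]%classic)) => i; exact: segment_compact.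
Qed.

Lemma cont_supp_bounded f : cont_supp f -> exists2 M : R, 0 <= M & forall x, `|f x| <= M.
Proof.
move=> [cf [b sb]].
have /compact_bounded[M [_ HM]] : compact (f @` [set x : V | forall i, `|x ord0 i| <= b]).
  by apply: continuous_compact; [exact: continuous_subspaceT|exact: compact_box].
exists (`|M| + 1); first by rewrite addr_ge0.
move=> x; have [->|fx] := eqVneq (f x) 0; first by rewrite normr0 addr_ge0.
apply: (HM (`|M| + 1)); first by rewrite (le_lt_trans (ler_norm _))// ltrDl.
by exists x => //; exact: sb.
Qed.

Lemma cbox_finite (b : R) : (mu (cbox d b) < +oo)%E.
Proof.
have [b0|b0] := leP 0 b; first by rewrite lebesgue_cbox// ltry.
apply: (@le_lt_trans _ _ (mu (cbox d 0))); last first.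
  by rewrite lebesgue_cbox// ltry.
apply: le_measure; rewrite ?inE.
- exact: measurable_cbox.
- exact: measurable_cbox.
- by move=> t H i; apply: le_trans (H i) (ltW b0).
Qed.

Lemma bounded_supp_integrable (f : d.-tuple RM -> R) M b :
  measurable_fun setT (f : _ -> RM) -> (forall t, `|f t| <= M) ->
  (forall t, f t != 0 -> cbox d b t) ->
  mu.-integrable setT (EFin \o f).
Proof.
move=> mf fM sf; have mB := measurable_cbox d b.
have -> : EFin \o f = (EFin \o f) \_ (cbox d b).
  apply/funext => t; rewrite /patch; case: ifPn => // /negP tB /=.
  by congr (_%:E); apply: contrapT => /eqP /sf H; apply: tB; rewrite inE.
apply/integrable_restrict => //; rewrite setTI.
apply: measurable_bounded_integrable => //.
- exact: cbox_finite.
- exact: measurable_funTS.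
- exists M; split; first exact: num_real.
  by move=> c Mc t _ /=; apply: le_trans (ltW Mc).
Qed.

Lemma cont_supp_integrable f : cont_supp f ->
  mu.-integrable setT (EFin \o (f \o @rv_of R d)).
Proof.
move=> cf; have [M _ fM] := cont_supp_bounded f cf; have [c [b sb]] := cf.
apply: (bounded_supp_integrable (f \o @rv_of R d) M b); first exact: continuous_measurable_rv.
  by move=> t /=; exact: fM.
by move=> t /= ft i; have := sb _ ft i; rewrite mxE.
Qed.

Lemma cont_suppD f g : cont_supp f -> cont_supp g -> cont_supp (fun x => f x + g x).
Proof.
move=> [cf [b fb]] [cg [c gc]]; split; first by move=> x; apply: (@continuousD _ _ _ f g x); [exact: cf|exact: cg].
exists (Num.max b c) => x h i; rewrite le_max.
have [fx|fx] := eqVneq (f x) 0; last by rewrite fb.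
by rewrite gc ?orbT//; move: h; rewrite fx add0r.
Qed.

Lemma cont_suppMl f g : continuous f -> cont_supp g -> cont_supp (fun x => f x * g x).
Proof.
move=> cf [cg [c gc]]; split; first by move=> x; apply: (@continuousM _ _ f g x); [exact: cf|exact: cg].
by exists c => x; rewrite mulf_eq0 negb_or => /andP[_ gx]; exact: gc.
Qed.

Lemma cont_suppMr f g : cont_supp f -> continuous g -> cont_supp (fun x => f x * g x).
Proof.
move=> cf cg; rewrite (_ : (fun x => _) = (fun x => g x * f x)).
  exact: cont_suppMl.
by apply/funext => x; rewrite mulrC.
Qed.

Lemma cont_suppZ (a : R) f : cont_supp f -> cont_supp (fun x => a * f x).
Proof. by move=> cf; apply: cont_suppMl => //; exact: cst_continuous. Qed.

Lemma cont_supp0 : cont_supp (fun=> 0).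
Proof. by split; [exact: cst_continuous|exists 0 => x; rewrite eqxx]. Qed.

Lemma cont_supp_sum (I : Type) (r : seq I) (F : I -> V -> R) :
  (forall i, cont_supp (F i)) -> cont_supp (fun x => \sum_(i <- r) F i x).
Proof.
move=> cF; elim: r => [|i r IH].
  by under eq_fun do rewrite big_nil; exact: cont_supp0.
by under eq_fun do rewrite big_cons; exact: cont_suppD.
Qed.

Lemma IntD f g : cont_supp f -> cont_supp g -> Int (fun x => f x + g x) = Int f + Int g.
Proof. by move=> cf cg; rewrite /Int RintegralD//; exact: cont_supp_integrable. Qed.

Lemma IntZ (a : R) f : cont_supp f -> Int (fun x => a * f x) = a * Int f.
Proof. by move=> cf; rewrite /Int RintegralZl//; exact: cont_supp_integrable. Qed.

Lemma Int0 : Int (fun=> 0) = 0.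
Proof. by rewrite /Int Rintegral_cst// mul0r. Qed.

Lemma Int_sum (I : Type) (r : seq I) (F : I -> V -> R) : (forall i, cont_supp (F i)) ->
  Int (fun x => \sum_(i <- r) F i x) = \sum_(i <- r) Int (F i).
Proof.
move=> cF; elim: r => [|i r IH].
  by under eq_fun do rewrite big_nil; rewrite big_nil Int0.
under eq_fun do rewrite big_cons; rewrite big_cons IntD ?IH//.
exact: cont_supp_sum.
Qed.

Lemma Int_ge0 f : (forall x, 0 <= f x) -> 0 <= Int f.
Proof. by move=> f0; apply: Rintegral_ge0. Qed.

Lemma IntE f : cont_supp f -> (\int[mu]_t (f (rv_of t))%:E = (Int f)%:E)%E.
Proof.
move=> cf; rewrite /Int /Rintegral fineK//; apply: integrable_fin_num => //.
exact: cont_supp_integrable.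
Qed.

Lemma cont_supp_shift f (v : V) : cont_supp f -> cont_supp (fun x => f (x + v)).
Proof.
move=> [c [b sb]].
have H : continuous (f \o (fun x => x + v)).
  move=> x; apply: continuous_comp; last exact: c.
  by apply: (@continuousD _ _ _ (fun x : V => x) (fun=> v) x); [exact: cvg_id|exact: cst_continuous].
split; first exact: H.
exists (b + \sum_i `|v ord0 i|) => x fx i.
have := sb _ fx i; rewrite mxE => h.
rewrite -[x ord0 i](addrK (v ord0 i)); apply: le_trans (ler_normB _ _) _.
by apply: lerD => //; rewrite (bigD1 i)//= lerDl sumr_ge0.
Qed.

Lemma Int_shift f (v : V) : cont_supp f -> Int (fun x => f (x + v)) = Int f.
Proof.
move=> cf; rewrite /Int /Rintegral; congr fine.
have mf : measurable_fun setT (fun t : d.-tuple RM => (f (rv_of t))%:E).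
  by apply/measurable_EFinP; apply: continuous_measurable_rv; case: cf.
have int : mu.-integrable (shift_tuple v @^-1` setT)
    ((fun t : d.-tuple RM => (f (rv_of t))%:E) \o shift_tuple v).
  rewrite (_ : _ \o _ = EFin \o ((fun x => f (x + v)) \o @rv_of R d)); last first.
    by apply/funext => t /=; rewrite rv_of_shift.
  by apply: cont_supp_integrable; exact: cont_supp_shift.
transitivity (\int[pushforward mu (shift_tuple v)]_t ((f (rv_of t))%:E))%E.
  rewrite (integral_pushforward (measurable_shift v) mf int measurableT).
  by apply: eq_integral => t _ /=; rewrite rv_of_shift.
by apply: eq_measure_integral => A mA _; exact: lebesgue_shift.
Qed.

(** Differentiation under the integral sign with majorant [|M|] on a box common to all [t]. *)
Lemma Int_derive (F F' : R -> V -> R) (u v a M b : R) : u < a < v ->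
  (forall t, u < t < v -> cont_supp (F t)) ->
  (forall t x, u < t < v -> is_derive t 1 (F^~ x) (F' t x)) ->
  (forall t x, u < t < v -> `|F' t x| <= M) ->
  (forall t, u < t < v -> supp_in b (F' t)) ->
  is_derive a 1 (fun t => Int (F t)) (Int (F' a)).
Proof.
move=> uav cF dF bF sF.
pose G (t : d.-tuple RM) : R := `|M| * \1_(cbox d b) t.
have mb := measurable_cbox d b.
have d1 t (y : d.-tuple RM) : u < t < v ->
    partial1of2 (fun t y => F t (rv_of y)) t y = F' t (rv_of y).
  by move=> ht; rewrite partial1of2E; have := dF t (rv_of y) ht; case.
have H := @cvg_differentiation_under_integral R _ (d.-tuple RM) mu
  (fun t y => F t (rv_of y)) setT measurableT a u v.
have {H} : h^-1 *: (Int (F (h + a)) - Int (F a)) @[h --> 0^'] --> Int (F' a).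
  rewrite /Int [X in _ --> X](_ : _ =
    (\int[mu]_y (partial1of2 (fun t y => F t (rv_of y)) a y))%R); last first.
    by apply: eq_Rintegral => y _; rewrite d1.
  apply: (H _ _ _ G).
  - by rewrite /= in_itv.
  - by move=> t; rewrite /= in_itv/= => ht; apply: cont_supp_integrable; exact: cF.
  - move=> t y; rewrite /= in_itv/= => ht _; have := dF t (rv_of y) ht; case=> //.
  - by move=> t; rewrite /G mulr_ge0.
  - apply: (bounded_supp_integrable G `|M| b).
    + by apply: measurable_funM => //; exact: measurable_indic.
    + move=> t; rewrite /G indicE normrM normr_id.
      by case: (_ \in _); rewrite /= ?normr1 ?normr0 ?mulr1 ?mulr0.
    + move=> t; rewrite /G indicE; case: (boolP (t \in _)) => [|_]; first by rewrite inE.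
      by rewrite mulr0 eqxx.
  - move=> t y; rewrite /= in_itv/= => ht _; rewrite d1// /G indicE.
    case: (boolP (y \in _)) => [_|/negP yb].
      by rewrite mulr1 (le_trans (bF _ _ ht))// ler_norm.
    rewrite mulr0 normr_le0; apply/negP => /negP Fy; apply: yb; rewrite inE => i.
    by have := sF t ht _ Fy i; rewrite mxE.
move=> H; apply: DeriveDef.
  apply/cvg_ex; exists (Int (F' a)).
  by under eq_fun do rewrite scaler1.
rewrite /derive; under eq_fun do rewrite scaler1.
exact/cvg_lim.
Qed.

(** The integral of [F(x + te)] is constant in [t] by translation invariance, and its derivative at
    0 is the integral of [G]. *)
Lemma Int_partial0 (e : V) (F G : V -> R) : cont_supp F -> cont_supp G ->
  (forall x, is_derive x e F (G x)) -> Int G = 0.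
Proof.
move=> cF cG dF.
have [M _ bG] := cont_supp_bounded G cG; have [_ [b sb]] := cG.
have [M0 _ bF] := cont_supp_bounded F cF.
have H : is_derive (0:R) (1:R) (fun t => Int (fun x => F (x + t *: e)))
    (Int (fun x => G (x + 0 *: e))).
  (* The enlarged box contains the supports of all translates of [G] with [|t| < 1]. *)
  apply: (@Int_derive (fun t x => F (x + t *: e)) (fun t x => G (x + t *: e))
     (-1) 1 0 M (b + \sum_i `|e ord0 i|)).
  - by apply/andP; split; lra.
  - by move=> t _; exact: cont_supp_shift.
  - move=> t x _; have := dF (x + t *: e) => -[dv dE].
    have E : (fun h : R => h^-1 *: (F (x + (h *: 1 + t) *: e) - F (x + t *: e))) =
        (fun h : R => h^-1 *: (F (h *: e + (x + t *: e)) - F (x + t *: e))).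
      apply/funext => h; congr (_ *: (F _ - _)).
      by rewrite scaler1 scalerDl addrCA.
    apply: DeriveDef; first by rewrite /derivable E.
    by rewrite /derive E.
  - by move=> t x _; exact: bG.
  - move=> t /andP[t1 t2] x Gx i; have := sb _ Gx i; rewrite !mxE => h.
    rewrite -[x ord0 i](addrK (t * e ord0 i)); apply: le_trans (ler_normB _ _) _.
    apply: lerD => //; rewrite (bigD1 i)//=; apply: ler_wpDr; first exact: sumr_ge0.
    by rewrite normrM ler_piMl// ler_norml; apply/andP; split; lra.
have : is_derive (0:R) (1:R) (fun t : R => Int (fun x => F (x + t *: e))) 0.
  rewrite (_ : (fun t : R => _) = cst (Int F)); first exact: is_derive_cst.
  by apply/funext => t; rewrite Int_shift.
case: H => _ h1 [_ h2]; transitivity (Int (fun x => G (x + 0 *: e))).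
  by congr Int; apply/funext => x; rewrite scale0r addr0.
by rewrite -h1 h2.
Qed.

Lemma Int_by_parts (e : V) (u u' F F' : V -> R) :
  continuous u -> continuous u' -> cont_supp F -> cont_supp F' ->
  (forall x, is_derive x e u (u' x)) -> (forall x, is_derive x e F (F' x)) ->
  Int (fun x => u x * F' x) = - Int (fun x => u' x * F x).
Proof.
move=> cu cu' cF cF' du dF; apply/eqP; rewrite -addr_eq0 -IntD; last 2 first.
- exact: cont_suppMl.
- exact: cont_suppMl.
apply/eqP; apply: (@Int_partial0 e (fun x => u x * F x)).
- exact: cont_suppMl.
- by apply: cont_suppD; exact: cont_suppMl.
- move=> x; have := @is_deriveM _ _ u F x e _ _ (du x) (dF x).
  by move=> H; apply: is_derive_eq; rewrite /GRing.scale/= [F x * _]mulrC.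
Qed.

End compactly_supported_integral.

(** * Radial functions and the regularised profile *)

Section directional_derivatives.
Context {R : realType}.

Lemma is_derive_cvg {V : normedModType R} (x v : V) (f : V -> R) (df : R) :
  is_derive x v f df <-> h^-1 *: (f (h *: v + x) - f x) @[h --> 0^'] --> df.
Proof.
split; first by case=> dv <-; exact: dv.
by move=> H; apply: DeriveDef; [apply/cvg_ex; exists df|exact/cvg_lim].
Qed.

Lemma is_derive_line {V : normedModType R} (x v : V) (f : V -> R) (df : R) :
  is_derive x v f df <-> is_derive (0 : R) (1 : R) (fun h : R => f (h *: v + x)) df.
Proof.
split=> /is_derive_cvg H; apply/is_derive_cvg; apply: cvg_trans H.
  rewrite (_ : (fun h : R => _) = (fun h : R => h^-1 *: (f (h *: v + x) - f x)))//.
  by apply/funext => h /=; rewrite addr0 scale0r add0r scaler1.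
rewrite (_ : (fun h : R => _) = (fun h : R => h^-1 *: (f ((h *: 1 + 0 : R) *: v + x) - f (0 *: v + x))))//.
by apply/funext => h /=; rewrite addr0 scale0r add0r scaler1.
Qed.

Lemma is_derive_chain {V : normedModType R} (x v : V) (g : V -> R) (f : R -> R) (dg df : R) :
  is_derive x v g dg -> is_derive (g x) 1 f df -> is_derive x v (f \o g) (df * dg).
Proof.
move=> /is_derive_line H1 H2; apply/is_derive_line.
have H2' : is_derive (g ((0 : R) *: v + x)) 1 f df by rewrite scale0r add0r.
exact: (@is_derive1_comp _ f (fun h : R => g (h *: v + x)) 0 df dg).
Qed.

Lemma is_derive_shift1 (x : R) (f : R -> R) (df e : R) :
  is_derive (x + e) 1 f df -> is_derive x 1 (fun t => f (t + e)) df.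
Proof.
move=> H; rewrite -[df]mulr1.
have := @is_derive1_comp _ f (fun t => t + e) x df 1 H; apply.
by apply: is_derive_eq; rewrite addr0.
Qed.

Definition glue (s1 : R) (f g : R -> R) s := if s <= s1 then f s else g s.

Lemma glue_is_derive s1 (f g f1 g1 : R -> R) (s : R) :
  f s1 = g s1 -> f1 s1 = g1 s1 ->
  (s <= s1 -> is_derive s 1 f (f1 s)) -> (s1 <= s -> is_derive s 1 g (g1 s)) ->
  is_derive s 1 (glue s1 f g) (glue s1 f1 g1 s).
Proof.
move=> fg fg1 df dg; rewrite /glue; case: ltgtP => [ss|ss|ss].
- apply: (near_eq_is_derive _ (df (ltW ss))); near=> t.
  by rewrite ifT//; apply: ltW; near: t; exact: lt_nbhsl.
- apply: (near_eq_is_derive _ (dg (ltW ss))); near=> t.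
  by rewrite leNgt ifF//; apply/negbTE; rewrite negbK; near: t; exact: lt_nbhsr.
- subst s; apply/is_derive_cvg; move/is_derive_cvg : (df (lexx _)) => {}df.
  move/is_derive_cvg : (dg (lexx _)); rewrite -fg1 -fg => {}dg.
  apply/cvgrPdist_lt => e e0.
  move/cvgrPdist_lt : df => /(_ e e0) df; move/cvgrPdist_lt : dg => /(_ e e0) dg.
  near=> h; rewrite lexx.
  case: ifPn => _; first by near: h; exact: df.
  by near: h; exact: dg.
Unshelve. all: by end_near. Qed.

Lemma glue_continuous s1 (f g : R -> R) (s : R) : f s1 = g s1 ->
  (s <= s1 -> {for s, continuous f}) -> (s1 <= s -> {for s, continuous g}) ->
  {for s, continuous (glue s1 f g)}.
Proof.
move=> fg cf cg.
apply/cvgrPdist_lt => e e0; have [ss|ss|ss] := ltgtP s s1.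
- have -> : glue s1 f g s = f s by rewrite /glue ltW.
  move/cvgrPdist_lt : (cf (ltW ss)) => /(_ e e0) {}cf; near=> t.
  rewrite /glue ifT; first by near: t; exact: cf.
  by apply: ltW; near: t; exact: lt_nbhsl.
- have -> : glue s1 f g s = g s by rewrite /glue leNgt ss.
  move/cvgrPdist_lt : (cg (ltW ss)) => /(_ e e0) {}cg; near=> t.
  rewrite /glue leNgt ifF; first by near: t; exact: cg.
  by apply/negbTE; rewrite negbK; near: t; exact: lt_nbhsr.
- subst s; have -> : glue s1 f g s1 = f s1 by rewrite /glue lexx.
  move/cvgrPdist_lt : (cf (lexx _)) => /(_ e e0) {}cf.
  move/cvgrPdist_lt : (cg (lexx _)) => /(_ e e0) {}cg.
  near=> t; rewrite /glue; case: ifPn => _; first by near: t; exact: cf.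
  by rewrite fg; near: t; exact: cg.
Unshelve. all: by end_near. Qed.

(** As a [glue], it inherits continuity, and its square differentiability, from the gluing
    lemmas. *)
Definition pos_part : R -> R := glue 0 (fun=> 0) id.

Lemma pos_partE (y : R) : pos_part y = Num.max 0 y.
Proof. by rewrite /pos_part /glue; case: leP => [/max_l|/ltW/max_r]. Qed.

Lemma pos_part_continuous : continuous pos_part.
Proof. by move=> y; apply: glue_continuous => // _; [exact: cst_continuous|exact: cvg_id]. Qed.

Lemma pos_part_sqr_derive (y : R) : is_derive y (1 : R) (fun t : R => pos_part t ^+ 2) (2 * pos_part y).
Proof.
have -> : (fun t => pos_part t ^+ 2) = glue 0 (fun=> 0) (fun t => t ^+ 2).
  by apply/funext => t; rewrite /pos_part /glue; case: ifP; rewrite ?expr0n.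
have -> : 2 * pos_part y = glue 0 (fun=> 0) (fun t => 2 * t) y.
  by rewrite /pos_part /glue; case: ifP; rewrite ?mulr0.
apply: glue_is_derive; rewrite ?expr0n ?mulr0// => _.
by apply: is_derive_eq; rewrite /GRing.scale/=; ring.
Qed.

Lemma continuous_sum {T : topologicalType} (I : Type) (r : seq I) (F : I -> T -> R) :
  (forall i, continuous (F i)) -> continuous (fun x => \sum_(i <- r) F i x).
Proof.
move=> cF; elim: r => [|i r IH].
  by under eq_fun do rewrite big_nil; exact: cst_continuous.
under eq_fun do rewrite big_cons.
by move=> x; apply: (@continuousD _ _ _ (F i) (fun x => \sum_(j <- r) F j x) x);
  [exact: cF|exact: IH].
Qed.

Lemma continuous_mul {T : topologicalType} (f g : T -> R) :
  continuous f -> continuous g -> continuous (fun x => f x * g x).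
Proof.
by move=> cf cg x; apply: (@continuousM _ _ f g x); [exact: cf|exact: cg].
Qed.

Lemma is_derive_along {V : normedModType R} (a y : V) (t : R) (f : V -> R) (df : R) :
  is_derive (a + t *: y) y f df -> is_derive t (1 : R) (fun t : R => f (a + t *: y)) df.
Proof.
move=> /is_derive_cvg H; apply/is_derive_cvg; apply: cvg_trans H.
rewrite (_ : (fun h : R => _) =
  (fun h : R => h^-1 *: (f (h *: y + (a + t *: y)) - f (a + t *: y))))//.
by apply/funext => h /=; rewrite scaler1 scalerDl addrCA.
Qed.

Context {d : nat}.
Local Notation V := 'rV[R]_d.
Implicit Types (x v : V).

Definition sqn x : R := \sum_i x ord0 i ^+ 2.

Lemma sqn_ge0 x : 0 <= sqn x.
Proof. by apply: sumr_ge0 => i _; exact: sqr_ge0. Qed.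

Lemma coord_rv_continuous (i : 'I_d) : continuous (fun x : V => x ord0 i).
Proof. by move=> x; exact: coord_continuous. Qed.

Lemma sqn_continuous : continuous sqn.
Proof.
by apply: continuous_sum => i; apply: continuous_mul; exact: coord_rv_continuous.
Qed.

Lemma coord_is_derive x v (i : 'I_d) : is_derive x v (fun y : V => y ord0 i) (v ord0 i).
Proof.
apply/is_derive_line.
have -> : (fun h : R => (h *: v + x) ord0 i) = (fun h => h * v ord0 i + x ord0 i).
  by apply/funext => h; rewrite !mxE.
by apply: is_derive_eq; rewrite /GRing.scale/=; ring.
Qed.

Lemma sqn_is_derive x v : is_derive x v sqn (2 * \sum_i x ord0 i * v ord0 i).
Proof.
rewrite /sqn.
have H (i : 'I_d) : is_derive x v (fun y : V => y ord0 i ^+ 2) (2 * x ord0 i * v ord0 i).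
  have := @is_deriveX _ _ (fun y : V => y ord0 i) 1 x v _ (coord_is_derive x v i).
  by move=> h; apply: is_derive_eq; rewrite /GRing.scale/=; ring.
have := @is_derive_sum _ _ _ d (fun i (y : V) => y ord0 i ^+ 2) x v _ H.
rewrite (_ : \sum_(i < d) (fun y : V => y ord0 i ^+ 2) = (fun y : V => \sum_i y ord0 i ^+ 2)).
  by move=> h; apply: is_derive_eq; rewrite mulr_sumr; apply: eq_bigr => i _; rewrite mulrA.
by apply/funext => y; rewrite fct_sumE.
Qed.

Lemma coord_delta (x : V) (j : 'I_d) : \sum_i x ord0 i * (delta_mx ord0 j : V) ord0 i = x ord0 j.
Proof.
rewrite (bigD1 j)//= mxE !eqxx mulr1 big1 ?addr0// => i /negbTE ij.
by rewrite mxE ij andbF mulr0.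
Qed.

End directional_derivatives.

(** * The profile and the signs of its derivatives *)

Section profile.
Context {R : realType}.

Lemma lin_ln_large (a g A : R) : 0 < a -> 0 <= g ->
  exists2 L0 : R, 1 <= L0 & forall L, L0 <= L -> A <= a * L - g * ln L.
Proof.
(* With [q = sqrt L] one has [ln L = 2 ln q <= 2q], so the right side is at least [q (a q - 2g)];
   [q0] is chosen so that [a q0 = 2g + |A| + a]. *)
move=> a0 g0; pose q0 := (2 * g + `|A|) / a + 1.
have q01 : 1 <= q0 by rewrite lerDr divr_ge0// ?(ltW a0)// addr_ge0// mulr_ge0.
exists (q0 ^+ 2); first by rewrite expr_ge1// (le_trans ler01).
move=> L qL; have L0 : 0 <= L by apply: le_trans qL; exact: sqr_ge0.
pose q := Num.sqrt L; have qE : L = q ^+ 2 by rewrite sqr_sqrtr.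
have q0q : q0 <= q.
  by rewrite -(@ler_pXn2r _ 2)// ?nnegrE ?sqrtr_ge0// ?(le_trans ler01)// -qE.
have q_gt0 : 0 < q by apply: lt_le_trans q0q; exact: lt_le_trans q01.
have h : 2 * g + `|A| + a <= a * q.
  have : a * q0 <= a * q by rewrite ler_wpM2l// ltW.
  by rewrite /q0 mulrDr mulr1 mulrC divfK// gt_eqF.
have lnq : ln q <= q by apply: ltW; exact: ln_sublinear.
have -> : ln L = 2 * ln q by rewrite qE lnXn// mulr_natl.
have Aq : `|A| <= q * `|A| by rewrite ler_peMl// (le_trans q01).
have := ler_norm A; have := normr_ge0 A; rewrite qE; nra.
Qed.

Variables (al ga : R).

(** The logarithm of [|phi|] at [s = |z|^2]; a single exponential replaces the product of two
    powers. *)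
Definition expo (s : R) := - al * ln s - ga * ln (- ln s).
Definition prof (s : R) := - expR (expo s).
Definition prof1 (s : R) := expR (expo s) * s^-1 * (al - ga * (- ln s)^-1).
Definition prof2 (s : R) := - (expR (expo s) * s^-1 ^+ 2 *
  ((al - ga * (- ln s)^-1) * (al - ga * (- ln s)^-1 + 1) + ga * (- ln s)^-1 ^+ 2)).

Lemma Nln_gt0 (s : R) : 0 < s < 1 -> 0 < - ln s.
Proof. by move=> s01; rewrite oppr_gt0 ln_lt0. Qed.

Lemma Nln_is_derive (s : R) : 0 < s < 1 -> is_derive s 1 (fun t => - ln t) (- s^-1).
Proof. by move=> /andP[s0 s1]; have := is_derive1_ln s0 => H; exact: is_deriveN. Qed.

Lemma expo_is_derive (s : R) : 0 < s < 1 ->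
  is_derive s 1 expo (- (s^-1 * (al - ga * (- ln s)^-1))).
Proof.
move=> s01; have L0 := Nln_gt0 s s01; have /andP[s0 s1] := s01.
have H1 := is_derive1_ln s0.
have H2 := @is_derive1_comp _ (@ln R) (fun t => - ln t) s _ _ (is_derive1_ln L0)
  (Nln_is_derive s s01).
have H3 := @is_deriveZ _ _ _ (fun t => ln t) (- al) s 1 _ H1.
have H4 := @is_deriveZ _ _ _ (fun t => ln (- ln t)) ga s 1 _ H2.
have H5 := is_deriveB H3 H4.
by apply: is_derive_eq H5 _; rewrite /GRing.scale/=; ring.
Qed.

Lemma prof_is_derive (s : R) : 0 < s < 1 -> is_derive s 1 prof (prof1 s).
Proof.
move=> s01.
have H := @is_derive1_comp _ expR expo s _ _ (is_derive_expR _) (expo_is_derive s s01).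
by apply: is_derive_eq (is_deriveN H) _; rewrite /prof1; ring.
Qed.

Lemma prof1_is_derive (s : R) : 0 < s < 1 -> is_derive s 1 prof1 (prof2 s).
Proof.
move=> s01; have L0 := Nln_gt0 s s01; have /andP[s0 s1] := s01.
have HE := @is_derive1_comp _ expR expo s _ _ (is_derive_expR _) (expo_is_derive s s01).
have HV : is_derive s 1 (fun t : R => t^-1) (- s^-1 ^+ 2).
  have := @is_deriveV R id s 1 1 (lt0r_neq0 s0) (is_derive_id _ _).
  by move=> H; apply: is_derive_eq H _; rewrite /GRing.scale/= mulr1 exprVn.
have HL : is_derive s 1 (fun t : R => (- ln t)^-1) ((- ln s)^-1 ^+ 2 * s^-1).
  have := @is_deriveV R (fun t => - ln t) s _ 1 (lt0r_neq0 L0) (Nln_is_derive s s01).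
  by move=> H; apply: is_derive_eq H _; rewrite /GRing.scale/= exprVn mulrNN.
have HB : is_derive s 1 (fun t : R => al - ga * (- ln t)^-1) (- (ga * ((- ln s)^-1 ^+ 2 * s^-1))).
  have H := is_deriveB (is_derive_cst al s 1) (@is_deriveZ _ _ _ _ ga s 1 _ HL).
  by apply: is_derive_eq H _; rewrite /GRing.scale/= sub0r.
have H := is_deriveM (is_deriveM HE HV) HB.
by apply: is_derive_eq H _; rewrite /prof2 /GRing.scale/=; rewrite -[((expR \o expo) * _) s]/(expR (expo s) * s^-1); ring.
Qed.

Lemma prof2_continuous (s : R) : 0 < s < 1 -> {for s, continuous prof2}.
Proof.
move=> s01; have L0 := Nln_gt0 s s01; have /andP[s0 s1] := s01.
have ce : {for s, continuous (fun t => expR (expo t))}.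
  apply: differentiable_continuous; apply/derivable1_diffP.
  by have [] := @is_derive1_comp _ expR expo s _ _ (is_derive_expR _) (expo_is_derive s s01).
have cV : {for s, continuous (fun t : R => t^-1)}.
  by apply: inv_continuous; exact: lt0r_neq0.
have cL : {for s, continuous (fun t : R => (- ln t)^-1)}.
  apply: continuousV; first exact: lt0r_neq0.
  by apply: continuousN; exact: continuous_ln.
have cB : {for s, continuous (fun t : R => al - ga * (- ln t)^-1)}.
  by apply: continuousB; [exact: cst_continuous|apply: continuousM => //; exact: cst_continuous].
apply: continuousN; apply: continuousM.
  by apply: continuousM => //; exact: (continuousM cV cV).
apply: continuousD.
  by apply: continuousM => //; apply: continuousD => //; exact: cst_continuous.
by apply: continuousM; [exact: cst_continuous|exact: (continuousM cL cL)].
Qed.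

Hypotheses (al0 : 0 < al) (ga0 : 0 < ga).

Lemma prof_large (A : R) : exists2 e : R, 0 < e < 1 & forall s, 0 < s <= e -> prof s < A.
Proof.
have [L0 L01 H] := lin_ln_large al ga (`|A|) al0 (ltW ga0).
exists (expR (- L0)); first by rewrite expR_gt0/= expR_lt1 oppr_lt0 (lt_le_trans _ L01).
move=> s /andP[s0 sL].
have h : L0 <= - ln s by rewrite lerNr -(expRK (- L0)) ler_ln// posrE expR_gt0.
have := H _ h; rewrite mulrN -mulNr => h2.
have := expR_ge1Dx (expo s); rewrite /prof /expo => h3.
have := ler_norm (- A); rewrite normrN => h4; lra.
Qed.

(** Divided by [E/s], the last expression is [t (n - m - m t) - m ga q^2] with [q = 1/L] and
    [t = al - ga q]. As [q] tends to 0 it tends to [al (n - m - m al)], positive by the bound on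
    [al]. *)
Lemma prof_signs (n m : R) : 0 < m -> al < (n - m) / m ->
  exists2 s0 : R, 0 < s0 < 1 & forall s, 0 < s <= s0 ->
    [/\ 0 <= prof1 s, prof2 s <= 0 & 0 <= n * prof1 s + m * (s * prof2 s)].
Proof.
move=> m0; rewrite ltr_pdivlMr// => dl0.
pose dl := n - m - m * al; have {}dl0 : 0 < dl by rewrite /dl; lra.
(* The three terms ensure [q <= 1], [2 ga q <= al] (so [t >= al/2]) and [2 m ga q <= al dl], by
   which [al dl / 2] absorbs the error [m ga q^2]. *)
pose L0 := 1 + 2 * ga / al + 2 * m * ga / (al * dl).
have p1 : 0 < 2 * ga / al by rewrite divr_gt0// mulr_gt0.
have p2 : 0 < 2 * m * ga / (al * dl) by rewrite divr_gt0 ?mulr_gt0.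
exists (expR (- L0)).
  by rewrite expR_gt0/= expR_lt1 oppr_lt0 /L0; lra.
move=> s /andP[s0 sL].
have hL : L0 <= - ln s by rewrite lerNr -(expRK (- L0)) ler_ln// posrE expR_gt0.
have Lgt0 : 0 < - ln s by apply: lt_le_trans hL; rewrite /L0; lra.
rewrite /prof1 /prof2.
set q := (- ln s)^-1; have q0 : 0 < q by rewrite invr_gt0.
have qL c : c <= L0 -> q * c <= 1.
  move=> cL; rewrite /q mulrC ler_pdivrMr// mul1r; exact: le_trans hL.
have q1 : q <= 1 by have := qL 1; rewrite mulr1; apply; rewrite /L0; lra.
have q2 : 2 * ga * q <= al.
  have : q * (2 * ga / al) <= 1 by apply: qL; rewrite /L0; lra.
  by rewrite mulrA ler_pdivrMr// mul1r mulrC.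
have q3 : 2 * m * ga * q <= al * dl.
  have : q * (2 * m * ga / (al * dl)) <= 1 by apply: qL; rewrite /L0; lra.
  by rewrite mulrA ler_pdivrMr ?mulr_gt0// mul1r mulrC.
set E := expR _; have E0 : 0 < E by exact: expR_gt0.
have sV : 0 < s^-1 by rewrite invr_gt0.
set t := al - ga * q.
have t0 : al / 2 <= t by rewrite /t; lra.
have t1 : t <= al by rewrite /t; have := mulr_gt0 ga0 q0; lra.
have gq := mulr_gt0 ga0 q0.
have gq2 : ga * q ^+ 2 <= ga * q.
  by rewrite ler_wpM2l ?(ltW ga0)// expr2 ler_piMl// ltW.
have gq20 : 0 <= ga * q ^+ 2 by rewrite mulr_ge0 ?sqr_ge0 ?ltW.
split.
- by rewrite mulr_ge0// ?mulr_ge0 ?ltW//; lra.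
- by rewrite oppr_le0 mulr_ge0// ?mulr_ge0 ?sqr_ge0 ?ltW//; nra.
have -> : n * (E * s^-1 * t) + m * (s * - (E * s^-1 ^+ 2 * (t * (t + 1) + ga * q ^+ 2))) =
   E * s^-1 * (n * t - m * (t * (t + 1) + ga * q ^+ 2)).
  by field; exact: lt0r_neq0.
apply: mulr_ge0; first by rewrite mulr_ge0// ltW.
have : t * dl <= t * (n - m - m * t).
  by rewrite ler_wpM2l//; [lra|rewrite /dl; nra].
have : al / 2 * dl <= t * dl by rewrite ler_wpM2r// ltW.
have : m * (ga * q ^+ 2) <= m * (ga * q) by rewrite ler_wpM2l// ltW.
nra.
Qed.

End profile.

Section radial.
Context {R : realType} {d : nat}.
Local Notation V := 'rV[R]_d.
Variables (H H1 H2 : R -> R).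
Hypothesis dH : forall s : R, 0 <= s -> is_derive s (1 : R) H (H1 s).
Hypothesis dH1 : forall s : R, 0 <= s -> is_derive s (1 : R) H1 (H2 s).
Hypothesis cH2 : forall s : R, 0 <= s -> {for s, continuous H2}.

Definition radial (x : V) := H (sqn x).
Definition radial1 (i : 'I_d) (x : V) := 2 * x ord0 i * H1 (sqn x).
Definition radial2 (i j : 'I_d) (x : V) :=
  2 * (i == j)%:R * H1 (sqn x) + 4 * x ord0 i * x ord0 j * H2 (sqn x).

Lemma radial_derive x v : is_derive x v radial (\sum_i v ord0 i * radial1 i x).
Proof.
have := is_derive_chain x v sqn H _ _ (sqn_is_derive x v) (dH _ (sqn_ge0 x)).
move=> h; apply: is_derive_eq h _.
by rewrite !mulr_sumr; apply: eq_bigr => i _; rewrite /radial1; ring.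
Qed.

Lemma sum_delta (F : 'I_d -> R) (j : 'I_d) :
  \sum_i (delta_mx ord0 j : V) ord0 i * F i = F j.
Proof.
rewrite (bigD1 j)//= mxE !eqxx mul1r big1 ?addr0// => i /negbTE ij.
by rewrite mxE ij andbF mul0r.
Qed.

Lemma radial1_derive i j x :
  is_derive x (delta_mx ord0 j : V) (radial1 i) (radial2 i j x).
Proof.
have h1 := is_derive_chain x (delta_mx ord0 j) sqn H1 _ _ (sqn_is_derive x _)
  (dH1 _ (sqn_ge0 x)).
have h2 := @is_deriveZ _ _ _ (fun y : V => y ord0 i) 2 x _ _ (coord_is_derive x (delta_mx ord0 j) i).
have h := is_deriveM h2 h1.
apply: is_derive_eq h _; rewrite coord_delta /radial2 mxE eqxx /= /GRing.scale/=.
ring.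
Qed.

Let comp_cont (G : R -> R) : (forall s : R, 0 <= s -> {for s, continuous G}) ->
  continuous (fun x : V => G (sqn x)).
Proof.
move=> cG x; apply: (@continuous_comp _ _ _ sqn G); first exact: sqn_continuous.
by apply: cG; exact: sqn_ge0.
Qed.

Let derive_cont (G G1 : R -> R) (s : R) : is_derive s (1 : R) G (G1 s) -> {for s, continuous G}.
Proof.
by move=> h; apply: differentiable_continuous; apply/derivable1_diffP; case: h.
Qed.

Lemma radial_continuous : continuous radial.
Proof. by apply: comp_cont => s s0; apply: (derive_cont H H1); exact: dH. Qed.

Lemma radial1_continuous i : continuous (radial1 i).
Proof.
apply: continuous_mul.
  by apply: continuous_mul; [exact: cst_continuous|exact: coord_rv_continuous].
by apply: comp_cont => s s0; apply: (derive_cont H1 H2); exact: dH1.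
Qed.

Lemma radial2_continuous i j : continuous (radial2 i j).
Proof.
move=> x; apply: (@continuousD _ _ _ (fun x : V => 2 * (i == j)%:R * H1 (sqn x))
  (fun x : V => 4 * x ord0 i * x ord0 j * H2 (sqn x))).
  apply: continuous_mul; first exact: cst_continuous.
  by apply: comp_cont => s s0; apply: (derive_cont H1 H2); exact: dH1.
apply: continuous_mul; last exact: comp_cont.
apply: continuous_mul; last exact: coord_rv_continuous.
by apply: continuous_mul; [exact: cst_continuous|exact: coord_rv_continuous].
Qed.

End radial.

Section regularised_profile.
Context {R : realType}.
Variables (al ga s1 e : R).
Hypotheses (s10 : 0 < s1) (e0 : 0 < e) (s1e : s1 + e < 1).

Let se01 (s : R) : 0 <= s -> s <= s1 -> 0 < s + e < 1.
Proof.
move=> s0 ss1; rewrite ltr_wpDl//=; apply: le_lt_trans s1e; exact: lerD.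
Qed.

(* The profile shifted by [e] on [[0, s1]], continued by its second Taylor
   polynomial so as to be C^2 on the half-line. *)
Let c := s1 + e.
Definition reg := glue s1 (fun s => prof al ga (s + e))
  (fun s => prof al ga c + prof1 al ga c * (s - s1) + prof2 al ga c / 2 * (s - s1) ^+ 2).
Definition reg1 := glue s1 (fun s => prof1 al ga (s + e))
  (fun s => prof1 al ga c + prof2 al ga c * (s - s1)).
Definition reg2 := glue s1 (fun s => prof2 al ga (s + e)) (fun=> prof2 al ga c).

Lemma reg_derive (s : R) : 0 <= s -> is_derive s (1 : R) reg (reg1 s).
Proof.
move=> s0; apply: glue_is_derive.
- by rewrite subrr mulr0 addr0 expr0n mulr0 addr0.
- by rewrite subrr mulr0 addr0.
- move=> ss1; apply: is_derive_shift1; apply: prof_is_derive; exact: se01.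
- by move=> _; apply: is_derive_eq; rewrite /GRing.scale/=; field.
Qed.

Lemma reg1_derive (s : R) : 0 <= s -> is_derive s (1 : R) reg1 (reg2 s).
Proof.
move=> s0; apply: glue_is_derive.
- by rewrite subrr mulr0 addr0.
- by [].
- move=> ss1; apply: is_derive_shift1; apply: prof1_is_derive; exact: se01.
- by move=> _; apply: is_derive_eq; rewrite /GRing.scale/=; field.
Qed.

Lemma reg2_continuous (s : R) : 0 <= s -> {for s, continuous reg2}.
Proof.
move=> s0; apply: glue_continuous => //; last by move=> _; exact: cst_continuous.
move=> ss1; apply: (@continuous_comp _ _ _ (fun t => t + e) (prof2 al ga)).
  by apply: continuousD => //; exact: cst_continuous.
by apply: prof2_continuous; exact: se01.
Qed.

Lemma regE s : s <= s1 -> reg s = prof al ga (s + e).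
Proof. by rewrite /reg /glue => ->. Qed.
Lemma reg1E s : s <= s1 -> reg1 s = prof1 al ga (s + e).
Proof. by rewrite /reg1 /glue => ->. Qed.
Lemma reg2E s : s <= s1 -> reg2 s = prof2 al ga (s + e).
Proof. by rewrite /reg2 /glue => ->. Qed.

End regularised_profile.

(** * The mean value inequality *)

Section mean_value.
Context {R : realType} {d : nat}.
Local Notation V := 'rV[R]_d.
Local Notation RM := (measurableTypeR R).
Local Notation mu := (@lebesgue R d).
Local Notation e_ i := (delta_mx ord0 i : V).

Lemma continuous_box_bounded (f : V -> R) (b : R) : continuous f ->
  exists2 M : R, 0 <= M & forall x : V, (forall i, `|x ord0 i| <= b) -> `|f x| <= M.
Proof.
move=> cf.
have /compact_bounded[M [_ HM]] : compact (f @` [set x : V | forall i, `|x ord0 i| <= b]).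
  by apply: continuous_compact; [exact: continuous_subspaceT|exact: compact_box].
exists (`|M| + 1); first by rewrite addr_ge0.
move=> x xb; apply: (HM (`|M| + 1)); first by rewrite (le_lt_trans (ler_norm _))// ltrDl.
by exists x.
Qed.

Variables (v : V -> R) (v1 v2 : 'I_d -> V -> R).
Hypothesis dv : forall x w : V, is_derive x w v (\sum_i w ord0 i * v1 i x).
Hypothesis dv1 : forall i (x : V), is_derive x (e_ i) (v1 i) (v2 i x).
Hypothesis cv : continuous v.
Hypothesis cv1 : forall i, continuous (v1 i).
Hypothesis cv2 : forall i, continuous (v2 i).
Variable a : V.

Let pt (t : R) (x : V) : V := a + t *: (x - a).
Definition bump (c : R) (x : V) : R := pos_part (c - sqn (x - a)).
Let Phi (c t : R) := Int (fun x => bump c x * v (pt t x)).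

Let cont_sub : continuous (fun x : V => x - a).
Proof.
by move=> x; apply: (@continuousB _ _ _ (fun x : V => x) (fun=> a) x);
  [exact: cvg_id|exact: cst_continuous].
Qed.

Let cont_comp_sub (f : V -> R) : continuous f -> continuous (fun x : V => f (x - a)).
Proof.
move=> cf; suff H : continuous (f \o (fun x : V => x - a)) by exact: H.
by move=> x; apply: continuous_comp; [exact: cont_sub|exact: cf].
Qed.

Let cont_pt t : continuous (pt t).
Proof.
move=> x; apply: (@continuousD _ _ _ (fun=> a) (fun x : V => t *: (x - a)) x).
  exact: cst_continuous.
apply: (@continuous_comp _ _ _ (fun x : V => x - a) (fun x : V => t *: x)).
  exact: cont_sub.
exact: scaler_continuous.
Qed.

Let cont_comp_pt t (f : V -> R) : continuous f -> continuous (fun x => f (pt t x)).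
Proof.
by move=> cf x; apply: (@continuous_comp _ _ _ (pt t) f); [exact: cont_pt|exact: cf].
Qed.

Lemma bump_ge0 c x : 0 <= bump c x.
Proof. by rewrite /bump pos_partE le_max lexx. Qed.

Lemma bump_supp c x : bump c x != 0 -> sqn (x - a) < c.
Proof.
rewrite /bump /pos_part /glue; case: ifPn => [_|]; first by rewrite eqxx.
by rewrite -ltNge subr_gt0.
Qed.

Lemma sqn_coord (x : V) (c : R) i : sqn x <= c -> `|x ord0 i| <= `|c| + 1.
Proof.
move=> xc; have h : x ord0 i ^+ 2 <= c.
  by apply: le_trans xc; rewrite /sqn (bigD1 i)//= lerDl sumr_ge0// => j _; exact: sqr_ge0.
have := ler_norm c; have := normr_ge0 (x ord0 i); rewrite -(real_normK (num_real _)) in h.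
nra.
Qed.

(** Half-side of a box holding [a + t (x - a)] for [|x - a|^2 <= c] and [-1 < t < 2], an open
    interval around [[0, 1]]. *)
Let brad (c : R) : R := \sum_i `|a ord0 i| + 2 * (`|c| + 1).

Let pt_box (c t : R) x : -1 < t < 2 -> sqn (x - a) <= c -> forall i, `|pt t x ord0 i| <= brad c.
Proof.
move=> /andP[t1 t2] xc i; have := sqn_coord _ _ i xc; rewrite !mxE => h.
apply: le_trans (ler_normD _ _) _; apply: lerD.
  by rewrite (bigD1 i)//= lerDl sumr_ge0.
by rewrite normrM; apply: ler_pM => //; rewrite ler_norml; apply/andP; split; lra.
Qed.

Lemma bump_continuous c : continuous (bump c).
Proof.
suff H : continuous (pos_part \o (fun x : V => c - sqn (x - a))) by exact: H.
move=> x; apply: continuous_comp; last exact: pos_part_continuous.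
apply: continuousB; first exact: cst_continuous.
exact: (cont_comp_sub sqn sqn_continuous x).
Qed.

Lemma bump_supp_in c : supp_in (brad c) (bump c).
Proof.
move=> x /bump_supp/ltW xc i.
have := @pt_box c 1 x _ xc i; rewrite /pt scale1r addrC subrK; apply.
by apply/andP; split; lra.
Qed.

Lemma bump_cont_supp c : cont_supp (bump c).
Proof. by split; [exact: bump_continuous|exists (brad c); exact: bump_supp_in]. Qed.

Lemma bump_sqr_derive c x i : is_derive x (e_ i) (fun y => bump c y ^+ 2)
  (- 4 * (x - a) ord0 i * bump c x).
Proof.
have hs : is_derive x (e_ i) (fun y => c - sqn (y - a)) (- (2 * (x - a) ord0 i)).
  have h : is_derive x (e_ i) (fun y : V => sqn (y - a)) (2 * (x - a) ord0 i).
    have := sqn_is_derive (x - a) (e_ i); rewrite coord_delta => /is_derive_line H.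
    apply/is_derive_line; rewrite (_ : (fun h : R => _) =
      (fun h : R => sqn (h *: e_ i + (x - a))))//.
    by apply/funext => h; rewrite addrA.
  have := is_deriveB (is_derive_cst c x (e_ i)) h.
  by move=> H; apply: is_derive_eq H _; rewrite sub0r.
have := is_derive_chain x (e_ i) (fun y => c - sqn (y - a)) _ _ _ hs
  (pos_part_sqr_derive (c - sqn (x - a))).
by move=> H; apply: is_derive_eq H _; rewrite /bump; ring.
Qed.

Let dPhi (c t : R) : -1 < t < 2 -> is_derive t (1 : R) (Phi c)
  (Int (fun x => bump c x * \sum_i (x - a) ord0 i * v1 i (pt t x))).
Proof.
move=> t12.
have [Mk Mk0 HMk] := cont_supp_bounded _ (bump_cont_supp c).
have [M HM] : exists M : 'I_d -> R, forall i, 0 <= M i /\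
    forall x : V, (forall j, `|x ord0 j| <= brad c) -> `|v1 i x| <= M i.
  have H (i : 'I_d) : exists M : R, 0 <= M /\
      forall x : V, (forall j, `|x ord0 j| <= brad c) -> `|v1 i x| <= M.
    by have [M M0 HM] := continuous_box_bounded (v1 i) (brad c) (cv1 i); exists M.
  by have [M HM] := choice H; exists M.
apply: (@Int_derive _ _ (fun t x => bump c x * v (pt t x))
  (fun t x => bump c x * \sum_i (x - a) ord0 i * v1 i (pt t x)) (-1) 2 t
  (Mk * \sum_i (`|c| + 1) * M i) (brad c)) => //.
- move=> u _; apply: cont_suppMr; first exact: bump_cont_supp.
  exact: cont_comp_pt.
- move=> u x _.
  have h := is_derive_along a (x - a) u v _ (dv (a + u *: (x - a)) (x - a)).
  have := @is_deriveZ _ _ _ (fun t : R => v (a + t *: (x - a))) (bump c x) u 1 _ h.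
  by move=> H; exact: H.
- move=> u x u12.
  have [->|bx] := eqVneq (bump c x) 0.
    rewrite mul0r normr0 mulr_ge0// sumr_ge0// => i _.
    by rewrite mulr_ge0 ?addr_ge0//; have [] := HM i.
  have xc := ltW (bump_supp _ _ bx).
  rewrite normrM; apply: ler_pM => //.
  apply: le_trans (ler_norm_sum _ _ _) _; apply: ler_sum => i _.
  rewrite normrM; apply: ler_pM => //; first exact: sqn_coord.
  by have [_] := HM i; apply; exact: pt_box.
- by move=> u _ x; rewrite mulf_eq0 negb_or => /andP[/bump_supp_in].
Qed.

(** The gradient of [bump^2] is [-4 (x - a) bump], so the radial factor is a derivative; moving it
    onto [v1 i (pt t x)] produces [t] by the chain rule. *)
Let by_parts (c t : R) i : Int (fun x => bump c x * ((x - a) ord0 i * v1 i (pt t x))) =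
  t / 4 * Int (fun x => bump c x ^+ 2 * v2 i (pt t x)).
Proof.
have cb2 : cont_supp (fun x => bump c x ^+ 2).
  by apply: cont_suppMl; [exact: bump_continuous|exact: bump_cont_supp].
have cd : continuous (fun x : V => - 4 * (x - a) ord0 i).
  apply: continuous_mul; first exact: cst_continuous.
  exact: (cont_comp_sub (fun x => x ord0 i) (coord_rv_continuous i)).
have H := @Int_by_parts _ _ (e_ i) (fun x => v1 i (pt t x)) (fun x => t * v2 i (pt t x))
  (fun x => bump c x ^+ 2) (fun x => - 4 * (x - a) ord0 i * bump c x).
have {H} : Int (fun x => v1 i (pt t x) * (- 4 * (x - a) ord0 i * bump c x)) =
  - Int (fun x => t * v2 i (pt t x) * bump c x ^+ 2).
  apply: H.
  - exact: cont_comp_pt.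
  - by apply: continuous_mul; [exact: cst_continuous|exact: cont_comp_pt].
  - exact: cb2.
  - by apply: cont_suppMl => //; exact: bump_cont_supp.
  - move=> x; have := dv1 i (pt t x) => /is_derive_line h.
    have h2 : is_derive (0 * t : R) (1 : R) (fun h : R => v1 i (h *: e_ i + pt t x)) (v2 i (pt t x)).
      by rewrite mul0r.
    have hm : is_derive (0 : R) (1 : R) (fun h : R => h * t) t.
      by apply: is_derive_eq; rewrite /GRing.scale/=; ring.
    have := @is_derive1_comp _ (fun h : R => v1 i (h *: e_ i + pt t x))
      (fun h : R => h * t) 0 _ _ h2 hm.
    move=> H; apply/is_derive_line; rewrite mulrC.
    rewrite (_ : (fun h : R => _) =
      (fun h : R => v1 i (h *: e_ i + pt t x)) \o (fun h : R => h * t))//.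
    apply/funext => u /=; congr (v1 i _); rewrite /pt -addrA scalerDr scalerA.
    by rewrite addrCA [t * u]mulrC.
  - by move=> x; exact: bump_sqr_derive.
have -> : (fun x => v1 i (pt t x) * (- 4 * (x - a) ord0 i * bump c x)) =
  (fun x => - 4 * (bump c x * ((x - a) ord0 i * v1 i (pt t x)))).
  by apply/funext => x; ring.
have -> : (fun x => t * v2 i (pt t x) * bump c x ^+ 2) =
  (fun x => t * (bump c x ^+ 2 * v2 i (pt t x))).
  by apply/funext => x; ring.
have c1 : cont_supp (fun x => bump c x * ((x - a) ord0 i * v1 i (pt t x))).
  apply: (cont_suppMr (bump c) (fun x => (x - a) ord0 i * v1 i (pt t x)) (bump_cont_supp c)).
  apply: continuous_mul; last exact: cont_comp_pt.
  exact: (cont_comp_sub (fun x => x ord0 i) (coord_rv_continuous i)).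
have c2 : cont_supp (fun x => bump c x ^+ 2 * v2 i (pt t x)).
  by apply: cont_suppMr => //; exact: cont_comp_pt.
rewrite (IntZ (- 4) _ c1) (IntZ t _ c2).
by set A := Int _; set B := Int _; move=> H; lra.
Qed.

Let dPhiE (c t : R) : Int (fun x => bump c x * \sum_i (x - a) ord0 i * v1 i (pt t x)) =
  t / 4 * Int (fun x => bump c x ^+ 2 * \sum_i v2 i (pt t x)).
Proof.
have cb2 : cont_supp (fun x => bump c x ^+ 2).
  by apply: cont_suppMl; [exact: bump_continuous|exact: bump_cont_supp].
under eq_fun do rewrite mulr_sumr.
rewrite Int_sum; last first.
  move=> i.
  apply: (cont_suppMr (bump c) (fun x => (x - a) ord0 i * v1 i (pt t x)) (bump_cont_supp c)).
  apply: continuous_mul; last exact: cont_comp_pt.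
  exact: (cont_comp_sub (fun x => x ord0 i) (coord_rv_continuous i)).
under [in RHS]eq_fun do rewrite mulr_sumr.
rewrite Int_sum; last by move=> i; apply: cont_suppMr => //; exact: cont_comp_pt.
by rewrite mulr_sumr; apply: eq_bigr => i _; exact: by_parts.
Qed.

Variables (c1 c2 : R).
Hypothesis c21 : c2 <= c1.
Hypothesis pos : forall (t : R) (y : V), 0 < t < 1 -> sqn y <= c1 -> 0 <= \sum_i v2 i (a + t *: y).

Lemma bump_le x : bump c2 x <= bump c1 x.
Proof.
rewrite /bump !pos_partE ge_max le_max lexx /= le_max; apply/orP; right.
by rewrite lerD2r.
Qed.

(** The integral of [(bump c1 - bump c2) v(a + t (x - a))] has derivative [t/4] times that of
    [(bump c1^2 - bump c2^2)] against the Laplacian, so its value at [t = 1] is at least its value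
    at [t = 0]. *)
Lemma mean_value_weight : 0 <= Int (fun x => (bump c1 x - bump c2 x) * (v x - v a)).
Proof.
pose W t := Phi c1 t - Phi c2 t.
have dW (t : R) : -1 < t < 2 -> is_derive t (1 : R) W
   (t / 4 * Int (fun x => (bump c1 x ^+ 2 - bump c2 x ^+ 2) * \sum_i v2 i (pt t x))).
  move=> t12; have := is_deriveB (dPhi c1 t t12) (dPhi c2 t t12).
  move=> H; apply: is_derive_eq H _; rewrite !dPhiE -mulrBr; congr (_ * _).
  have cs c : cont_supp (fun x => bump c x ^+ 2 * \sum_i v2 i (pt t x)).
    apply: cont_suppMr; first by apply: cont_suppMl; [exact: bump_continuous|exact: bump_cont_supp].
    by apply: continuous_sum => i; exact: cont_comp_pt.
  rewrite -[in LHS]mulN1r -(IntZ (-1) _ (cs c2)) -IntD//; last exact: cont_suppZ.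
  by congr Int; apply/funext => x; rewrite mulN1r -mulrBl.
have t12 (t : R) : 0 <= t -> t <= 1 -> -1 < t < 2.
  by move=> t0 t1; apply/andP; split; lra.
have W01 : W 0 <= W 1.
  apply: (@ger0_derive1_ndecr R W 0 1) => //.
  - move=> t; rewrite in_itv/= => /andP[t0 t1].
    by have [] := dW t (t12 t (ltW t0) (ltW t1)).
  - move=> t; rewrite in_itv/= => /andP[t0 t1].
    have [_] := dW t (t12 t (ltW t0) (ltW t1)).
    rewrite derive1E => ->; rewrite mulr_ge0 ?divr_ge0 ?(ltW t0)//.
    apply: Int_ge0 => x; have [b0|bx] := eqVneq (bump c1 x) 0.
      have -> : bump c2 x = 0.
        by apply/eqP; rewrite eq_le bump_ge0 andbT -b0 bump_le.
      by rewrite b0 subrr mul0r.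
    apply: mulr_ge0.
      rewrite subr_ge0 ler_pXn2r ?nnegrE ?bump_ge0//; exact: bump_le.
    by apply: pos; [rewrite t0 t1|exact: ltW (bump_supp _ _ bx)].
  - apply: derivable_within_continuous => t; rewrite in_itv/= => /andP[t0 t1].
    by have [] := dW t (t12 t t0 t1).
have cs c (f : V -> R) : continuous f -> cont_supp (fun x => bump c x * f x).
  by move=> cf; apply: cont_suppMr => //; exact: bump_cont_supp.
have E t : W t = Int (fun x => (bump c1 x - bump c2 x) * v (pt t x)).
  have csv c : cont_supp (fun x => bump c x * v (pt t x)).
    by apply: cs; exact: cont_comp_pt.
  rewrite /W /Phi -[X in _ + X]mulN1r -(IntZ (-1) _ (csv c2)) -IntD//; last exact: cont_suppZ.
  by congr Int; apply/funext => x; rewrite mulN1r -mulrBl.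
have csb (f : V -> R) : continuous f -> cont_supp (fun x => (bump c1 x - bump c2 x) * f x).
  move=> cf; under eq_fun do rewrite mulrBl -mulN1r.
  by apply: cont_suppD; [exact: cs|apply: cont_suppZ; exact: cs].
have := W01; rewrite !E -subr_ge0 => W01'.
have -> : (fun x => (bump c1 x - bump c2 x) * (v x - v a)) =
  (fun x => (bump c1 x - bump c2 x) * v (pt 1 x) +
      -1 * ((bump c1 x - bump c2 x) * v (pt 0 x))).
  apply/funext => x; rewrite /pt scale1r scale0r addr0 [a + (x - a)]addrC subrK; ring.
rewrite IntD ?IntZ ?mulN1r//; first by apply: csb; exact: cont_comp_pt.
- by apply: csb; exact: cont_comp_pt.
- by apply: cont_suppZ; apply: csb; exact: cont_comp_pt.
Qed.

End mean_value.

Section dominated.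
Local Open Scope ereal_scope.

Lemma dominated_ge0 d (T : measurableType d) (R : realType) (mu : {measure set T -> \bar R})
    (D : set T) (f_ : (T -> \bar R)^nat) (f g : T -> \bar R) :
  measurable D -> (forall n, measurable_fun D (f_ n)) -> measurable_fun D f ->
  {ae mu, forall x, D x -> f_ ^~ x @ \oo --> f x} ->
  mu.-integrable D g -> {ae mu, forall x n, D x -> `|f_ n x| <= g x} ->
  (forall n, 0 <= \int[mu]_(x in D) f_ n x) -> 0 <= \int[mu]_(x in D) f x.
Proof.
move=> mD mf_ mf cf ig fg If.
have [_ _ H] := @dominated_convergence d T R mu D mD f_ f g mf_ mf cf ig fg.
rewrite -(cvg_lim _ H)//; apply: lime_ge; first by apply/cvg_ex; eexists; exact: H.
by apply: nearW => n; exact: If.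
Qed.

End dominated.

Section mean_value_ball.
Context {R : realType} {d : nat}.
Local Notation V := 'rV[R]_d.
Local Notation RM := (measurableTypeR R).
Local Notation mu := (@lebesgue R d).
Local Notation e_ i := (delta_mx ord0 i : V).

Definition eball (a : V) (c : R) : set V := [set x | sqn (x - a) <= c].

Lemma sqn_sub_continuous (a : V) : continuous (fun x : V => sqn (x - a)).
Proof.
suff H : continuous (sqn \o (fun x : V => x - a)) by exact: H.
move=> x; apply: continuous_comp; last exact: sqn_continuous.
by apply: (@continuousB _ _ _ (fun x : V => x) (fun=> a) x);
  [exact: cvg_id|exact: cst_continuous].
Qed.

Lemma eball_closed a c : closed (eball a c).
Proof.
have -> : eball a c = (fun x : V => sqn (x - a)) @^-1` [set t | t <= c] by [].
by apply: preimage_closed; [move=> x _; exact: sqn_sub_continuous|exact: closed_le].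
Qed.

Lemma measurable_eball a c : measurable (@rv_of R d @^-1` eball a c).
Proof. exact: closed_measurable_rv (eball_closed a c). Qed.

Variables (v : V -> R) (v1 v2 : 'I_d -> V -> R).
Hypothesis dv : forall x w : V, is_derive x w v (\sum_i w ord0 i * v1 i x).
Hypothesis dv1 : forall i (x : V), is_derive x (e_ i) (v1 i) (v2 i x).
Hypothesis cv : continuous v.
Hypothesis cv1 : forall i, continuous (v1 i).
Hypothesis cv2 : forall i, continuous (v2 i).
Variables (a : V) (c : R).

(** The slack [dl] gives room for weights supported slightly outside the ball. *)
Lemma mean_value_ball (dl : R) : 0 < dl ->
  (forall (t : R) (y : V), 0 < t < 1 -> sqn y <= c + dl -> 0 <= \sum_i v2 i (a + t *: y)) ->
  (0 <= \int[mu]_(t in @rv_of R d @^-1` eball a c) (v (rv_of t) - v a)%:E)%E.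
Proof.
move=> dl0 pos; have mB := measurable_eball a c.
pose dn (n : nat) : R := dl / n.+1%:R.
have dn0 n : 0 < dn n by rewrite divr_gt0// ltr0n.
have dndl n : dn n <= dl by rewrite ler_pdivrMr ?ltr0n// ler_peMr ?ler1n// ltW.
(* This weight is 1 on the ball, 0 where [|x - a|^2 >= c + dn n], and affine in [|x - a|^2] in
   between. *)
pose w n (x : V) := (bump a (c + dn n) x - bump a c x) / dn n.
have bump_cc n x : bump a c x <= bump a (c + dn n) x.
  by apply: bump_le; rewrite lerDl ltW.
have w_in n x : sqn (x - a) <= c -> w n x = 1.
  move=> xc; rewrite /w /bump !pos_partE !max_r ?subr_ge0//; last first.
    by rewrite (le_trans xc)// lerDl ltW.
  rewrite (_ : _ - _ - _ = dn n); last by ring.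
  by rewrite divff// gt_eqF.
have w_out n x : c + dn n <= sqn (x - a) -> w n x = 0.
  move=> xc; rewrite /w /bump !pos_partE !max_l ?subr_le0//; first by rewrite subrr mul0r.
  by rewrite (le_trans _ xc)// lerDl ltW.
have w01 n x : 0 <= w n x <= 1.
  apply/andP; split; first by rewrite divr_ge0 ?subr_ge0 ?(ltW (dn0 n)).
  rewrite ler_pdivrMr// mul1r /bump !pos_partE.
  by case: (leP 0 (c + dn n - _)) => h1; case: (leP 0 (c - _)) => h2; have := dn0 n; lra.
have w_supp n : supp_in (\sum_i `|a ord0 i| + 2 * (`|c + dl| + 1)) (w n).
  move=> x wx i; have xc : sqn (x - a) <= c + dl.
    apply: le_trans (_ : c + dn n <= _); last by rewrite lerD2l.
    by rewrite leNgt; apply/negP => /ltW/(w_out n) h; rewrite h eqxx in wx.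
  have h := sqn_coord _ _ i xc; rewrite !mxE in h.
  rewrite -[x ord0 i](subrK (a ord0 i)) addrC.
  apply: le_trans (ler_normD _ _) _; apply: lerD.
    by rewrite (bigD1 i)//= lerDl sumr_ge0.
  by apply: le_trans h _; have := normr_ge0 (c + dl); lra.
set b := \sum_i _ + _ in w_supp.
have w_cs n : cont_supp (w n).
  split; last by exists b; exact: w_supp.
  apply: continuous_mul; last exact: cst_continuous.
  move=> x; apply: (@continuousB _ _ _ (bump a (c + dn n)) (bump a c) x);
    exact: bump_continuous.
have cvv : continuous (fun x => v x - v a).
  by move=> x; apply: (@continuousB _ _ _ v (fun=> v a) x); [exact: cv|exact: cst_continuous].
have [M M0 HM] := continuous_box_bounded (fun x => v x - v a) b cvv.
rewrite integral_mkcond.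
apply: (@dominated_ge0 _ _ _ mu setT (fun n t => (w n (rv_of t) * (v (rv_of t) - v a))%:E)
   _ (fun t => (M * \1_(cbox d b) t)%:E)) => //.
- move=> n; apply/measurable_EFinP.
  apply: (@continuous_measurable_rv _ _ (fun x => w n x * (v x - v a))).
  by apply: continuous_mul => //; case: (w_cs n).
- apply/(measurable_restrictT _ mB); apply: measurable_funTS; apply/measurable_EFinP.
  exact: (@continuous_measurable_rv _ _ (fun x => v x - v a)).
- apply: aeW => t _; rewrite /patch; case: ifPn => [|/negP tB].
    rewrite inE => tB; rewrite (_ : (fun n => _) = cst (v (rv_of t) - v a)%:E).
      exact: cvg_cst.
    by apply/funext => n; rewrite w_in// mul1r.
  have tc : c < sqn (rv_of t - a).
    by rewrite ltNge; apply/negP => h; apply: tB; rewrite inE.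
  apply: cvg_near_cst.
  have e0 : 0 < (sqn (rv_of t - a) - c) / dl by rewrite divr_gt0// subr_gt0.
  near=> n; rewrite w_out ?mul0r//.
  rewrite -lerBrDl /dn -ler_pdivlMl// mulrC; apply: ltW.
  by near: n; exact: (near_infty_natSinv_lt (PosNum e0)).
- apply: (bounded_supp_integrable (fun t => M * \1_(cbox d b) t) `|M| b).
  + by apply: measurable_funM => //; exact: measurable_indic (measurable_cbox d b).
  + move=> t; rewrite indicE normrM.
    by case: (_ \in _); rewrite /= ?normr1 ?normr0 ?mulr1 ?mulr0.
  + move=> t; rewrite indicE; case: (boolP (t \in _)) => [|_]; first by rewrite inE.
    by rewrite mulr0 eqxx.
- apply: aeW => t n _; rewrite /= lee_fin indicE normrM.
  have [->|wt] := eqVneq (w n (rv_of t)) 0; first by rewrite normr0 mul0r mulr_ge0.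
  have tb := w_supp n _ wt.
  rewrite mem_set ?mulr1; last by move=> i; have := tb i; rewrite mxE.
  rewrite -[leRHS]mul1r; apply: ler_pM => //; last exact: HM.
  by have /andP[w0 w1] := w01 n (rv_of t); rewrite ger0_norm.
- move=> n; rewrite (@IntE _ _ (fun x => w n x * (v x - v a))); last first.
    by apply: cont_suppMr.
  rewrite lee_fin.
  have -> : (fun x => w n x * (v x - v a)) =
    (fun x => (dn n)^-1 * ((bump a (c + dn n) x - bump a c x) * (v x - v a))).
    by apply/funext => x; rewrite /w; ring.
  have cs : cont_supp (fun x => (bump a (c + dn n) x - bump a c x) * (v x - v a)).
    apply: cont_suppMr => //; under eq_fun do rewrite -[X in _ + X]mulN1r.
    by apply: cont_suppD; [|apply: cont_suppZ]; exact: bump_cont_supp.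
  rewrite (IntZ _ _ cs) mulr_ge0 ?invr_ge0 ?(ltW (dn0 n))//.
  apply: (@mean_value_weight _ _ v v1 v2) => //; first by rewrite lerDl ltW.
  move=> t y t01 yc; apply: pos => //; apply: le_trans yc _.
  by rewrite lerD2l.
Unshelve. all: by end_near. Qed.

End mean_value_ball.

(** * Integrability near the origin *)

Section integrability_exponents.
Context {R : realType}.

(* Telescoping: [(1 - 1/y)^(1-q) >= 1 + (q-1)/y] gives
   [(q-1) y^-q <= (y-1)^(1-q) - y^(1-q)]. *)
Lemma sum_powR_bound (q : R) : 1 < q -> forall N,
  \sum_(0 <= k < N) expR (- q * ln k.+2%:R) <= (q - 1)^-1.
Proof.
move=> q1; have q10 : 0 < q - 1 by rewrite subr_gt0.
suff H N : \sum_(0 <= k < N) expR (- q * ln k.+2%:R) <=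
    (1 - expR ((1 - q) * ln N.+1%:R)) / (q - 1).
  move=> N; apply: le_trans (H N) _; rewrite -[leRHS]mul1r ler_wpM2r//.
    by rewrite invr_ge0 ltW.
elim: N => [|N IH]; first by rewrite big_nil ln1 mulr0 expR0 subrr mul0r.
rewrite big_nat_recr//=.
suff h : (q - 1) * expR (- q * ln N.+2%:R) <=
   expR ((1 - q) * ln N.+1%:R) - expR ((1 - q) * ln N.+2%:R).
  apply: le_trans (lerD IH (lexx _)) _; rewrite ler_pdivlMr// mulrDl divfK ?gt_eqF//.
  by rewrite [_ * (q - 1)]mulrC; move: h; set A := expR _; set B := expR _; set C := expR _; lra.
have y0 : 0 < N.+2%:R :> R by rewrite ltr0n.
have x0 : 0 < N.+1%:R :> R by rewrite ltr0n.
have lxy : N.+2%:R^-1 <= ln N.+2%:R - ln N.+1%:R :> R.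
  have : ln (N.+1%:R / N.+2%:R) <= N.+1%:R / N.+2%:R - 1 :> R.
    have := @le_ln1Dx R (N.+1%:R / N.+2%:R - 1); rewrite [1 + _]addrC subrK; apply.
    by rewrite ltrBrDr addNr divr_gt0.
  rewrite ln_div// => h.
  have -> : N.+2%:R^-1 = - (N.+1%:R / N.+2%:R - 1) :> R.
    apply: (mulIf (lt0r_neq0 y0)); rewrite mulVf ?gt_eqF// mulNr mulrBl divfK ?gt_eqF//.
    by rewrite mul1r -[N.+2%:R]natr1; ring.
  by rewrite -[leRHS]opprB lerN2.
have e1 : expR ((1 - q) * ln N.+1%:R) =
  expR ((1 - q) * ln N.+2%:R) * expR ((q - 1) * (ln N.+2%:R - ln N.+1%:R)).
  by rewrite -expRD; congr expR; ring.
have e2 : expR (- q * ln N.+2%:R) = expR ((1 - q) * ln N.+2%:R) * N.+2%:R^-1.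
  have -> : N.+2%:R^-1 = expR (- ln N.+2%:R) :> R by rewrite expRN lnK ?posrE.
  by rewrite -expRD; congr expR; ring.
have e3 : 1 + (q - 1) * N.+2%:R^-1 <= expR ((q - 1) * (ln N.+2%:R - ln N.+1%:R)).
  apply: le_trans (expR_ge1Dx _); by rewrite lerD2l ler_wpM2l// ltW.
rewrite e1 e2 mulrCA -[X in _ <= _ - X]mulr1 -mulrBr ler_wpM2l ?expR_ge0//.
by move: e3; set A := expR _; set B := _ * _; lra.
Qed.

Context {n : nat} (al ga : R).
Hypotheses (n0 : (0 < n)%N) (al0 : 0 < al) (ga_gt : al / n%:R < ga).
Local Notation d := (n + n)%N.
Local Notation RM := (measurableTypeR R).
Local Notation mu := (@lebesgue R d).
Local Notation s_ t := (sqn (@rv_of R d t)).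

Let nR0 : 0 < n%:R :> R. Proof. by rewrite ltr0n. Qed.
Let ga0 : 0 < ga. Proof. by apply: lt_trans ga_gt; rewrite divr_gt0. Qed.

(** Equals [|phi|^p] for [0 < |z| < 1]; its finite value at the origin concerns a null set only. *)
Definition power_fun (p : R) (t : d.-tuple RM) : R := expR (p * expo al ga (s_ t)).

Lemma measurable_sqn : measurable_fun setT (fun t : d.-tuple RM => s_ t : RM).
Proof. exact: (@continuous_measurable_rv _ _ sqn sqn_continuous). Qed.

Lemma measurable_expo : measurable_fun setT (fun t : d.-tuple RM => expo al ga (s_ t) : RM).
Proof.
have m1 : measurable_fun setT (fun t : d.-tuple RM => ln (s_ t) : RM).
  exact: (measurableT_comp (@measurable_ln R) measurable_sqn).
have m2 : measurable_fun setT (fun t : d.-tuple RM => ln (- ln (s_ t)) : RM).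
  exact: (measurableT_comp (@measurable_ln R) (measurable_funN m1)).
by apply: measurable_funB; apply: measurable_funM.
Qed.

Lemma measurable_power_fun p : measurable_fun setT (power_fun p : _ -> RM).
Proof.
have m1 : measurable_fun setT (fun t : d.-tuple RM => p * expo al ga (s_ t) : RM).
  by apply: measurable_funM => //; exact: measurable_expo.
exact: (measurableT_comp (@measurable_expR R) m1).
Qed.

Definition shell (a b : R) : set (d.-tuple RM) := [set t | a < s_ t <= b].

Lemma measurable_shell a b : measurable (shell a b).
Proof.
have -> : shell a b = (fun t : d.-tuple RM => s_ t) @^-1` `]a, b]%classic.
  by apply/seteqP; split => t /=; rewrite in_itv.
by rewrite -[X in measurable X]setTI; apply: measurable_sqn.
Qed.

Lemma shell_volume (a r : R) : 0 <= r -> (mu (shell a (r ^+ 2)) <= ((2 * r) ^+ d)%:E)%E.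
Proof.
move=> r0; rewrite -lebesgue_cbox//; apply: le_measure; rewrite ?inE.
- exact: measurable_shell.
- exact: measurable_cbox.
move=> t /andP[_ tr] i; rewrite -(@ler_pXn2r _ 2)// ?nnegrE// real_normK ?num_real//.
apply: le_trans tr; rewrite /sqn (bigD1 i)//= mxE lerDl sumr_ge0// => j _; exact: sqr_ge0.
Qed.

Lemma integral_shell_le p (a r M : R) : 0 <= r -> 0 <= M ->
  (forall t, shell a (r ^+ 2) t -> power_fun p t <= M) ->
  (\int[mu]_(t in shell a (r ^+ 2)) (power_fun p t)%:E <= (M * (2 * r) ^+ d)%:E)%E.
Proof.
move=> r0 M0 HM; have mS := measurable_shell a (r ^+ 2).
apply: (@le_trans _ _ (\int[mu]_(t in shell a (r ^+ 2)) (cst M%:E t))%E).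
  apply: ge0_le_integral => //.
  - by move=> t _; rewrite lee_fin expR_ge0.
  - apply/measurable_EFinP; apply: measurable_funTS; exact: measurable_power_fun.
rewrite integral_cst// EFinM; apply: lee_wpmul2l; first by rewrite lee_fin.
exact: shell_volume.
Qed.

Let p0 := n%:R / al.
Let q := p0 * ga.

Let q1 : 1 < q.
Proof.
rewrite /q /p0 mulrAC ltr_pdivlMr// mul1r.
by move: ga_gt; rewrite ltr_pdivrMr// mulrC.
Qed.

Let p0E L : p0 * (- al * - L - ga * ln L) = n%:R * L - q * ln L.
Proof. by rewrite /q /p0; field; rewrite gt_eqF. Qed.

Let power_p0 (t : d.-tuple RM) : power_fun p0 t = expR (n%:R * (- ln (s_ t)) - q * ln (- ln (s_ t))).
Proof. by rewrite /power_fun /expo -p0E opprK. Qed.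

Let power_p0_le (t : d.-tuple RM) (u w : R) : 0 < u -> u <= - ln (s_ t) -> - ln (s_ t) <= w ->
  power_fun p0 t <= expR (n%:R * w - q * ln u).
Proof.
move=> u0 uL Lw; rewrite power_p0 ler_expR; apply: lerB.
  by rewrite ler_wpM2l// ltW.
rewrite ler_wpM2l//; first by rewrite (le_trans ler01)// ltW.
by rewrite ler_ln ?posrE// (lt_le_trans u0).
Qed.

(** On shell [k.+1] the quantity [L = -ln s] lies in [[k+2, k+3)], matching the terms of
    [sum_powR_bound]; shell 0 takes the rest, where [-ln c <= L < 2]. *)
Let sh (c : R) (k : nat) : set (d.-tuple RM) :=
  if k is k'.+1 then shell (expR (- k'.+3%:R)) (expR (- k'.+2%:R))
  else shell (expR (- 2)) c.

Let ln_shell (a b : R) (t : d.-tuple RM) : 0 < a -> shell a b t ->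
  - ln b <= - ln (s_ t) < - ln a.
Proof.
move=> a0 /andP[at_ tb]; have s0 := lt_trans a0 at_.
rewrite lerN2 ler_ln ?posrE// ?tb ?(lt_le_trans s0)//= ltrN2 ltr_ln ?posrE//.
Qed.

Lemma power_integrable_crit (c : R) : 0 < c < 1 ->
  mu.-integrable (shell 0 c) (EFin \o power_fun p0).
Proof.
move=> /andP[c0 c1].
have Lc : 0 < - ln c by rewrite oppr_gt0 ln_lt0// c0.
have mf : measurable_fun setT (fun t => (power_fun p0 t)%:E).
  by apply/measurable_EFinP; exact: measurable_power_fun.
apply/integrableP; split; first exact: measurable_funTS.
under eq_integral do rewrite /= ger0_norm ?expR_ge0//.
have msh k : measurable (sh c k) by case: k => [|k]; exact: measurable_shell.
have sub : shell 0 c `<=` \bigcup_k sh c k.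
  move=> t /andP[t0 tc]; have [L2|L2] := ltP (- ln (s_ t)) 2.
    exists 0%N => //=; rewrite /shell/= tc andbT -(lnK t0) ltr_expR.
    by rewrite ltrNl.
  have : 0 <= - ln (s_ t) - 2 by rewrite subr_ge0.
  move=> /truncn_itv /andP[]; set k := Num.trunc _ => k1 k2.
  exists k.+1 => //; rewrite /= /shell/= -(lnK t0) ltr_expR ler_expR.
  have e2 : k.+2%:R = k%:R + 2 :> R by rewrite -addn2 natrD.
  have e3 : k.+3%:R = k.+1%:R + 2 :> R by rewrite -addn2 natrD.
  rewrite e2 e3; apply/andP; split; lra.
apply: le_lt_trans.
  apply: (@ge0_subset_integral _ _ _ mu (shell 0 c) (\bigcup_k sh c k)) => //.
  - exact: measurable_shell.
  - exact: bigcup_measurable.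
  - exact: measurable_funTS.
  - by move=> t _; rewrite lee_fin expR_ge0.
rewrite ge0_integral_bigcup//; last 3 first.
- exact: measurable_funTS.
- by move=> t _; rewrite lee_fin expR_ge0.
- apply/trivIsetP => -[|i] [|j] _ _ ij //; apply/seteqP; split => // t /= [].
  + move=> /andP[h1 _] /andP[_ h2]; have := lt_le_trans h1 h2.
    by rewrite ltr_expR ltrN2 ltNge ler_nat.
  + move=> /andP[_ h2] /andP[h1 _]; have := lt_le_trans h1 h2.
    by rewrite ltr_expR ltrN2 ltNge ler_nat.
  + move=> /andP[h1 h2] /andP[h3 h4].
    have := lt_le_trans h1 h4; rewrite ltr_expR ltrN2 ltr_nat !ltnS => ji.
    have := lt_le_trans h3 h2; rewrite ltr_expR ltrN2 ltr_nat !ltnS => ij'.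
    by move: ij; rewrite eqSS eqn_leq ij' ji.
pose C0 : R := expR (n%:R * 2 - q * ln (- ln c)) * (2 * Num.sqrt c) ^+ d.
(* On shell [k.+1] the cube has volume [2^d e^(-n(k+2))] and the integrand is at most
   [e^(n(k+3)) (k+2)^(-q)]; the exponentials leave [e^n]. *)
pose C1 : R := 2 ^+ d * expR n%:R.
pose B (k : nat) : R := if k is k'.+1 then C1 * expR (- q * ln k'.+2%:R) else C0.
have bound k : (\int[mu]_(t in sh c k) (power_fun p0 t)%:E <= (B k)%:E)%E.
  case: k => [|k] /=.
    rewrite /sh -(sqr_sqrtr (ltW c0)); apply: integral_shell_le; rewrite ?sqrtr_ge0 ?expR_ge0//.
    move=> t; rewrite (sqr_sqrtr (ltW c0)) => ht.
    have /andP[h1 h2] := ln_shell _ _ _ (expR_gt0 _) ht.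
    by apply: power_p0_le => //; apply: ltW; move: h2; rewrite expRK opprK.
  pose r : R := expR (- (k.+2%:R / 2)).
  have r2 : expR (- k.+2%:R) = r ^+ 2.
    by rewrite /r expr2 -expRD; congr expR; lra.
  rewrite r2; have -> : C1 * expR (- q * ln k.+2%:R) =
      expR (n%:R * k.+3%:R - q * ln k.+2%:R) * (2 * r) ^+ d.
    rewrite /C1 exprMn addnn -[in r ^+ _]muln2 mulnC exprM -r2 -expRM_natl mulrCA -mulrA.
    rewrite -!expRD; congr (_ * expR _).
    by rewrite -[k.+3%:R]natr1; ring.
  apply: integral_shell_le; rewrite ?expR_ge0// => t; rewrite -r2 => ht.
  have /andP[h1 h2] := ln_shell _ _ _ (expR_gt0 _) ht.
  rewrite !expRK !opprK in h1 h2.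
  by apply: power_p0_le; [rewrite ltr0n|exact: h1|exact: ltW].
have B0 k : 0 <= B k.
  by case: k => [|k]; rewrite /B !mulr_ge0 ?expR_ge0 ?exprn_ge0 ?mulr_ge0 ?sqrtr_ge0.
apply: (@le_lt_trans _ _ (C0 + C1 * (q - 1)^-1)%:E); last by rewrite ltry.
apply: lime_le.
  by apply: is_cvg_nneseries => k _ _; apply: integral_ge0 => t _; rewrite lee_fin expR_ge0.
apply: nearW => N; apply: (@le_trans _ _ (\sum_(0 <= k < N) (B k)%:E)%E).
  by apply: lee_sum => k _; exact: bound.
rewrite sumEFin lee_fin; case: N => [|N].
  rewrite big_nil addr_ge0//; first exact: (B0 0%N).
  by rewrite mulr_ge0 ?mulr_ge0 ?exprn_ge0 ?expR_ge0 ?invr_ge0 ?subr_ge0 ?(ltW q1).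
rewrite big_nat_recl//= lerD2l -mulr_sumr ler_wpM2l//.
  by rewrite mulr_ge0 ?exprn_ge0 ?expR_ge0.
exact: sum_powR_bound.
Qed.

Lemma shell_finite (a c : R) : 0 <= c -> (mu (shell a c) < +oo)%E.
Proof.
move=> c0; rewrite -(sqr_sqrtr c0).
by apply: le_lt_trans (shell_volume _ _ (sqrtr_ge0 c)) _; rewrite ltry.
Qed.

(** On a set of finite measure, [|phi|^p <= 1 + |phi|^p0] for [p <= p0]. *)
Lemma power_integrable (p c : R) : 0 < p <= n%:R / al -> 0 < c < 1 ->
  mu.-integrable (shell 0 c) (EFin \o power_fun p).
Proof.
move=> /andP[p_gt0 pp0] c01; have /andP[c0 c1] := c01.
have mS := measurable_shell 0 c.
apply: (@le_integrable _ _ _ mu _ mS _ (fun t => 1 + (power_fun p0 t)%:E)%E).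
- by apply: measurable_funTS; apply/measurable_EFinP; exact: measurable_power_fun.
- move=> t _; rewrite -EFinD !abse_EFin lee_fin !ger0_norm ?addr_ge0 ?expR_ge0//.
  rewrite /power_fun; have [h|h] := leP (expo al ga (s_ t)) 0.
    apply: ler_wpDr; first exact: expR_ge0.
    by rewrite expR_le1 mulr_ge0_le0// ltW.
  apply: ler_wpDl => //; rewrite ler_expR ler_wpM2r//; exact: ltW.
- apply: integrableD => //; last exact: power_integrable_crit.
  apply: (@measurable_bounded_integrable _ _ _ mu (cst 1)) => //.
    by apply: shell_finite; exact: ltW.
  by exists 1; split; [exact: num_real|move=> M M1 t _ /=; rewrite normr1 ltW].
Qed.

(** Here [d b^2] is [|z|^2] at a corner of the cube of half-side [b]. In terms of [L] the product is
    a constant times [exp((p al - n) L - p ga ln L)], and [p al - n > 0]. *)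
Lemma power_box_large (p K e : R) : n%:R / al < p -> 0 < e ->
  exists2 b : R, 0 < b /\ d%:R * b ^+ 2 <= e &
    K < (2 * b) ^+ d * expR (p * expo al ga (d%:R * b ^+ 2)).
Proof.
move=> pn e0; have a0 : 0 < p * al - n%:R by rewrite subr_gt0 -ltr_pdivrMr.
have p0' : 0 < p by apply: lt_trans pn; rewrite divr_gt0.
(* With [d b^2 = s] and [d = 2n], the volume is [(2b)^(2n) = (2s/n)^n]. *)
pose C : R := (2 / n%:R) ^+ n; have C0 : 0 < C by rewrite exprn_gt0// divr_gt0.
have [L0 L01 H] := lin_ln_large (p * al - n%:R) (p * ga) (`|K| / C) a0
  (mulr_ge0 (ltW p0') (ltW ga0)).
have [L L0L Le] : exists2 L : R, L0 <= L & - ln e <= L.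
  by exists (Num.max L0 (- ln e)); rewrite le_max lexx ?orbT.
have [s s0 sL] : exists2 s : R, 0 < s & ln s = - L.
  by exists (expR (- L)); rewrite ?expR_gt0// expRK.
have [D dR0 DE] : exists2 D : R, 0 < D & d%:R = D.
  by exists d%:R => //; rewrite ltr0n addn_gt0 n0.
have [b b0 b2] : exists2 b : R, 0 < b & b ^+ 2 = s / D.
  exists (Num.sqrt (s / D)); first by rewrite sqrtr_gt0 divr_gt0.
  by rewrite sqr_sqrtr// divr_ge0 ?ltW.
have Db : D * b ^+ 2 = s by rewrite b2 mulrC divfK// gt_eqF.
exists b; rewrite DE Db.
  by split => //; rewrite -ler_ln ?posrE// sL lerNl.
have -> : (2 * b) ^+ d = C * expR (- (n%:R * L)).
  have -> : (2 * b) ^+ d = (2 ^+ 2 * b ^+ 2) ^+ n by rewrite -exprMn -exprM mul2n addnn.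
  rewrite b2 (_ : 2 ^+ 2 * (s / D) = (2 / n%:R) * s); last first.
    by rewrite -DE addnn -mul2n natrM; field; rewrite gt_eqF.
  by rewrite exprMn -mulrN expRM_natl -sL lnK.
rewrite -mulrA -expRD /expo sL opprK.
rewrite (_ : _ + _ = (p * al - n%:R) * L - p * ga * ln L); last by ring.
have h := H L L0L.
have := expR_ge1Dx ((p * al - n%:R) * L - p * ga * ln L); set X := _ - _ in h * => hX.
apply: le_lt_trans (ler_norm K) _; rewrite -ltr_pdivrMl// mulrC.
by apply: le_lt_trans h _; lra.
Qed.

End integrability_exponents.

(** * From the profile to phi *)

Section phi_integrability.
Context {R : realType} {n : nat} (al ga : R).
Hypotheses (n0 : (0 < n)%N) (al0 : 0 < al) (ga_gt : al / n%:R < ga).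
Local Notation d := (n + n)%N.
Local Notation V := 'rV[R]_d.
Local Notation RM := (measurableTypeR R).
Local Notation mu := (@lebesgue R d).
Implicit Types z : V.

Lemma cnorm_sqn z : cnorm z = Num.sqrt (sqn z).
Proof.
rewrite /cnorm /sqn big_split_ord /= -big_split /=.
by congr Num.sqrt; apply: eq_bigr => j _.
Qed.

Lemma cnorm_sqr z : cnorm z ^+ 2 = sqn z.
Proof. by rewrite cnorm_sqn sqr_sqrtr// sqn_ge0. Qed.

Lemma sqn_eq0 z : (sqn z == 0) = (z == 0).
Proof.
apply/eqP/eqP => [h|->]; last by rewrite /sqn big1// => i _; rewrite mxE expr0n.
apply/rowP => i; rewrite mxE; apply/eqP; rewrite -sqrf_eq0 eq_le sqr_ge0 andbT -h.
by rewrite /sqn (bigD1 i)//= lerDl sumr_ge0// => j _; exact: sqr_ge0.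
Qed.

Lemma sqn_gt0 z : z != 0 -> 0 < sqn z.
Proof. by move=> z0; rewrite lt_neqAle sqn_ge0 eq_sym sqn_eq0 z0. Qed.

Lemma cballE (r : R) : 0 < r -> cball 0 r = [set z : V | sqn z < r ^+ 2].
Proof.
move=> r0; apply/seteqP; split => z; rewrite /cball /= subr0 => h.
  by rewrite -cnorm_sqr ltr_pXn2r ?nnegrE ?(ltW r0) ?cnorm_sqn ?sqrtr_ge0// -cnorm_sqn.
by rewrite -(@ltr_pXn2r _ 2)// ?nnegrE ?(ltW r0) ?cnorm_sqn ?sqrtr_ge0// -cnorm_sqn cnorm_sqr.
Qed.

Lemma cclosed_ballE (a : V) (r : R) : 0 < r -> cclosed_ball a r = eball a (r ^+ 2).
Proof.
move=> r0; apply/seteqP; split => z; rewrite /cclosed_ball /eball /= => h.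
  by rewrite -cnorm_sqr ler_pXn2r ?nnegrE ?(ltW r0) ?cnorm_sqn ?sqrtr_ge0// -cnorm_sqn.
by rewrite -(@ler_pXn2r _ 2)// ?nnegrE ?(ltW r0) ?cnorm_sqn ?sqrtr_ge0// -cnorm_sqn cnorm_sqr.
Qed.

Lemma cball_open (r : R) : 0 < r -> open (cball (0 : V) r).
Proof.
move=> r0; rewrite cballE//.
have -> : [set z : V | sqn z < r ^+ 2] = sqn @^-1` [set x | x < r ^+ 2] by [].
by apply: open_comp => [x _|]; [exact: sqn_continuous|exact: open_lt].
Qed.

Lemma phiE z : z != 0 -> sqn z < 1 -> phi al ga z = (prof al ga (sqn z))%:E.
Proof.
move=> z0 z1; have s0 := sqn_gt0 _ z0; rewrite /phi (negbTE z0).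
have c0 : 0 < cnorm z by rewrite cnorm_sqn sqrtr_gt0.
have L0 : 0 < - ln (cnorm z ^+ 2) by rewrite cnorm_sqr Nln_gt0// s0.
rewrite /powR !gt_eqF// -expRD /prof /expo -cnorm_sqr lnXn//.
by congr ((- expR _)%:E); rewrite -mulr_natl; ring.
Qed.

Definition origin : set (d.-tuple RM) := [set t | rv_of t == 0].

Lemma measurable_origin : measurable origin.
Proof.
have -> : origin = @rv_of R d @^-1` [set z | sqn z <= 0].
  by apply/seteqP; split => t; rewrite /origin /= -sqn_eq0 eq_le sqn_ge0 andbT.
apply: closed_measurable_rv.
have -> : [set z : V | sqn z <= 0] = sqn @^-1` [set x | x <= 0] by [].
by apply: preimage_closed; [move=> x _; exact: sqn_continuous|exact: closed_le].
Qed.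

Lemma origin_null : mu origin = 0%E.
Proof.
apply/eqP; rewrite eq_le measure_ge0 andbT; apply/lee_addgt0Pr => e e0; rewrite add0e.
(* As [2b <= 1], the volume [(2b)^d] is at most [2b <= e]. *)
pose b := Num.min (2^-1) (e / 2); have b0 : 0 <= b by rewrite le_min invr_ge0 ler0n divr_ge0 ?ltW.
apply: (@le_trans _ _ (mu (cbox d b))).
  apply: le_measure; rewrite ?inE.
  - exact: measurable_origin.
  - exact: measurable_cbox.
  - by move=> t /eqP/rowP t0 i; have := t0 i; rewrite !mxE => ->; rewrite normr0.
rewrite lebesgue_cbox// lee_fin.
have b1 : 2 * b <= 1 by rewrite -ler_pdivlMl// mulr1 ge_min lexx.
have be : 2 * b <= e by rewrite -ler_pdivlMl// mulrC ge_min lexx orbT.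
apply: le_trans be; rewrite -[leRHS]expr1; apply: ler_wiXn2l; rewrite ?mulr_ge0//.
by rewrite addn_gt0 n0.
Qed.

Lemma measurable_off_origin (c : \bar R) (h : d.-tuple RM -> R) :
  measurable_fun setT (h : _ -> RM) ->
  measurable_fun setT (fun t => if rv_of t == 0 then c else (h t)%:E).
Proof.
move=> mh; apply: measurable_fun_ifT => //; last exact/measurable_EFinP.
have -> : (fun t : d.-tuple RM => rv_of t == 0) = (fun t => sqn (rv_of t) == 0).
  by apply/funext => t; rewrite sqn_eq0.
by apply: measurable_fun_eqr => //; exact: measurable_sqn.
Qed.

(** Deletes the null point where phi is infinite, so that real-valued estimates on [shell 0 c]
    suffice. *)
Lemma integrable_off_origin (D : set (d.-tuple RM)) (f : d.-tuple RM -> \bar R)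
    (h : d.-tuple RM -> R) (c : R) : measurable D -> measurable_fun D f ->
  (forall t, D t -> sqn (rv_of t) <= c) ->
  (forall t, D t -> ~ origin t -> f t = (h t)%:E) ->
  mu.-integrable (shell 0 c) (EFin \o h) -> mu.-integrable D f.
Proof.
move=> mD mf Dc fh ih; apply/(negligible_integrable measurable_origin mD mf origin_null).
have mDN : measurable (D `\` origin) by apply: measurableD => //; exact: measurable_origin.
apply: (@eq_integrable _ _ _ mu _ mDN (EFin \o h)).
  by move=> t; rewrite inE => -[Dt t0]; rewrite fh.
apply: (integrableS _ mDN _ ih); first exact: measurable_shell.
move=> t [Dt /negP t0]; rewrite /shell /= Dc// andbT.
by apply: sqn_gt0; exact: t0.
Qed.

Variable c : R.
Hypotheses (c01 : 0 < c < 1).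
Let c0 : 0 < c. Proof. by case/andP: c01. Qed.
Let c1 : c < 1. Proof. by case/andP: c01. Qed.

Lemma prof_power (t : d.-tuple RM) : prof al ga (sqn (rv_of t)) = - power_fun al ga 1 t.
Proof. by rewrite /prof /power_fun mul1r. Qed.

Lemma measurable_phi (D : set (d.-tuple RM)) : (forall t, D t -> sqn (rv_of t) <= c) ->
  measurable_fun D (phi al ga \o @rv_of R d).
Proof.
move=> Dc; pose g (t : d.-tuple RM) : \bar R :=
  if rv_of t == 0 then -oo%E else (- power_fun al ga 1 t)%:E.
have mg : measurable_fun D g.
  apply: measurable_funTS; apply: (measurable_off_origin -oo%E (fun t => - power_fun al ga 1 t)).
  by apply: measurable_funN; exact: measurable_power_fun.
apply: (eq_measurable_fun g) => // t; rewrite inE => /Dc tc; rewrite /g /=.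
case: ifPn => [/eqP ->|t0]; first by rewrite /phi eqxx.
by rewrite phiE// ?prof_power//; exact: le_lt_trans tc c1.
Qed.

Lemma phi_power (p : R) (t : d.-tuple RM) : rv_of t != 0 -> sqn (rv_of t) < 1 ->
  (`|phi al ga (rv_of t)| `^ p)%E = (power_fun al ga p t)%:E.
Proof.
move=> t0 t1; rewrite phiE// abse_EFin poweR_EFin /prof normrN ger0_norm ?expR_ge0//.
by rewrite /power_fun /powR gt_eqF ?expR_gt0// expRK.
Qed.

Lemma measurable_phi_power (p : R) (D : set (d.-tuple RM)) : 0 < p ->
  (forall t, D t -> sqn (rv_of t) <= c) ->
  measurable_fun D ((fun z => (`|phi al ga z| `^ p)%E) \o @rv_of R d).
Proof.
move=> p0 Dc; pose g (t : d.-tuple RM) : \bar R :=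
  if rv_of t == 0 then +oo%E else (power_fun al ga p t)%:E.
have mg : measurable_fun D g.
  apply: measurable_funTS; apply: (measurable_off_origin +oo%E (power_fun al ga p)).
  exact: measurable_power_fun.
apply: (eq_measurable_fun g) => // t; rewrite inE => /Dc tc; rewrite /g /=.
case: ifPn => [/eqP ->|t0]; first by rewrite /phi eqxx /= gt_eqF.
by rewrite phi_power//; exact: le_lt_trans tc c1.
Qed.

Lemma phi_integrable (D : set (d.-tuple RM)) : al <= n%:R -> measurable D ->
  (forall t, D t -> sqn (rv_of t) <= c) ->
  mu.-integrable D (phi al ga \o @rv_of R d).
Proof.
move=> aln mD Dc.
apply: (integrable_off_origin D _ (fun t => - power_fun al ga 1 t) c) => //.
- exact: measurable_phi.
- move=> t Dt /negP t0 /=; rewrite phiE ?prof_power//.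
  exact: le_lt_trans (Dc t Dt) c1.
- have := power_integrable al ga n0 al0 ga_gt 1 c.
  rewrite ltr01 ler_pdivlMr// mul1r => /(_ aln c01) /integrableN.
  by apply: eq_integrable => //; exact: measurable_shell.
Qed.

Lemma phi_power_integrable (p : R) (D : set (d.-tuple RM)) : 0 < p <= n%:R / al ->
  measurable D -> (forall t, D t -> sqn (rv_of t) <= c) ->
  mu.-integrable D ((fun z => (`|phi al ga z| `^ p)%E) \o @rv_of R d).
Proof.
move=> pn mD Dc; have /andP[p0 _] := pn.
apply: (integrable_off_origin D _ (power_fun al ga p) c) => //.
- exact: measurable_phi_power.
- move=> t Dt /negP t0 /=; rewrite phi_power//.
  exact: le_lt_trans (Dc t Dt) c1.
- exact: power_integrable.
Qed.

Hypothesis mono : forall s t : R, 0 < s -> s <= t -> t <= c -> prof al ga s <= prof al ga t.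

(** On a small cube inside [U], monotonicity bounds [|phi|^p] below by its value at a corner, and
    the integral would exceed every bound. *)
Lemma phi_power_not_integrable (p : R) (U : set V) : n%:R / al < p -> open U -> U 0 ->
  ~ mu.-integrable (@rv_of R d @^-1` U) ((fun z => (`|phi al ga z| `^ p)%E) \o @rv_of R d).
Proof.
move=> pn oU U0 iU; have p0 : 0 < p by apply: lt_trans pn; rewrite divr_gt0// ltr0n.
have [K KE] : exists K : R,
    (\int[mu]_(t in @rv_of R d @^-1` U) (`|phi al ga (rv_of t)| `^ p) = K%:E)%E.
  have := integrable_fin_num (open_measurable_rv _ U oU) iU.
  by case E : (\int[mu]_(t in _) _)%E => [K||] // _; exists K; rewrite -E.
have /nbhs_ballP [e0 /= e00 eU] : nbhs (0 : V) U by rewrite openE in oU; exact: oU.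
pose e := Num.min c (e0 ^+ 2 / 2).
have e_gt0 : 0 < e by rewrite lt_min c0 divr_gt0 ?exprn_gt0.
have [b [b0 be] Kb] := power_box_large al ga n0 al0 ga_gt p K e pn e_gt0.
have bsq t : cbox d b t -> sqn (rv_of t) <= d%:R * b ^+ 2.
  move=> tb; rewrite /sqn mulr_natl -[X in _ *+ X]card_ord -sumr_const.
  apply: ler_sum => i _; rewrite mxE -real_normK ?num_real//.
  by rewrite ler_pXn2r ?nnegrE ?(ltW b0).
have bU : cbox d b `<=` @rv_of R d @^-1` U.
  move=> t tb /=; apply: eU; split => // i j; rewrite (ord1 i) !mxE /ball/= sub0r normrN.
  have : `|tnth t j : R| ^+ 2 <= sqn (rv_of t).
    rewrite real_normK ?num_real// /sqn (bigD1 j)//= mxE lerDl sumr_ge0// => k _.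
    exact: sqr_ge0.
  move=> /le_trans/(_ (bsq t tb))/le_trans/(_ be) h.
  rewrite -(@ltr_pXn2r _ 2)// ?nnegrE ?(ltW e00)//; apply: le_lt_trans h _.
  rewrite gt_min; apply/orP; right; rewrite ltr_pdivrMr// ltr_pMr ?exprn_gt0//.
  by rewrite ltr1n.
have dec t : cbox d b t ->
    ((expR (p * expo al ga (d%:R * b ^+ 2)))%:E <= `|phi al ga (rv_of t)| `^ p)%E.
  move=> tb; have [t0|t0] := eqVneq (rv_of t) 0.
    by rewrite t0 /phi eqxx /= gt_eqF ?leey.
  have sc := bsq t tb; have bc : d%:R * b ^+ 2 <= c by rewrite (le_trans be)// ge_min lexx.
  have s1 : sqn (rv_of t) < 1 by apply: le_lt_trans c1; exact: le_trans bc.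
  rewrite phi_power// lee_fin /power_fun ler_expR ler_wpM2l ?(ltW p0)//.
  by have := mono _ _ (sqn_gt0 _ t0) sc bc; rewrite /prof lerN2 ler_expR.
have : (((2 * b) ^+ d * expR (p * expo al ga (d%:R * b ^+ 2)))%:E <= K%:E)%E.
  rewrite -KE; apply: (@le_trans _ _ (\int[mu]_(t in cbox d b)
     (cst (expR (p * expo al ga (d%:R * b ^+ 2)))%:E) t)%E).
    rewrite integral_cst; last exact: measurable_cbox.
    by rewrite -[X in (_ <= _ * X)%E]/(mu (cbox d b)) lebesgue_cbox ?(ltW b0)// -EFinM mulrC.
  have mU := open_measurable_rv _ U oU.
  have mf : measurable_fun (@rv_of R d @^-1` U) (fun t => `|phi al ga (rv_of t)| `^ p)%E.
    exact: measurable_int iU.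
  apply: (@le_trans _ _ (\int[mu]_(t in cbox d b) (`|phi al ga (rv_of t)| `^ p))%E).
    apply: ge0_le_integral => //; first exact: measurable_cbox.
    - by move=> t _; rewrite lee_fin expR_ge0.
    - exact: measurable_funS mf.
  apply: ge0_subset_integral => //; first exact: measurable_cbox.
  by move=> t _; exact: poweR_ge0.
by rewrite lee_fin leNgt Kb.
Qed.

End phi_integrability.

(** * Subharmonicity *)

Section approximation.
Context {R : realType} {n : nat} (al ga s0 : R) (m : nat).
Local Notation d := (n + n)%N.
Local Notation V := 'rV[R]_d.
Hypothesis s001 : 0 < s0 < 1.
Hypothesis signs : forall s, 0 < s <= s0 -> [/\ 0 <= prof1 al ga s, prof2 al ga s <= 0 &
  0 <= n%:R * prof1 al ga s + m%:R * (s * prof2 al ga s)].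

Lemma prof_continuous (s : R) : 0 < s < 1 -> {for s, continuous (prof al ga)}.
Proof.
move=> s01; apply: differentiable_continuous; apply/derivable1_diffP.
by case: (prof_is_derive al ga s s01).
Qed.

Lemma prof_nondecreasing (s t : R) : 0 < s -> s <= t -> t <= s0 -> prof al ga s <= prof al ga t.
Proof.
move=> sgt0 st ts0; have /andP[s0_gt0 s0_lt1] := s001.
move: st; rewrite le_eqVlt => /predU1P[->//|st].
have I01 x : s <= x <= t -> 0 < x < 1.
  move=> /andP[sx xt]; rewrite (lt_le_trans sgt0 sx)/=.
  exact: le_lt_trans xt (le_lt_trans ts0 s0_lt1).
have Ist x : x \in `]s, t[%R -> s <= x <= t by rewrite in_itv /= => /andP[/ltW -> /ltW ->].
have [] := @MVT R (prof al ga) (prof1 al ga) s t st.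
- by move=> x /Ist /I01; exact: prof_is_derive.
- apply: continuous_in_subspaceT => x; rewrite inE /= in_itv /= => /I01.
  exact: prof_continuous.
- move=> x /Ist xst E; rewrite -subr_ge0 E mulr_ge0// ?subr_ge0 ?(ltW st)//.
  have /I01/andP[x0 _] := xst; case/andP: xst => _ xt.
  by have [] := signs x; rewrite ?x0 ?(le_trans xt).
Qed.

(** Starting at [s0 / 2] keeps [s + eps k] within [(0, s0]] for [0 <= s <= s0 / 2], where the sign
    conditions hold. *)
Definition eps (k : nat) : R := s0 / 2 / k.+1%:R.
Definition approx (k : nat) : V -> R := radial (reg al ga (s0 / 2) (eps k)).

Lemma eps_gt0 k : 0 < eps k.
Proof. by case/andP: s001 => h _; rewrite !divr_gt0// ltr0n. Qed.

Lemma eps_le k : eps k <= s0 / 2.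
Proof.
case/andP: s001 => h _; rewrite /eps ler_pdivrMr ?ltr0n// ler_peMr ?ler1n//.
by rewrite divr_ge0// ltW.
Qed.

Lemma half_eps k (s : R) : s <= s0 / 2 -> s + eps k <= s0.
Proof. by move=> h; rewrite [leRHS]splitr lerD// eps_le. Qed.

Lemma half_eps_lt1 k : s0 / 2 + eps k < 1.
Proof. by case/andP: s001 => _; apply: le_lt_trans; exact: half_eps. Qed.

Lemma approx_prof k x : sqn x <= s0 / 2 -> approx k x = prof al ga (sqn x + eps k).
Proof. exact: regE. Qed.

(** The shift moves away from the singularity of a monotone negative profile; this is the majorant
    for all later limits. *)
Lemma approx_bound k x : x != 0 -> sqn x <= s0 / 2 -> `|approx k x| <= - prof al ga (sqn x).
Proof.
move=> x0 xs; rewrite approx_prof// ler0_norm; last by rewrite oppr_le0 expR_ge0.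
rewrite lerN2; apply: prof_nondecreasing; last exact: half_eps.
  exact: sqn_gt0.
by rewrite lerDl ltW// eps_gt0.
Qed.

Lemma approx_cvg x : x != 0 -> sqn x <= s0 / 2 ->
  approx ^~ x @ \oo --> prof al ga (sqn x).
Proof.
move=> x0 xs; have /andP[s0_gt0 s0_lt1] := s001.
rewrite (_ : approx ^~ x = (fun k => prof al ga (sqn x + eps k))); last first.
  by apply/funext => k; exact: approx_prof.
apply: continuous_cvg.
  apply: prof_continuous; rewrite sqn_gt0//=; apply: le_lt_trans xs _.
  by rewrite ltr_pdivrMr// mul1r (lt_trans s0_lt1)// ltr1n.
rewrite -[X in _ --> X]addr0; apply: cvgD; first exact: cvg_cst.
rewrite -(mulr0 (s0 / 2)); apply: cvgM; first exact: cvg_cst.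
exact: cvg_harmonic.
Qed.

Let s10 : 0 < s0 / 2. Proof. by case/andP: s001 => h _; rewrite divr_gt0. Qed.
Definition approx1 k := radial1 (d := d) (reg1 al ga (s0 / 2) (eps k)).
Definition approx2 k := radial2 (d := d) (reg1 al ga (s0 / 2) (eps k)) (reg2 al ga (s0 / 2) (eps k)).

Lemma approx_derive k (x w : V) : is_derive x w (approx k) (\sum_i w ord0 i * approx1 k i x).
Proof.
by apply: radial_derive => s sge0; apply: reg_derive => //; [exact: eps_gt0|exact: half_eps_lt1].
Qed.

Lemma approx_derive_delta k (x : V) i :
  is_derive x (delta_mx ord0 i : V) (approx k) (approx1 k i x).
Proof. by have := approx_derive k x (delta_mx ord0 i); rewrite sum_delta. Qed.

Lemma approx1_derive k i j (x : V) :
  is_derive x (delta_mx ord0 j : V) (approx1 k i) (approx2 k i j x).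
Proof.
by apply: radial1_derive => s sge0; apply: reg1_derive => //; [exact: eps_gt0|exact: half_eps_lt1].
Qed.

Lemma approx_continuous k : continuous (approx k).
Proof.
apply: (radial_continuous _ (reg1 al ga (s0 / 2) (eps k))) => s sge0.
by apply: reg_derive => //; [exact: eps_gt0|exact: half_eps_lt1].
Qed.

Lemma approx1_continuous k i : continuous (approx1 k i).
Proof.
apply: (radial1_continuous _ (reg2 al ga (s0 / 2) (eps k))) => s sge0.
by apply: reg1_derive => //; [exact: eps_gt0|exact: half_eps_lt1].
Qed.

Lemma approx2_continuous k i j : continuous (approx2 k i j).
Proof.
apply: radial2_continuous => s sge0.
  by apply: reg1_derive => //; [exact: eps_gt0|exact: half_eps_lt1].
by apply: reg2_continuous => //; [exact: eps_gt0|exact: half_eps_lt1].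
Qed.

(** The Laplacian is [4 (n h' + s h'')] with [h'], [h''] taken at [s + e]. As [h'' <= 0] and
    [s <= m (s + e)], the sign condition bounds it below. *)
Lemma approx_laplacian_ge0 k (x : V) : (0 < m)%N -> sqn x <= s0 / 2 ->
  0 <= \sum_i approx2 k i i x.
Proof.
move=> m0 xs; rewrite /approx2 /radial2 reg1E// reg2E//.
have /signs[] : 0 < sqn x + eps k <= s0.
  by rewrite half_eps// andbT ltr_wpDl ?sqn_ge0// eps_gt0.
move: (prof1 _ _ _) (prof2 _ _ _) => p1 p2 p1_ge0 p2_le0 p_ge0.
rewrite big_split /= -mulr_suml -!mulr_sumr -[X in _ + X]mulr_suml.
rewrite (eq_bigr (fun=> 1 : R)); last by move=> i _; rewrite eqxx.
rewrite sumr_const card_ord natrD.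
rewrite (eq_bigr (fun i : 'I_d => 4 * (x ord0 i ^+ 2))); last first.
  by move=> i _; rewrite expr2 mulrA.
rewrite -mulr_sumr -/(sqn x).
suff : 0 <= n%:R * p1 + sqn x * p2 by lra.
apply: le_trans p_ge0 _; rewrite lerD2l.
rewrite mulrA ler_wnM2r//.
rewrite -[leLHS]mul1r; apply: ler_pM; rewrite ?ler1n ?sqn_ge0//.
by rewrite lerDl ltW// eps_gt0.
Qed.

End approximation.

Section semicontinuity.
Context {R : realType} {n : nat} (al ga : R).
Local Notation d := (n + n)%N.
Local Notation V := 'rV[R]_d.

Lemma phi_usc (B : set V) : 0 < al -> 0 < ga -> (forall z, B z -> sqn z < 1) ->
  usc_on B (phi al ga).
Proof.
move=> al0 ga0 B1 z /B1 z1 A uA; have [z0|z0] := eqVneq z 0.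
  subst z; have [e /andP[e0 _] H] := prof_large al ga al0 ga0 A.
  have : \forall w \near (0 : V), sqn w < Num.min e 1.
    have H0 : sqn (0 : V) < Num.min e 1 by rewrite lt_min (_ : sqn 0 = 0) ?e0 ?ltr01//; apply/eqP; rewrite sqn_eq0.
    have := @sqn_continuous R d 0; move/cvgr_lt => /(_ _ H0); exact.
  apply: filterS => w; rewrite lt_min => /andP[we w1].
  have [->|w0] := eqVneq w 0; first by rewrite /phi eqxx ltNyr.
  by rewrite phiE// lte_fin H// sqn_gt0//= ltW.
rewrite phiE// lte_fin in uA.
have s01 : 0 < sqn z < 1 by rewrite sqn_gt0.
have n1 : \forall w \near z, sqn w < 1 by have := @sqn_continuous R d z; move/cvgr_lt; exact.
have n2 : \forall w \near z, 0 < sqn w.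
  by have := @sqn_continuous R d z; move/cvgr_gt; apply; rewrite sqn_gt0.
have n3 : \forall w \near z, prof al ga (sqn w) < A.
  have : prof al ga (sqn w) @[w --> z] --> prof al ga (sqn z).
    apply: (@continuous_comp _ _ _ (@sqn R d) (prof al ga)); first exact: sqn_continuous.
    exact: prof_continuous.
  by move/cvgr_lt; exact.
near=> w; rewrite phiE ?lte_fin; first by near: w; exact: n3.
  by rewrite -sqn_eq0 gt_eqF//; near: w; exact: n2.
by near: w; exact: n1.
Unshelve. all: by end_near. Qed.

End semicontinuity.

Section subharmonicity.
Context {R : realType} {n : nat} (al ga s0 : R) (m : nat).
Local Notation d := (n + n)%N.
Local Notation V := 'rV[R]_d.
Local Notation RM := (measurableTypeR R).
Local Notation mu := (@lebesgue R d).
Hypotheses (n0 : (0 < n)%N) (m0 : (0 < m)%N) (al0 : 0 < al) (aln : al <= n%:R).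
Hypothesis ga_gt : al / n%:R < ga.
Hypothesis s001 : 0 < s0 < 1.
Hypothesis signs : forall s, 0 < s <= s0 -> [/\ 0 <= prof1 al ga s, prof2 al ga s <= 0 &
  0 <= n%:R * prof1 al ga s + m%:R * (s * prof2 al ga s)].
Let half_gt0 : 0 < s0 / 2. Proof. by case/andP: s001 => h _; rewrite divr_gt0. Qed.
Let half_lt1 : s0 / 2 < 1.
Proof. by case/andP: s001 => _ h; rewrite ltr_pdivrMr// mul1r (lt_trans h)// ltr1n. Qed.
Let half01 : 0 < s0 / 2 < 1. Proof. by rewrite half_gt0. Qed.

Lemma measurable_approx k : measurable_fun setT (approx al ga s0 k \o @rv_of R d : _ -> RM).
Proof. by apply: continuous_measurable_rv; exact: approx_continuous. Qed.

Lemma eball_finite (a : V) (c : R) : (mu (@rv_of R d @^-1` eball a c) < +oo)%E.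
Proof.
pose b : R := \sum_i `|a ord0 i| + (`|c| + 1).
apply: (@le_lt_trans _ _ (mu (cbox d b))); last exact: cbox_finite.
apply: le_measure; rewrite ?inE.
- exact: measurable_eball.
- exact: measurable_cbox.
- move=> t tc i; have tE : tnth t i = rv_of t ord0 i :> R by rewrite mxE.
  move: tc; rewrite /eball /=; move: (rv_of t) tE => x tE xc.
  rewrite /= tE -[x ord0 i](subrK (a ord0 i)) addrC /b.
  apply: (le_trans (ler_normD _ _)); apply: lerD.
    by rewrite (bigD1 i)//= lerDl sumr_ge0.
  have h : (x ord0 i - a ord0 i) ^+ 2 <= c.
    apply: le_trans xc; rewrite /sqn (bigD1 i)//= !mxE lerDl sumr_ge0// => j _.
    exact: sqr_ge0.
  rewrite -(@ler_pXn2r _ 2)// ?nnegrE ?addr_ge0// real_normK ?num_real//.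
  apply: le_trans h _; have := ler_norm c; have := normr_ge0 c; nra.
Qed.

(** For balls centred at 0 the left side of the mean value inequality is [-oo] because their volume
    is positive. *)
Lemma eball0_gt0 (c : R) : 0 < c -> (0 < mu (@rv_of R d @^-1` eball 0 c))%E.
Proof.
move=> c0; have d0 : 0 < d%:R :> R by rewrite ltr0n addn_gt0 n0.
pose b := Num.sqrt (c / d%:R); have b0 : 0 < b by rewrite sqrtr_gt0 divr_gt0.
apply: (@lt_le_trans _ _ (mu (cbox d b))).
  by rewrite lebesgue_cbox ?(ltW b0)// lte_fin exprn_gt0// mulr_gt0.
apply: le_measure; rewrite ?inE.
- exact: measurable_cbox.
- exact: measurable_eball.
- move=> t tb; rewrite /eball /= subr0.
  have -> : c = \sum_(i < d) b ^+ 2.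
    by rewrite sumr_const card_ord -mulr_natl sqr_sqrtr ?divr_ge0 ?ltW// mulrC divfK// gt_eqF.
  apply: ler_sum => i _; rewrite mxE -real_normK ?num_real//.
  by rewrite ler_pXn2r ?nnegrE ?(ltW b0).
Qed.

(** Adding the conditions at the points [a + r e_i] and [a - r e_i] cancels the cross terms. *)
Lemma ball_in_ball (a : V) (r rho : R) : 0 < r -> eball a (r ^+ 2) `<=` [set z | sqn z < rho] ->
  sqn a + r ^+ 2 < rho.
Proof.
move=> r0 sub; have i : 'I_d by exact: (Ordinal (ltn_addr n n0)).
have E (s : R) : sqn (a + s *: delta_mx ord0 i) = sqn a + 2 * s * a ord0 i + s ^+ 2.
  rewrite /sqn (bigD1 i)//= [in RHS](bigD1 i)//= !mxE !eqxx mulr1 sqrrD.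
  rewrite (eq_bigr (fun j => a ord0 j ^+ 2)); last first.
    by move=> j /negbTE ji; rewrite !mxE ji andbF mulr0 addr0.
  by rewrite -mulr_natl; ring.
have S (s : R) : s ^+ 2 = r ^+ 2 -> sqn a + 2 * s * a ord0 i + s ^+ 2 < rho.
  move=> sr; rewrite -E; apply: sub; rewrite /eball /= addrC addKr.
  rewrite /sqn (bigD1 i)//= !mxE !eqxx mulr1 big1 ?addr0 ?sr// => j /negbTE ji.
  by rewrite !mxE ji andbF mulr0 expr0n.
by have := S r erefl; have := S (- r) (sqrrN r); rewrite sqrrN; lra.
Qed.

Lemma sqn_add_le (t : R) (a y : V) : 0 < t < 1 -> sqn (a + t *: y) <= 2 * (sqn a + sqn y).
Proof.
move=> /andP[t0 t1]; rewrite mulrDr /sqn !mulr_sumr -big_split /=; apply: ler_sum => i _.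
rewrite !mxE; move: (a ord0 i) (y ord0 i) => u v.
have : t * v * (t * v) <= v * v.
  rewrite mulrACA -!expr2; apply: ler_piMl; first exact: sqr_ge0.
  by rewrite expr_le1 ?ltW.
by rewrite !expr2; have := sqr_ge0 (u - t * v); rewrite expr2; nra.
Qed.

Lemma approx_mean_value k (a : V) (r : R) : 0 < r ->
  eball a (r ^+ 2) `<=` [set z | sqn z < s0 / 4] ->
  (0 <= \int[mu]_(t in @rv_of R d @^-1` eball a (r ^+ 2))
     (approx al ga s0 k (rv_of t) - approx al ga s0 k a)%:E)%E.
Proof.
move=> r0 sub; have h := ball_in_ball a r _ r0 sub.
(* This slack makes [|a|^2 + |y|^2 <= s0/4], hence [|a + ty|^2 <= s0/2], where the Laplacian is
   nonnegative. The radius condition of the theorem originates here. *)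
apply: (mean_value_ball (approx al ga s0 k) (approx1 al ga s0 k) (fun i => approx2 al ga s0 k i i)
   _ _ _ _ _ a (r ^+ 2) (s0 / 4 - sqn a - r ^+ 2)).
- exact: approx_derive.
- by move=> i x; exact: approx1_derive.
- exact: approx_continuous.
- by move=> i; exact: approx1_continuous.
- by move=> i; exact: approx2_continuous.
- lra.
- move=> t y t01 yc; apply: (approx_laplacian_ge0 _ _ _ m) => //.
  apply: le_trans (sqn_add_le t a y t01) _; lra.
Qed.

Lemma phi_mean_value (a : V) (r : R) : 0 < r -> eball a (r ^+ 2) `<=` [set z | sqn z < s0 / 4] ->
  (phi al ga a * mu (@rv_of R d @^-1` eball a (r ^+ 2)) <=
   \int[mu]_(t in @rv_of R d @^-1` eball a (r ^+ 2)) phi al ga (rv_of t))%E.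
Proof.
move=> r0 sub; have [a0|a0] := eqVneq a 0.
  by subst a; rewrite /phi eqxx gt0_mulNye ?leNye// eball0_gt0// exprn_gt0.
set D := _ @^-1` _; have mD : measurable D by exact: measurable_eball.
have s0_gt0 : 0 < s0 by case/andP: s001.
have D_half t : D t -> sqn (rv_of t) <= s0 / 2.
  by move=> /sub /= h; apply: ltW; apply: lt_trans h _; lra.
have a_half : sqn a <= s0 / 2.
  by have := ball_in_ball a r _ r0 sub; have := sqr_ge0 r; lra.
have a1 : sqn a < 1 by exact: le_lt_trans half_lt1.
have muD : (mu D < +oo)%E by exact: eball_finite.
have i_phi : mu.-integrable D (phi al ga \o @rv_of R d).
  exact: (phi_integrable al ga n0 al0 ga_gt (s0 / 2)).
have i_cst (K : R) : mu.-integrable D (EFin \o cst K).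
  apply: (@measurable_bounded_integrable _ _ _ mu (cst K)) => //.
  by exists `|K|; split; [exact: num_real|move=> M M1 t _ /=; exact: ltW].
rewrite phiE//; set A := prof al ga (sqn a).
have aeD t : ~ origin t -> D t -> rv_of t != 0 /\ sqn (rv_of t) < 1.
  move=> /negP t0 Dt; split => //.
  by apply: le_lt_trans half_lt1; exact: D_half.
have mphi := measurable_phi al ga (s0 / 2) half01 D D_half.
suff : (0 <= \int[mu]_(t in D) (phi al ga (rv_of t) - A%:E))%E.
  rewrite integralB//; last exact: i_cst.
  rewrite integral_cst// sube_ge0//.
  by rewrite fin_numM// ge0_fin_numE.
(* The constant [- A] in the majorant is [|phi a|], which bounds every [approx al ga s0 k a]. *)
apply: (@dominated_ge0 _ _ _ mu D
  (fun k t => (approx al ga s0 k (rv_of t) - approx al ga s0 k a)%:E) _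
  (fun t => `|phi al ga (rv_of t)| + (- A)%:E)%E) => //.
- move=> k; apply: measurable_funTS; apply/measurable_EFinP.
  by apply: measurable_funB; [exact: measurable_approx|exact: measurable_cst].
- by apply: emeasurable_funB; [exact: mphi|exact: measurable_cst].
- exists origin; split; [exact: measurable_origin|exact: origin_null|].
  move=> t /= H; apply: contrapT => nt; apply: H => Dt; have [t0 t1] := aeD t nt Dt.
  rewrite phiE// -EFinB; apply: cvg_EFin; first exact: nearW.
  by apply: cvgB; apply: approx_cvg => //; exact: D_half.
- apply: integrableD => //; [exact: integrable_abse|exact: i_cst].
- exists origin; split; [exact: measurable_origin|exact: origin_null|].
  move=> t /= H; apply: contrapT => nt; apply: H => k Dt; have [t0 t1] := aeD t nt Dt.
  rewrite phiE// !abse_EFin -EFinD lee_fin (le_trans (ler_normB _ _))//.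
  have h := approx_bound al ga s0 m s001 signs k.
  apply: lerD; last exact: h.
  rewrite [leRHS]ler0_norm; first by apply: h => //; exact: D_half.
  by rewrite oppr_le0 expR_ge0.
- by move=> k; exact: approx_mean_value.
Qed.

Lemma phi_subharmonic (rho : R) : 0 < rho -> rho ^+ 2 <= s0 / 4 ->
  subharmonic (cball (0 : V) rho) (phi al ga).
Proof.
move=> rho0 rs; have s0_gt0 : 0 < s0 by case/andP: s001.
have B_half z : cball (0 : V) rho z -> sqn z < s0 / 4.
  by rewrite cballE// => /= h; exact: lt_le_trans rs.
split.
  apply: phi_usc => //; first by apply: lt_trans ga_gt; rewrite divr_gt0// ltr0n.
  by move=> z /B_half h; apply: lt_trans h _; have := half_lt1; lra.
move=> a r r0; rewrite cclosed_ballE// => sub.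
by apply: phi_mean_value => // z /sub; exact: B_half.
Qed.

Lemma phi_locally_integrable (rho : R) : 0 < rho -> rho ^+ 2 <= s0 / 4 ->
  clocally_integrable (cball (0 : V) rho) (phi al ga).
Proof.
move=> rho0 rs K cK KB; apply: (phi_integrable al ga n0 al0 ga_gt (s0 / 2)) => //.
  by apply: closed_measurable_rv; apply: compact_closed => //; exact: norm_hausdorff.
move=> t /KB; rewrite cballE// => /= h; have s0_gt0 : 0 < s0 by case/andP: s001.
by apply: ltW; apply: lt_le_trans h _; lra.
Qed.

End subharmonicity.

(** * Positivity of the currents *)

Section hessian_form.
Context {R : realType} {n : nat}.
Local Notation d := (n + n)%N.
Local Notation V := 'rV[R]_d.
Local Notation K := (complex R).
Local Notation ofR := (real_complex R).
Implicit Types (s : seq 'M[K]_n) (D E : 'M[R]_d).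

(** The form attached to a Hessian, extended linearly to all real matrices so that pairings can be
    expanded over the [delta_mx a b]. *)
Definition form_of D : 'M[K]_n := \matrix_(j, k)
  let x := @lshift n n in let y := @rshift n n in
  Complex ((D (x j) (x k) + D (y j) (y k)) / 4) ((D (x j) (y k) - D (y j) (x k)) / 4).

Lemma ddcE (f : V -> R) z : ddc f z = form_of (\matrix_(a, b) partial a (partial b f) z).
Proof. by apply/matrixP => j k; rewrite !mxE /= !mxE. Qed.

Lemma form_of_linear (t : R) D E : form_of (t *: D + E) = ofR t *: form_of D + form_of E.
Proof.
apply/matrixP => j k; rewrite !mxE /= !mxE.
by apply/eqP; rewrite eq_complex/=; apply/andP; split; apply/eqP; ring.
Qed.

(** The real Hessian of [h(|z|^2)] becomes [h' beta] plus [h''] times a rank one form: the terms of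
    type (2,0) and (0,2) drop out. *)
Lemma form_of_radial (h1 h2 : R) (z : V) :
  form_of (\matrix_(a, b) (2 * (a == b)%:R * h1 + 4 * z ord0 a * z ord0 b * h2)) =
  ofR h1 *: 1%:M + ofR h2 *: \matrix_(i, j) (conjc (zcoord z i) * zcoord z j).
Proof.
apply/matrixP => j k; rewrite !mxE /= !mxE !eq_lshift !eq_rshift eq_lrshift eq_rlshift /zcoord.
move: (z _ (lshift n j)) (z _ (rshift n j)) (z _ (lshift n k)) (z _ (rshift n k)) => a b a' b'.
apply/eqP; rewrite eq_complex/=; apply/andP.
by case: (j == k); split; apply/eqP; rewrite /= ?mulr1n ?mulr0n /=; field.
Qed.

Definition hess_pairing s D : R := complex.Re (wedge (form_of D :: s)).

Hypothesis n0 : (0 < n)%N.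

Lemma hess_pairing_linear s (t : R) D E :
  hess_pairing s (t *: D + E) = t * hess_pairing s D + hess_pairing s E.
Proof.
rewrite /hess_pairing form_of_linear wedge_linear//.
by case: (wedge (form_of D :: s)) (wedge (form_of E :: s)) => [a b] [a' b'] /=; ring.
Qed.

Lemma hess_pairingE s D :
  hess_pairing s D = \sum_a \sum_b D a b * hess_pairing s (delta_mx a b).
Proof.
have L0 : hess_pairing s 0 = 0.
  have := hess_pairing_linear s 1 0 0; rewrite scaler0 addr0; lra.
have LD D1 D2 : hess_pairing s (D1 + D2) = hess_pairing s D1 + hess_pairing s D2.
  by rewrite -{1}[D1]scale1r hess_pairing_linear mul1r.
have LZ t D1 : hess_pairing s (t *: D1) = t * hess_pairing s D1.
  by rewrite -[t *: D1]addr0 hess_pairing_linear L0 addr0.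
rewrite {1}[D]matrix_sum_delta (big_morph _ LD L0); apply: eq_bigr => a _.
by rewrite (big_morph _ LD L0); apply: eq_bigr => b _; rewrite LZ.
Qed.

Lemma hess_pairing_radial_ge0 m (al : seq 'M[K]_n) (h1 h2 : R) (z : V) :
  (0 < m)%N -> (m <= n)%N -> size al = m.-1 -> (forall A, A \in al -> m_positive m A) ->
  0 <= h1 -> h2 <= 0 -> 0 <= n%:R * h1 + m%:R * h2 * sqn z ->
  0 <= hess_pairing (al ++ nseq (n - m) 1%:M)
    (\matrix_(a, b) (2 * (a == b)%:R * h1 + 4 * z ord0 a * z ord0 b * h2)).
Proof.
move=> m0 mn sal pal h1_ge0 h2_le0 h; rewrite /hess_pairing form_of_radial.
set A := _ + _; have pA : m_positive m A.
  apply: (@m_positive_rank1 R n m h1 h2 (zcoord z)) => //.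
  rewrite (_ : \sum_j _ = sqn z)// /sqn big_split_ord /= -big_split /=.
  by apply: eq_bigr => j _.
have := @garding_positivity R n m m0 mn (A :: al).
rewrite /= sal prednK// => /(_ erefl).
case: (wedge _) => a b /= H.
have : (0 <= Complex a b :> K).
  by apply: H => B; rewrite in_cons => /predU1P[->//|/pal].
by rewrite lecE /= => /andP[].
Qed.

End hessian_form.

Section test_functions.
Context {R : realType} {n : nat}.
Local Notation d := (n + n)%N.
Local Notation V := 'rV[R]_d.
Variables (chi : V -> R) (K : set V).
Hypotheses (schi : smooth chi) (cK : compact K) (chiK : forall z, ~ K z -> chi z = 0).
Hypothesis K1 : forall z, K z -> sqn z <= 1.
Implicit Types s : seq 'I_d.

Lemma iter_partial_is_derive s (a : 'I_d) (z : V) :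
  is_derive z (delta_mx ord0 a : V) (foldr partial chi s) (foldr partial chi (a :: s) z).
Proof.
by apply: DeriveDef => //; apply: diff_derivable; exact: schi.
Qed.

(** The complement of the compact [K] is open, so [chi] vanishes near each of its points. *)
Lemma iter_partial_out s z : ~ K z -> foldr partial chi s z = 0.
Proof.
elim: s z => [|a s IH] z Kz; first exact: chiK.
have oK : open (~` K) by apply: closed_openC; apply: compact_closed => //; exact: norm_hausdorff.
have E : \forall w \near z, 0 = foldr partial chi s w.
  have : nbhs z (~` K) by move: oK; rewrite openE; exact.
  by apply: filterS => w /IH.
have := @near_eq_is_derive _ _ _ (fun=> 0) (foldr partial chi s) z
  (delta_mx ord0 a : V) 0 E (is_derive_cst _ _ _).
by move=> [_ <-].
Qed.

Lemma iter_partial_supp s : supp_in 1 (foldr partial chi s).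
Proof.
move=> z /eqP fz i; have : K z by apply: contrapT => /(iter_partial_out s).
move=> /K1; apply: contraTT; rewrite -!ltNge => h.
rewrite /sqn (bigD1 i)//=; apply: ltr_wpDr; first by apply: sumr_ge0 => j _; exact: sqr_ge0.
by rewrite -real_normK ?num_real// exprn_egt1.
Qed.

Lemma iter_partial_cont_supp s : cont_supp (foldr partial chi s).
Proof.
split; last by exists 1; exact: iter_partial_supp.
by move=> z; apply: differentiable_continuous; exact: schi.
Qed.

Lemma Int_second_partial (u : V -> R) (u1 : 'I_d -> V -> R) (u2 : 'I_d -> 'I_d -> V -> R) a b :
  continuous u -> (forall i, continuous (u1 i)) -> (forall i j, continuous (u2 i j)) ->
  (forall i x, is_derive x (delta_mx ord0 i : V) u (u1 i x)) ->
  (forall i j x, is_derive x (delta_mx ord0 j : V) (u1 i) (u2 i j x)) ->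
  Int (fun x => u x * partial a (partial b chi) x) = Int (fun x => u2 a b x * chi x).
Proof.
move=> cu cu1 cu2 du du1.
have cs := iter_partial_cont_supp.
have -> : Int (fun x => u x * partial a (partial b chi) x) = - Int (fun x => u1 a x * partial b chi x).
  apply: (Int_by_parts (delta_mx ord0 a)) => //.
  - exact: (cs [:: b]).
  - exact: (cs [:: a; b]).
  - exact: (iter_partial_is_derive [:: b]).
have -> : Int (fun x => u1 a x * partial b chi x) = - Int (fun x => u2 a b x * chi x).
  apply: (Int_by_parts (delta_mx ord0 b)) => //.
  - exact: (cs [::]).
  - exact: (cs [:: b]).
  - exact: (iter_partial_is_derive [::]).
by rewrite opprK.
Qed.

End test_functions.

Section current.
Context {R : realType} {n : nat} (al ga s0 : R) (m : nat).
Local Notation d := (n + n)%N.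
Local Notation V := 'rV[R]_d.
Local Notation RM := (measurableTypeR R).
Local Notation mu := (@lebesgue R d).
Local Notation C := (complex R).
Hypotheses (m0 : (0 < m)%N) (mn : (m < n)%N) (al0 : 0 < al) (aln : al <= n%:R).
Hypothesis ga_gt : al / n%:R < ga.
Hypothesis s001 : 0 < s0 < 1.
Hypothesis signs : forall s, 0 < s <= s0 -> [/\ 0 <= prof1 al ga s, prof2 al ga s <= 0 &
  0 <= n%:R * prof1 al ga s + m%:R * (s * prof2 al ga s)].
Variable As : seq 'M[C]_n.
Hypotheses (sAs : size As = m.-1) (pAs : forall A, A \in As -> m_positive m A).
Let n0 : (0 < n)%N. Proof. exact: leq_ltn_trans mn. Qed.
Local Notation tl := (As ++ nseq (n - m) (1%:M : 'M[C]_n)).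

(** The sign condition holds at [s + e]; with [h'' <= 0], putting [s] for the factor [s + e] only
    helps. *)
Lemma approx_pairing_ge0 k (x : V) : sqn x <= s0 / 2 ->
  0 <= hess_pairing tl (\matrix_(a, b) approx2 al ga s0 k a b x).
Proof.
move=> xs; rewrite /approx2 /radial2 reg1E// reg2E//.
have s_gt0 : 0 < sqn x + eps s0 k by rewrite ltr_wpDl ?sqn_ge0// eps_gt0.
have /signs[] : 0 < sqn x + eps s0 k <= s0 by rewrite s_gt0 half_eps.
move: (prof1 _ _ _) (prof2 _ _ _) => p1 p2 p1_ge0 p2_le0 p_ge0.
apply: hess_pairing_radial_ge0 => //; first exact: ltnW.
apply: le_trans p_ge0 _; rewrite lerD2l -mulrA ler_wpM2l// mulrC ler_wnM2l//.
by rewrite lerDl ltW// eps_gt0.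
Qed.

Variables (chi : V -> R) (K : set V).
Hypotheses (schi : smooth chi) (cK : compact K) (chiK : forall z, ~ K z -> chi z = 0).
Hypothesis K_half : forall z, K z -> sqn z <= s0 / 2.
Hypothesis chi_ge0 : forall z, 0 <= chi z.
Let K1 z : K z -> sqn z <= 1.
Proof.
move=> /K_half/le_trans; apply; case/andP: s001 => h1 h2.
by rewrite ler_pdivrMr// mul1r (le_trans (ltW h2))// ler1n.
Qed.

Let q a b := hess_pairing tl (delta_mx a b).
Let W (x : V) := complex.Re (wedge (ddc chi x :: tl)).

Lemma current_densityE x : W x = \sum_a \sum_b q a b * foldr partial chi [:: a; b] x.
Proof.
rewrite /W ddcE -/(hess_pairing tl _) hess_pairingE//.
by apply: eq_bigr => a _; apply: eq_bigr => b _; rewrite mxE mulrC.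
Qed.

Lemma current_density_out x : ~ K x -> W x = 0.
Proof.
move=> Kx; rewrite current_densityE big1// => a _; rewrite big1// => b _.
by rewrite (iter_partial_out chi K)// mulr0.
Qed.

Let csp := iter_partial_cont_supp chi K schi cK chiK K1.

Lemma current_density_cont_supp : cont_supp W.
Proof.
rewrite (_ : W = fun x => \sum_a \sum_b q a b * foldr partial chi [:: a; b] x); last first.
  by apply/funext => x; exact: current_densityE.
by do 2!apply: cont_supp_sum => ?; apply: cont_suppZ; exact: csp.
Qed.

Lemma approx_current_ge0 k : 0 <= Int (fun x => approx al ga s0 k x * W x).
Proof.
have cu := approx_continuous al ga s0 s001 k.
have cu1 := approx1_continuous al ga s0 s001 k.
have cu2 := approx2_continuous al ga s0 s001 k.
set u := approx al ga s0 k in cu *.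
have cs a b : cont_supp (fun x => u x * foldr partial chi [:: a; b] x).
  by apply: cont_suppMl => //; exact: csp.
have cs2 a b : cont_supp (fun x => approx2 al ga s0 k a b x * chi x).
  by apply: cont_suppMl => //; exact: (csp [::]).
have -> : Int (fun x => u x * W x) =
    Int (fun x => \sum_a \sum_b q a b * (u x * foldr partial chi [:: a; b] x)).
  congr Int; apply/funext => x; rewrite current_densityE mulr_sumr; apply: eq_bigr => a _.
  by rewrite mulr_sumr; apply: eq_bigr => b _; rewrite mulrCA.
(* Two integrations by parts move the Hessian from [chi] to the approximation, term by term since
   the pairing is linear in the Hessian. *)
have -> : Int (fun x => \sum_a \sum_b q a b * (u x * foldr partial chi [:: a; b] x)) =
    Int (fun x => \sum_a \sum_b q a b * (approx2 al ga s0 k a b x * chi x)).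
  rewrite !Int_sum; last 2 first.
  - by move=> a; apply: cont_supp_sum => b; exact: cont_suppZ.
  - by move=> a; apply: cont_supp_sum => b; exact: cont_suppZ.
  apply: eq_bigr => a _; rewrite !Int_sum; last 2 first.
  - by move=> b; exact: cont_suppZ.
  - by move=> b; exact: cont_suppZ.
  apply: eq_bigr => b _; rewrite (IntZ (q a b) _ (cs a b)) (IntZ (q a b) _ (cs2 a b)).
  congr (_ * _); apply: (Int_second_partial chi K schi cK chiK K1 u (approx1 al ga s0 k)) => //.
  - by move=> i x; exact: approx_derive_delta.
  - by move=> i j x; exact: approx1_derive.
apply: Int_ge0 => x; have [Kx|Kx] := pselect (K x); last first.
  by rewrite big1// => a _; rewrite big1// => b _; rewrite chiK// !mulr0.
rewrite (_ : \sum_a _ = hess_pairing tl (\matrix_(a, b) approx2 al ga s0 k a b x) * chi x).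
  by rewrite mulr_ge0// approx_pairing_ge0// K_half.
rewrite hess_pairingE// mulr_suml; apply: eq_bigr => a _.
by rewrite mulr_suml; apply: eq_bigr => b _; rewrite mxE; ring.
Qed.

Lemma phi_current_ge0 (B : set V) : open B -> K `<=` B -> (forall z, B z -> sqn z <= s0 / 2) ->
  (0 <= \int[mu]_(t in @rv_of R d @^-1` B) (phi al ga (rv_of t) * (W (rv_of t))%:E))%E.
Proof.
move=> oB KB B_half; set D := _ @^-1` _; have mD : measurable D by exact: open_measurable_rv.
have half01 : 0 < s0 / 2 < 1.
  by case/andP: s001 => h1 h2; rewrite divr_gt0//= ltr_pdivrMr// mul1r (lt_trans h2)// ltr1n.
have /andP[_ half1] := half01.
have D_half t : D t -> sqn (rv_of t) <= s0 / 2 by exact: B_half.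
have cW := current_density_cont_supp; have [M M0 WM] := cont_supp_bounded _ cW.
have mW : measurable_fun setT (W \o @rv_of R d : _ -> RM).
  by apply: continuous_measurable_rv; case: cW.
have cu k : cont_supp (fun x => approx al ga s0 k x * W x).
  by apply: cont_suppMl => //; exact: approx_continuous.
have mphi := measurable_phi al ga (s0 / 2) half01 D D_half.
have i_phi : mu.-integrable D (phi al ga \o @rv_of R d).
  exact: (phi_integrable al ga n0 al0 ga_gt (s0 / 2)).
have aeD t : ~ origin t -> D t -> rv_of t != 0 /\ sqn (rv_of t) < 1.
  move=> /negP t0 Dt; split => //.
  by apply: le_lt_trans half1; exact: D_half.
apply: (@dominated_ge0 _ _ _ mu D
  (fun k t => (approx al ga s0 k (rv_of t) * W (rv_of t))%:E) _
  (fun t => M%:E * `|phi al ga (rv_of t)|)%E) => //.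
- move=> k; apply: measurable_funTS; apply/measurable_EFinP.
  by apply: (@continuous_measurable_rv R d (fun x => approx al ga s0 k x * W x)); case: (cu k).
- apply: emeasurable_funM; first exact: mphi.
  by apply: measurable_funTS; apply/measurable_EFinP.
- exists origin; split; [exact: measurable_origin|exact: origin_null|].
  move=> t /= H; apply: contrapT => nt; apply: H => Dt; have [t0 t1] := aeD t nt Dt.
  rewrite phiE// -EFinM; apply: cvg_EFin; first exact: nearW.
  by apply: cvgMl; apply: approx_cvg => //; exact: D_half.
- by apply: integrableZl => //; exact: integrable_abse.
- exists origin; split; [exact: measurable_origin|exact: origin_null|].
  move=> t /= H; apply: contrapT => nt; apply: H => k Dt; have [t0 t1] := aeD t nt Dt.
  rewrite phiE// !abse_EFin -EFinM lee_fin normrM mulrC ler_pM//.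
  rewrite [leRHS]ler0_norm; last by rewrite oppr_le0 expR_ge0.
  by apply: (approx_bound al ga s0 m s001 signs k) => //; exact: D_half.
(* The density vanishes off [K], a subset of [B], so the integral over [B] is one over the whole
   space. *)
- move=> k; rewrite integral_mkcond.
  rewrite (_ : _ \_ D = fun t => (approx al ga s0 k (rv_of t) * W (rv_of t))%:E).
    by rewrite (IntE _ (cu k)) lee_fin approx_current_ge0.
  apply/funext => t; rewrite /patch; case: ifPn => // /negP tD.
  rewrite current_density_out ?mulr0// => Kt; apply: tD; rewrite inE.
  exact: KB.
Qed.

End current.

(** * m-subharmonicity and exponents on a fixed ball *)

Section assembly.
Context {R : realType} {n : nat} (al ga s0 : R) (m : nat).
Local Notation d := (n + n)%N.
Local Notation V := 'rV[R]_d.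
Hypotheses (m0 : (0 < m)%N) (mn : (m < n)%N) (al0 : 0 < al) (aln : al <= n%:R).
Hypothesis ga_gt : al / n%:R < ga.
Hypothesis s001 : 0 < s0 < 1.
Hypothesis signs : forall s, 0 < s <= s0 -> [/\ 0 <= prof1 al ga s, prof2 al ga s <= 0 &
  0 <= n%:R * prof1 al ga s + m%:R * (s * prof2 al ga s)].
Variable rho : R.
Hypotheses (rho0 : 0 < rho) (rho_s0 : rho ^+ 2 <= s0 / 4).
Let n0 : (0 < n)%N. Proof. exact: leq_ltn_trans mn. Qed.
Let s0_gt0 : 0 < s0. Proof. by case/andP: s001. Qed.
Let B_half (z : V) : cball 0 rho z -> sqn z <= s0 / 2.
Proof. by rewrite cballE// => /= h; apply: ltW; apply: lt_le_trans h _; have := rho_s0; have := s0_gt0; lra. Qed.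
Let half01 : 0 < s0 / 2 < 1.
Proof.
by case/andP: s001 => h1 h2; rewrite divr_gt0//= ltr_pdivrMr// mul1r (lt_trans h2)// ltr1n.
Qed.

Lemma phi_m_subharmonic : m_subharmonic m (cball (0 : V) rho) (phi al ga).
Proof.
split.
- exact: cball_open.
- by move=> z _; rewrite /phi; case: ifP => _; rewrite ?ltNyr ?ltry.
- exact: (phi_locally_integrable al ga s0).
- exact: (phi_subharmonic al ga s0 m).
- move=> As pAs chi [schi [K [cK KB chiK]]] chi_ge0.
  apply: (phi_current_ge0 al ga s0 m m0 mn al0 aln ga_gt s001 signs As _ _ chi K) => //.
  + by rewrite size_tuple.
  + by move=> A /tnthP[j ->].
  + by move=> z /KB; exact: B_half.
  + exact: cball_open.
Qed.

Lemma phi_exponents :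
  [set p : R | 0 < p /\ integrable_near (cball (0 : V) rho) 0 (fun z => (`|phi al ga z| `^ p)%E)] =
  [set p : R | 0 < p <= n%:R / al].
Proof.
apply/seteqP; split => p /=.
  move=> [p0 [U [oU U0 UB iU]]]; rewrite p0 /= leNgt; apply/negP => pn.
  apply: (phi_power_not_integrable al ga n0 al0 ga_gt (s0 / 2) half01 _ p U pn oU U0 iU).
  move=> s t s_gt0 st ts; apply: (prof_nondecreasing al ga s0 m s001 signs) => //.
  by apply: le_trans ts _; rewrite ler_pdivrMr// ler_peMr ?ler1n// ltW.
move=> pn; have /andP[p0 _] := pn; split=> //.
exists (cball 0 rho); split => //; first exact: cball_open.
  by rewrite cballE//= (_ : sqn 0 = 0) ?exprn_gt0//; apply/eqP; rewrite sqn_eq0.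
apply: (phi_power_integrable al ga n0 al0 ga_gt (s0 / 2) half01) => //.
  by apply: open_measurable_rv; exact: cball_open.
by move=> t; exact: B_half.
Qed.

End assembly.
Theorem proposition5p2 (R : realType) (n m : nat) (alpha gamma : R)
    (m_ge1 : (1 <= m)%N) (m_lt_n : (m < n)%N)
    (alpha_gt0 : 0 < alpha) (alpha_lt_cm : alpha < (n%:R - m%:R) / m%:R)
    (gamma_gt : alpha / n%:R < gamma) :
  exists r0 : R, 0 < r0 < 1 /\
    forall r : R, 0 < r <= r0 ->
      let B : set 'rV[R]_(n + n) := cball 0 r in
      m_subharmonic m B (phi alpha gamma) /\
      [set p : R | 0 < p /\
         integrable_near B 0 (fun z => (`|phi alpha gamma z| `^ p)%E)] =
      [set p : R | 0 < p <= n%:R / alpha].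
Proof.
have m_gt0 : 0 < m%:R :> R by rewrite ltr0n.
have n_gt0 : 0 < n%:R :> R by rewrite ltr0n; exact: leq_ltn_trans m_lt_n.
have gamma_gt0 : 0 < gamma by apply: lt_trans gamma_gt; exact: divr_gt0.
(* From [(n - m)/m <= n/m <= n]; this places the exponent 1 in the integrable range. *)
have alpha_le_n : alpha <= n%:R.
  apply: ltW; apply: (lt_le_trans alpha_lt_cm).
  rewrite ler_pdivrMr//; apply: (@le_trans _ _ n%:R); first by rewrite gerBl ltW.
  by rewrite ler_peMr ?ler1n// ltW.
have [s0 s001 signs] := prof_signs alpha gamma alpha_gt0 gamma_gt0 n%:R m%:R m_gt0 alpha_lt_cm.
have /andP[s0_gt0 s0_lt1] := s001.
have q_gt0 : 0 < s0 / 4 by rewrite divr_gt0.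
exists (Num.sqrt (s0 / 4)); split.
  rewrite sqrtr_gt0 q_gt0 -[ltRHS]sqrtr1 ltr_sqrt//.
  by rewrite ltr_pdivrMr// mul1r (lt_trans s0_lt1)// ltr1n.
move=> r /andP[r_gt0 r_le] B.
have r_s0 : r ^+ 2 <= s0 / 4.
  by rewrite -[leRHS]sqr_sqrtr ?(ltW q_gt0)// ler_pXn2r ?nnegrE ?(ltW r_gt0)// sqrtr_ge0.
split; first exact: (phi_m_subharmonic alpha gamma s0 m).
exact: (phi_exponents alpha gamma s0 m).
Qed.
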